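(* Let $X_M=\sum_{n\ge1}\delta_{(X_n,M_n)}$ be a stationary (simple) marked point process on $\mathbb{R}^d$ with Polish mark space $\mathbb{M}$ and intensity $\lambda>0$, satisfying Condition $\beta(\delta)$, and let $\{W_k\}$ be a convex averaging sequence in $\mathbb{R}^d$. For $C\in\mathcal{B}(\mathbb{M})$ put $$Y_k(C)=\frac{1}{\sqrt{|W_k|}}\sum_{n\ge1}\mathbf{1}_{W_k}(X_n)\bigl(\mathbf{1}_C(M_n)-P_M^{\mathbf{o}}(C)\bigr).$$ Then for any $\ell\ge 1$ and any $C_1,\dots,C_\ell\in\mathcal{B}(\mathbb{M})$, as $k\to\infty$, $$\mathbf{Y}_k=\bigl(Y_k(C_1),\dots,Y_k(C_\ell)\bigr)^\top\ \longrightarrow\ \mathcal{N}_\ell(\mathbf{o}_\ell,\mathbf{\Sigma})\quad\text{in distribution},$$ where $\mathbf{o}_\ell=(0,\dots,0)^\top$ and the asymptotic covariance matrix $\mathbf{\Sigma}=(\sigma_{ij})_{i,j=1}^\ell$ is given by the limits $$\sigma_{ij}=\lim_{k\to\infty}\mathbb{E}\,Y_k(C_i)Y_k(C_j).$$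
   Context: A marked point process (MPP) $X_M=\sum_{n\ge1}\delta_{(X_n,M_n)}$ is a random counting measure on $\mathcal{B}(\mathbb{R}^d\times\mathbb{M})$, with $\mathbb{M}$ Polish, such that $X_M(B\times\mathbb{M})<\infty$ for all bounded Borel $B\subset\mathbb{R}^d$; it is defined on a probability space $(\Omega,\mathcal{A},\mathbb{P})$. Throughout, $X_M$ is simple: all locations $X_n$ have multiplicity one regardless of their marks. It is stationary if $\sum_n\delta_{(X_n-x,M_n)}$ has the same distribution as $X_M$ for all $x\in\mathbb{R}^d$. The intensity is $\lambda=\mathbb{E}X_M([0,1)^d\times\mathbb{M})$ (finite), and the Palm mark distribution is $P_M^{\mathbf{o}}(C)=\lambda^{-1}\mathbb{E}X_M([0,1)^d\times C)$, $C\in\mathcal{B}(\mathbb{M})$. $|\cdot|$ denotes Lebesgue measure on $\mathbb{R}^d$, and $\mathcal{N}_\ell(a,\mathbf{\Sigma})$ denotes an $\ell$-dimensional Gaussian vector with mean $a$ and (possibly singular) covariance matrix $\mathbf{\Sigma}$. A convex averaging sequence (CAS) is an increasing sequence $\{W_k\}$ of convex compact sets in $\mathbb{R}^d$ with $\varrho(W_k)=\sup\{r>0: B(x,r)\subset W_k\text{ for some }x\in W_k\}\to\infty$, where $B(x,r)$ is the closed Euclidean ball. Mixing: for Borel $B\subset\mathbb{R}^d$, $\mathcal{A}_{X_M}(B)$ is the sub-$\sigma$-algebra of $\mathcal{A}$ generated by the restriction of $X_M$ to $B\times\mathbb{M}$. The $\beta$-mixing coefficient is $$\beta(\mathcal{A}_{X_M}(B),\mathcal{A}_{X_M}(B'))=\tfrac12\sup\sum_{i,j}|\mathbb{P}(A_i\cap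 A_j')-\mathbb{P}(A_i)\mathbb{P}(A_j')|,$$ the supremum being over all finite partitions $\{A_i\}$, $\{A'_j\}$ of $\Omega$ with $A_i\in\mathcal{A}_{X_M}(B)$, $A_j'\in\mathcal{A}_{X_M}(B')$. With $K_a=[-a,a]^d$ and $K_a^c=\mathbb{R}^d\setminus K_a$, the mixing rates $\beta^*_{X_M},\beta^{**}_{X_M}:[\frac12,\infty)\to[0,\infty)$ are non-increasing functions such that $$\beta(\mathcal{A}_{X_M}(K_a),\mathcal{A}_{X_M}(K^c_{a+b}))\le\begin{cases}\beta^*_{X_M}(b)&\text{for }\frac12\le a\le b,\\ a^{d-1}\beta^{**}_{X_M}(b)&\text{for }\frac12\le b\le a.\end{cases}$$ Condition $\beta(\delta)$: there exists some $\delta>0$ such that $\mathbb{E}\bigl(X_M([0,1]^d\times\mathbb{M})\bigr)^{2+\delta}<\infty$, $\int_1^\infty r^{d-1}\bigl(\beta^*_{X_M}(r)\bigr)^{\delta/(2+\delta)}\,dr<\infty$, and $r^{2d-1}\beta^{**}_{X_M}(r)\to0$ as $r\to\infty$. *)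

(* Defs.v *)
From HB Require Import structures.
From mathcomp Require Import all_boot all_order all_algebra.
From mathcomp Require Import all_classical all_reals all_analysis measurable_realfun.

Set Implicit Arguments.
Unset Strict Implicit.
Unset Printing Implicit Defensive.

Import Order.TTheory GRing.Theory Num.Theory.
Import numFieldNormedType.Exports.

Local Open Scope classical_set_scope.
Local Open Scope ring_scope.

(* T carrying its Borel sigma-algebra; convertible to T. *)
Notation borel T := (g_sigma_algebraType (@open T)).

Section Spaces.
Context {R : realType}.

Definition polish (M : topologicalType) : Prop :=
  (exists rho : M -> M -> R,
    [/\ forall x y, (rho x y = 0) <-> (x = y),
        forall x y, rho x y = rho y x,
        forall x y z, rho x z <= rho x y + rho y z,
        forall x (A : set M),
          nbhs x A <-> exists2 e, 0 < e & [set y | rho x y < e] `<=` A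
      & forall u : nat -> M,
          (forall e, 0 < e -> exists N : nat, forall m n : nat,
             (N <= m)%N -> (N <= n)%N -> rho (u m) (u n) < e) ->
          exists l : M, u @ \oo --> l])
  /\ exists D : set M, countable D /\ dense D.

Context {d : nat}.

(* The norm of 'rV[R]_d in the library is the sup norm, hence this one. *)
Definition eucl_norm (x : 'rV[R]_d) : R := Num.sqrt (\sum_i x 0 i ^+ 2).

Definition eucl_cball (x : 'rV[R]_d) (r : R) : set 'rV[R]_d :=
  [set y | eucl_norm (y - x) <= r].

(* Lebesgue measure on R^d, as the outer measure generated by half-open boxes:
   the exact analogue of the construction of lebesgue_measure on R. *)
Definition lebesgue_d (A : set 'rV[R]_d) : \bar R :=
  ereal_inf [set v | exists a b : nat -> 'rV[R]_d,
    [/\ forall k i, a k 0 i <= b k 0 i,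
        A `<=` \bigcup_k [set x : 'rV_d | forall i, a k 0 i < x 0 i <= b k 0 i]
      & v = (\sum_(0 <= k <oo) (\prod_i (b k 0 i - a k 0 i))%:E)%E]].

Definition halfopen_unit_cube : set 'rV[R]_d :=
  [set x | forall i, 0 <= x 0 i < 1].
Definition closed_unit_cube : set 'rV[R]_d :=
  [set x | forall i, 0 <= x 0 i <= 1].
Definition cube (a : R) : set 'rV[R]_d :=
  [set x | forall i, - a <= x 0 i <= a].

(* Extended-real valued: -oo when W contains no ball of positive radius. *)
Definition inradius (W : set 'rV[R]_d) : \bar R :=
  ereal_sup [set r%:E | r in
    [set r : R | 0 < r /\ exists2 x, W x & eucl_cball x r `<=` W]].

Definition convex_averaging_sequence (W : nat -> set 'rV[R]_d) : Prop :=
  [/\ forall m n : nat, (m <= n)%N -> W m `<=` W n,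
      forall k, convex_set (W k),
      forall k, compact (W k)
    & inradius (W k) @[k --> \oo] --> +oo%E].

End Spaces.

Section BetaCoefficient.
Context {disp : measure_display} {Omega : measurableType disp} {R : realType}.

Definition beta_coeff (P : probability Omega R)
    (F G : set_system Omega) : \bar R :=
  ((2^-1)%:E * ereal_sup [set s | exists m n : nat,
     exists (A : 'I_m -> set Omega) (B : 'I_n -> set Omega),
     [/\ partition setT A setT /\ (forall i, F (A i)),
         partition setT B setT /\ (forall j, G (B j))
       & s = \sum_(i < m) \sum_(j < n)
               `| P (A i `&` B j) - P (A i) * P (B j) | ] ])%E.

End BetaCoefficient.

(* sigma-algebra generated by the evaluations N |-> N A, A measurable. It is put
   on all set functions, so that restrictions and translates of a measure can
   be formed without measurability proofs; its trace on measures is the usual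
   sigma-algebra of the space of (counting) measures. *)
Definition evaluation_salgebra {disp : measure_display}
    (S : measurableType disp) (R : realType) : set_system (set S -> \bar R) :=
  <<s \bigcup_(A in (measurable : set (set S)))
        preimage_set_system setT (fun N : set S -> \bar R => N A)
          measurable >>.

Section MarkedPointProcess.
Context {disp : measure_display} {Omega : measurableType disp} {R : realType}
  (P : probability Omega R) {d : nat} {M : ptopologicalType}.

Local Notation Rd := (borel 'rV[R]_d).
Local Notation S := (Rd * borel M)%type.

(* A kernel is exactly a random measure: X w is a measure for each w, and
   w |-> X w A is measurable for each measurable A. *)
Variable X : R.-ker Omega ~> S.

(* The number of points may be finite or infinite, whence the index set I. *)
Definition marked_point_process : Prop :=
  (forall w, exists (I : set nat) (x : nat -> Rd) (m : nat -> borel M),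
     forall A : set S, measurable A ->
       X w A = (\esum_(n in I) \d_(x n, m n) A)%E) /\
  (forall w (B : set Rd), measurable B -> bounded_set (B : set 'rV[R]_d) ->
     (X w (B `*` setT) < +oo)%E).

Definition simple_point_process : Prop :=
  {ae P, forall w, forall x : Rd, (X w ([set x] `*` setT) <= 1)%E}.

Definition translate (x : 'rV[R]_d) (p : S) : S := (p.1 - x, p.2).

Definition stationary : Prop :=
  forall (x : 'rV[R]_d) (E : set (set S -> \bar R)),
    evaluation_salgebra E ->
    P [set w | E (pushforward (X w) (translate x))] =
    P [set w | E (X w : set S -> \bar R)].

Definition intensity : \bar R :=
  (\int[P]_w X w ((halfopen_unit_cube : set Rd) `*` setT))%E.

Definition palm_mark (C : set (borel M)) : R :=
  (fine intensity)^-1 *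
  fine (\int[P]_w X w ((halfopen_unit_cube : set Rd) `*` C))%E.

Definition restricted_salgebra (B : set Rd) : set_system Omega :=
  preimage_set_system setT
    (fun w => (fun A => X w (A `&` (B `*` setT))) : set S -> \bar R)
    (@evaluation_salgebra _ S R).

(* The rates are functions on [1/2, oo); their values elsewhere are not used. *)
Definition nonincreasing_rate (f : R -> R) : Prop :=
  (forall r, 2^-1 <= r -> 0 <= f r) /\
  (forall r s, 2^-1 <= r -> r <= s -> f s <= f r).

Definition mixing_rates (bs bss : R -> R) : Prop :=
  [/\ nonincreasing_rate bs, nonincreasing_rate bss,
      forall a b : R, 2^-1 <= a -> a <= b ->
        (beta_coeff P (restricted_salgebra (cube a))
                      (restricted_salgebra (~` cube (a + b))) <= (bs b)%:E)%E
    & forall a b : R, 2^-1 <= b -> b <= a ->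
        (beta_coeff P (restricted_salgebra (cube a))
                      (restricted_salgebra (~` cube (a + b)))
         <= (a ^+ d.-1 * bss b)%:E)%E].

Definition condition_beta (bs bss : R -> R) : Prop :=
  exists delta : R,
  [/\ 0 < delta,
      (\int[P]_w (X w ((closed_unit_cube : set Rd) `*` setT)
                    `^ (2 + delta)%R) < +oo)%E,
      (\int[lebesgue_measure]_(r in `[1%R, +oo[)
         (r ^+ d.-1 * bs r `^ (delta / (2 + delta)))%R%:E < +oo)%E
    & r ^+ (2 * d).-1 * bss r @[r --> +oo] --> (0 : R)].

Definition mark_fluct (W : set 'rV[R]_d) (C : set (borel M)) (w : Omega) : R :=
  (Num.sqrt (fine (lebesgue_d W)))^-1 *
  \int[X w]_p (\1_W p.1 * (\1_C p.2 - palm_mark C)).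

End MarkedPointProcess.

Section Gaussian.
Context {R : realType}.

(* Normal law with mean m and variance v >= 0. The degenerate case has to be
   singled out since normal_prob m 0 is a uniform law in the library. *)
Definition normal_law (m v : R) : set R -> \bar R :=
  if v == 0 then \d_m else normal_prob m (Num.sqrt v).

Definition gaussian_vector {l : nat} (nu : probability (borel 'rV[R]_l) R)
    (a : 'rV[R]_l) (Sigma : 'M[R]_l) : Prop :=
  [/\ forall t : 'rV[R]_l, exists m v : R, 0 <= v /\
        forall B : set R, measurable B ->
          nu [set y : 'rV[R]_l | B (\sum_i t 0 i * y 0 i)] = normal_law m v B,
      forall i, (\int[nu]_y ((y : 'rV[R]_l) 0 i)%:E)%E = (a 0 i)%:E
    & forall i j, (\int[nu]_y (((y : 'rV[R]_l) 0 i - a 0 i) *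
                               ((y : 'rV[R]_l) 0 j - a 0 j))%R%:E)%E =
                  (Sigma i j)%:E].

Definition cvg_in_distribution {disp : measure_display}
    {Omega : measurableType disp} (P : probability Omega R) {l : nat}
    (V : nat -> Omega -> 'rV[R]_l) (nu : probability (borel 'rV[R]_l) R) :
    Prop :=
  forall f : 'rV[R]_l -> R, continuous f -> (exists K, forall y, `|f y| <= K) ->
    (\int[P]_w (f (V k w))%:E)%E @[k --> \oo] --> (\int[nu]_y (f y)%:E)%E.

End Gaussian.

(* Main.v *)
(** Cut the window W into its
    intersections with unit cells: the scores
      sum_i t_i (X(A x C_i) - P_M(C_i) X(A x M)),   A = (cell) /\ W,
    form a centred random field indexed by a finite piece of Z^d, bounded in L^(2 + delta)
    and alpha-mixing at the rate beta^* by stationarity.  Bolthausen's form of Stein's method bounds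
    E cos(V + th) - exp(- Var V / 2) cos th for the normalized sum V of such a field,
    uniformly in the field: with g(x) = sin(lambda x + th), the difference between E V g(V)
    and Var(V) E g'(V) is small, and the resulting differential inequality in lambda is
    integrated from 0 to 1.  Davydov's inequality removes the truncation.  The variances
    converge because all but a negligible proportion of the cells lie deep inside W; this
    is convexity, a ball of radius rho in W allowing to compare W with its homothetic
    images of ratio 1 +- s as soon as rho s is large.  Finally characteristic functions
    determine convergence in law: a continuous bounded function is approximated on boxes
    by trigonometric polynomials, built from Bernstein polynomials. *)

From HB Require Import structures.
From mathcomp Require Import all_boot all_order all_algebra.
From mathcomp Require Import all_classical all_reals all_analysis measurable_realfun.
From mathcomp Require Import ring lra zify.
Require Import Defs.
Import Order.TTheory GRing.Theory Num.Theory.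
Import numFieldNormedType.Exports.
Set Implicit Arguments.
Unset Strict Implicit.
Unset Printing Implicit Defensive.
Local Open Scope classical_set_scope.
Local Open Scope ring_scope.

(** * Expectations and covariances *)

(** The number and shapes of the cell pieces change with [k], so the theorem for fields cannot
    concern one fixed field: its threshold may depend only on [d], the mixing rate and the moment
    bound. The delicate parameter is the radius [m] of the neighbourhoods in Stein's method: for [n]
    cells both [sqrt n alpha(m)] and [m^d / sqrt n] must be small. The integral condition permits
    it: summed over dyadic shells it makes [2^(q d) alpha(2^q)^ka] tend to 0, where
    [ka = delta / (2 + delta) <= 1] is Davydov's exponent for moments of order [2 + delta], and
    [alpha <= alpha^ka]. Pieces cut by the boundary of [W] must be centred too; this is not
    contained in the definition of the Palm mark distribution and is drawn from stationarity. No
    closed formula for [Sigma] is produced: the variances of linear forms are shown to be Cauchy,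
    then polarized. As [Sigma] may be singular, nothing is divided by a variance, and the Gaussian
    law is built from a decomposition of [Sigma] into rank one terms. *)

Lemma measurable_sum_cond {disp : measure_display} {T : measurableType disp} {R : realType}
    (I : Type) (s : seq I) (Q : pred I) (F : I -> T -> R) :
  (forall i, Q i -> measurable_fun setT (F i)) ->
  measurable_fun setT (fun w => \sum_(i <- s | Q i) F i w).
Proof.
move=> mF; elim: s => [|i s IH].
  by under eq_fun do rewrite big_nil; exact: measurable_cst.
under eq_fun do rewrite big_cons.
by case Qi: (Q i) => //; apply: measurable_funD => //; exact: mF.
Qed.

Section Expectation.
Context {disp : measure_display} {T : measurableType disp} {R : realType}.
Variable P : probability T R.
Implicit Types f g : T -> R.

Definition L1 f := P.-integrable setT (EFin \o f).
Definition Ex f : R := fine (\int[P]_w (f w)%:E)%E.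

Lemma L1_meas f : L1 f -> measurable_fun setT f.
Proof. by move=> /integrableP[/measurable_EFinP]. Qed.

Lemma ExE f : L1 f -> (\int[P]_w (f w)%:E)%E = (Ex f)%:E.
Proof. by move=> Lf; rewrite fineK//; exact: integrable_fin_num. Qed.

Lemma L1_add f g : L1 f -> L1 g -> L1 (fun w => f w + g w).
Proof. by move=> Lf Lg; rewrite /L1; apply: eq_integrable (integrableD _ Lf Lg). Qed.

Lemma L1_scale c f : L1 f -> L1 (fun w => c * f w).
Proof. by move=> Lf; rewrite /L1; apply: eq_integrable (integrableZl _ c Lf). Qed.

Lemma L1_sub f g : L1 f -> L1 g -> L1 (fun w => f w - g w).
Proof. by move=> Lf Lg; rewrite /L1; apply: eq_integrable (integrableB _ Lf Lg). Qed.

Lemma L1_bounded f c : measurable_fun setT f -> (forall w, `|f w| <= c) -> L1 f.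
Proof.
move=> mf fc; apply: measurable_bounded_integrable => //.
  by rewrite (le_lt_trans (probability_le1 P measurableT)) ?ltry.
exists c; split; first exact: num_real.
by move=> y cy w _ /=; rewrite (le_trans (fc w))// ltW.
Qed.

Lemma L1_cst c : L1 (fun=> c).
Proof. by apply: (@L1_bounded _ `|c|) => // w. Qed.

Lemma L1_dom f g : measurable_fun setT f -> L1 g ->
  (forall w, `|f w| <= g w) -> L1 f.
Proof.
move=> mf Lg fg; apply: le_integrable Lg => //.
  exact/measurable_EFinP.
by move=> w _ /=; rewrite lee_fin (le_trans (fg w))// ler_norm.
Qed.

Lemma L1_abs f : L1 f -> L1 (fun w => `|f w|).
Proof.
move=> Lf; apply: (le_integrable _ _ _ Lf) => //.
  by apply/measurable_EFinP; apply: measurableT_comp => //; exact: L1_meas.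
by move=> w _ /=; rewrite normr_id.
Qed.

Lemma L1_sum (I : Type) (s : seq I) (Q : pred I) (F : I -> T -> R) :
  (forall i, Q i -> L1 (F i)) -> L1 (fun w => \sum_(i <- s | Q i) F i w).
Proof.
move=> LF; elim: s => [|i s IH].
  under eq_fun do rewrite big_nil; exact: L1_cst.
under eq_fun do rewrite big_cons.
case Qi: (Q i) => //.
by apply: L1_add => //; exact: LF.
Qed.

Lemma Ex_add f g : L1 f -> L1 g -> Ex (fun w => f w + g w) = Ex f + Ex g.
Proof. by move=> Lf Lg; exact: RintegralD. Qed.

Lemma Ex_sub f g : L1 f -> L1 g -> Ex (fun w => f w - g w) = Ex f - Ex g.
Proof. by move=> Lf Lg; exact: RintegralB. Qed.

Lemma Ex_scale c f : L1 f -> Ex (fun w => c * f w) = c * Ex f.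
Proof. by move=> Lf; exact: RintegralZl. Qed.

Lemma Ex_cst c : Ex (fun=> c) = c.
Proof.
by have := expectation_cst P c; rewrite unlock /Ex => ->.
Qed.

Lemma Ex_sum (I : Type) (s : seq I) (Q : pred I) (F : I -> T -> R) :
  (forall i, Q i -> L1 (F i)) ->
  Ex (fun w => \sum_(i <- s | Q i) F i w) = \sum_(i <- s | Q i) Ex (F i).
Proof.
move=> LF; elim: s => [|i s IH].
  by under eq_fun do rewrite big_nil; rewrite big_nil Ex_cst.
under eq_fun do rewrite big_cons; rewrite big_cons; case: ifPn => // Qi.
by rewrite Ex_add ?IH//; [exact: LF|exact: L1_sum].
Qed.

Lemma Ex_le f g : L1 f -> L1 g -> (forall w, f w <= g w) -> Ex f <= Ex g.
Proof. by move=> Lf Lg fg; apply: le_Rintegral. Qed.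

Lemma Ex_ge0 f : (forall w, 0 <= f w) -> 0 <= Ex f.
Proof. by move=> f0; apply: Rintegral_ge0. Qed.

Lemma Ex_abs f : L1 f -> `|Ex f| <= Ex (fun w => `|f w|).
Proof. by move=> Lf; apply: le_normr_Rintegral. Qed.

Lemma Ex_absle f g : L1 f -> L1 g -> (forall w, `|f w| <= g w) -> `|Ex f| <= Ex g.
Proof.
by move=> Lf Lg fg; apply: le_trans (Ex_abs Lf) (Ex_le (L1_abs Lf) Lg fg).
Qed.

Lemma Ex_absle_cst f c : L1 f -> (forall w, `|f w| <= c) -> `|Ex f| <= c.
Proof. by move=> Lf fc; rewrite -[leRHS]Ex_cst; apply: Ex_absle => //; exact: L1_cst. Qed.

Lemma L1_indic (A : set T) : measurable A -> L1 (\1_A).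
Proof.
move=> mA; apply: (@L1_bounded _ 1) => // w.
by rewrite indicE; case: (w \in A); rewrite /= ?normr1// normr0.
Qed.

Lemma Ex_indic (A : set T) : measurable A -> Ex (\1_A) = fine (P A).
Proof. by move=> mA; rewrite /Ex integral_indic// setIT. Qed.

Definition L2 f := measurable_fun setT f /\ L1 (fun w => f w ^+ 2).

Lemma L2_meas f : L2 f -> measurable_fun setT f.
Proof. by case. Qed.

Lemma L2_sqr f : L2 f -> L1 (fun w => f w ^+ 2).
Proof. by case. Qed.

Lemma L2_mul f g : L2 f -> L2 g -> L1 (fun w => f w * g w).
Proof.
move=> [mf Lf] [mg Lg]; apply: (L1_dom _ (L1_add Lf Lg)).
  exact: measurable_funM.
move=> w; rewrite ler_norml; apply/andP; split.
- have := sqr_ge0 (f w + g w); have := sqr_ge0 (f w); have := sqr_ge0 (g w); nra.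
- have := sqr_ge0 (f w - g w); have := sqr_ge0 (f w); have := sqr_ge0 (g w); nra.
Qed.

Lemma L2_bounded f c : measurable_fun setT f -> (forall w, `|f w| <= c) -> L2 f.
Proof.
move=> mf fc; split=> //; apply: (@L1_bounded _ (c ^+ 2)).
  exact: measurable_funX.
by move=> w; rewrite normrX lerXn2r ?nnegrE// (le_trans _ (fc w)).
Qed.

Lemma L2_L1 f : L2 f -> L1 f.
Proof.
move=> Lf; rewrite (_ : f = fun w => f w * 1); last by apply/funext => w; rewrite mulr1.
by apply: L2_mul => //; apply: (@L2_bounded _ 1) => // w; rewrite normr1.
Qed.

Lemma L2_cst c : L2 (fun=> c).
Proof. by apply: (@L2_bounded _ `|c|). Qed.

Lemma L2_add f g : L2 f -> L2 g -> L2 (fun w => f w + g w).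
Proof.
move=> Lf Lg; split; first by apply: measurable_funD; exact: L2_meas.
rewrite (_ : (fun w => _) = fun w => f w ^+ 2 + 2 * (f w * g w) + g w ^+ 2); last first.
  by apply/funext => w; ring.
apply: L1_add; last exact: L2_sqr.
by apply: L1_add; [exact: L2_sqr|apply: L1_scale; exact: L2_mul].
Qed.

Lemma L2_scale c f : L2 f -> L2 (fun w => c * f w).
Proof.
move=> [mf Lf]; split; first exact: measurable_funM.
under eq_fun do rewrite exprMn; exact: L1_scale.
Qed.

Lemma L2_sub f g : L2 f -> L2 g -> L2 (fun w => f w - g w).
Proof.
move=> Lf Lg; rewrite (_ : (fun w => _) = fun w => f w + (-1) * g w).
  by apply: L2_add => //; exact: L2_scale.
by apply/funext => w; rewrite mulN1r.
Qed.

Lemma L2_sum (I : Type) (s : seq I) (Q : pred I) (F : I -> T -> R) :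
  (forall i, Q i -> L2 (F i)) -> L2 (fun w => \sum_(i <- s | Q i) F i w).
Proof.
move=> LF; elim: s => [|i s IH].
  under eq_fun do rewrite big_nil; exact: L2_cst.
under eq_fun do rewrite big_cons.
case Qi: (Q i) => //.
by apply: L2_add => //; exact: LF.
Qed.

Lemma L2_dom f g : measurable_fun setT f -> L2 g ->
  (forall w, `|f w| <= g w) -> L2 f.
Proof.
move=> mf [mg Lg] fg; split=> //; apply: L1_dom Lg _; first exact: measurable_funX.
by move=> w; rewrite normrX lerXn2r ?nnegrE// (le_trans _ (fg w)).
Qed.

Lemma Ex_sqr_ge0 f : 0 <= Ex (fun w => f w ^+ 2).
Proof. by apply: Ex_ge0 => w; exact: sqr_ge0. Qed.

Lemma Ex_jensen f : L2 f -> Ex f ^+ 2 <= Ex (fun w => f w ^+ 2).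
Proof.
move=> Lf; rewrite -subr_ge0.
have := Ex_sqr_ge0 (fun w => f w - Ex f).
rewrite (_ : (fun w => _) = fun w => f w ^+ 2 - (2 * Ex f) * f w + Ex f ^+ 2); last first.
  by apply/funext => w; ring.
have L1f := L2_L1 Lf; have A := L1_scale (2 * Ex f) L1f; have B := L2_sqr Lf.
have C := L1_sub B A; have D := L1_cst (Ex f ^+ 2).
by rewrite Ex_add// Ex_sub// Ex_scale// Ex_cst => h; nra.
Qed.

Lemma Ex_abs_sqrt f : L2 f -> Ex (fun w => `|f w|) <= Num.sqrt (Ex (fun w => f w ^+ 2)).
Proof.
move=> Lf; have Laf : L2 (fun w => `|f w|).
  split; first by apply: measurableT_comp => //; exact: L2_meas.
  by under eq_fun do rewrite real_normK ?num_real//; exact: L2_sqr.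
rewrite -[leLHS]ger0_norm; last exact: Ex_ge0.
rewrite -sqrtr_sqr ler_sqrt ?Ex_sqr_ge0//.
apply: le_trans (Ex_jensen Laf) _.
by under eq_fun do rewrite real_normK ?num_real//.
Qed.

Definition cov f g := Ex (fun w => f w * g w) - Ex f * Ex g.

Lemma covC f g : cov f g = cov g f.
Proof. by rewrite /cov [Ex f * _]mulrC; under eq_fun do rewrite mulrC. Qed.

(** Both variables are centred; then [2 |x y| <= x^2 + y^2], and a variance is at most the second
    moment. It serves for pairs of indices that are too close for mixing to be used. *)
Lemma cov_le_sqr f g : L2 f -> L2 g ->
  `|cov f g| <= 2^-1 * (Ex (fun w => f w ^+ 2) + Ex (fun w => g w ^+ 2)).
Proof.
move=> Lf Lg; have [L1f L1g] := (L2_L1 Lf, L2_L1 Lg).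
pose f0 w := f w - Ex f; pose g0 w := g w - Ex g.
have E0 : cov f g = Ex (fun w => f0 w * g0 w).
  rewrite (_ : (fun w => f0 w * g0 w) = fun w => (f w * g w - Ex g * f w) - (Ex f * g w - Ex f * Ex g)); last first.
    by apply/funext => w; rewrite /f0 /g0; ring.
  have Lfg := L2_mul Lf Lg; have Lgf := L1_scale (Ex g) L1f; have Lfg' := L1_scale (Ex f) L1g.
  have Lc := L1_cst (Ex f * Ex g); have A := L1_sub Lfg Lgf; have B := L1_sub Lfg' Lc.
  by rewrite !Ex_sub// Ex_cst !Ex_scale// /cov; ring.
have Lf0 : L2 f0 by apply: L2_sub => //; exact: L2_cst.
have Lg0 : L2 g0 by apply: L2_sub => //; exact: L2_cst.
have var h (Lh : L2 h) : Ex (fun w => (h w - Ex h) ^+ 2) <= Ex (fun w => h w ^+ 2).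
  rewrite (_ : (fun w => _) = fun w => h w ^+ 2 - ((2 * Ex h) * h w - Ex h ^+ 2)); last first.
    by apply/funext => w; ring.
  have L1h := L2_L1 Lh; have A := L1_scale (2 * Ex h) L1h; have B := L1_cst (Ex h ^+ 2).
  have D := L2_sqr Lh; have C := L1_sub A B; rewrite !Ex_sub// Ex_cst Ex_scale//.
  by rewrite gerBl; have := sqr_ge0 (Ex h); nra.
rewrite E0; apply: (@le_trans _ _ (Ex (fun w => 2^-1 * (f0 w ^+ 2 + g0 w ^+ 2)))).
  apply: Ex_absle; first exact: L2_mul.
    by apply: L1_scale; apply: L1_add; exact: L2_sqr.
  move=> w; rewrite ler_norml; apply/andP; split.
  - by have := sqr_ge0 (f0 w + g0 w); nra.
  - by have := sqr_ge0 (f0 w - g0 w); nra.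
have [A B] := (L2_sqr Lf0, L2_sqr Lg0).
rewrite Ex_scale ?Ex_add//; last exact: L1_add.
by rewrite ler_pM2l ?invr_gt0// lerD// var.
Qed.

Lemma Ex_sqr_sum (I : finType) (Q : pred I) (F : I -> T -> R) :
  (forall i, Q i -> L2 (F i)) ->
  Ex (fun w => (\sum_(i | Q i) F i w) ^+ 2) =
  \sum_(i | Q i) \sum_(j | Q j) Ex (fun w => F i w * F j w).
Proof.
move=> LF.
rewrite (_ : (fun w => _) = fun w => \sum_(i | Q i) \sum_(j | Q j) F i w * F j w); last first.
  by apply/funext => w; rewrite expr2 mulr_suml; apply: eq_bigr => i _; rewrite mulr_sumr.
rewrite Ex_sum; last by move=> i Qi; apply: L1_sum => j Qj; apply: L2_mul; exact: LF.
apply: eq_bigr => i Qi; rewrite Ex_sum// => j Qj; apply: L2_mul; exact: LF.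
Qed.

Lemma cov_addl f g h : L2 f -> L2 g -> L2 h ->
  cov (fun w => f w + g w) h = cov f h + cov g h.
Proof.
move=> Lf Lg Lh; rewrite /cov; under eq_fun do rewrite mulrDl.
have A := L2_mul Lf Lh; have B := L2_mul Lg Lh.
by rewrite !Ex_add//; [ring|exact: L2_L1|exact: L2_L1].
Qed.

Lemma cov_scalel c f h : L2 f -> L2 h -> cov (fun w => c * f w) h = c * cov f h.
Proof.
move=> Lf Lh; rewrite /cov; under eq_fun do rewrite -mulrA.
have A := L2_mul Lf Lh; rewrite !Ex_scale//; [ring|exact: L2_L1].
Qed.

Lemma cov_scale c e f h : L2 f -> L2 h ->
  cov (fun w => c * f w) (fun w => e * h w) = c * e * cov f h.
Proof.
move=> Lf Lh; rewrite cov_scalel//; last exact: L2_scale.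
by rewrite covC cov_scalel// covC mulrA.
Qed.

Lemma cov_suml (I : finType) (Q : pred I) (F : I -> T -> R) h :
  (forall i, Q i -> L2 (F i)) -> L2 h ->
  cov (fun w => \sum_(i | Q i) F i w) h = \sum_(i | Q i) cov (F i) h.
Proof.
move=> LF Lh; rewrite /cov; under eq_fun do rewrite mulr_suml.
rewrite !Ex_sum; first by rewrite mulr_suml -sumrB.
- by move=> i Qi; apply: L2_mul => //; exact: LF.
- by move=> i Qi; apply: L2_L1; exact: LF.
Qed.

Lemma cov_sum (I J : finType) (Q : pred I) (S : pred J) (F : I -> T -> R) (G : J -> T -> R) :
  (forall i, Q i -> L2 (F i)) -> (forall j, S j -> L2 (G j)) ->
  cov (fun w => \sum_(i | Q i) F i w) (fun w => \sum_(j | S j) G j w) =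
  \sum_(i | Q i) \sum_(j | S j) cov (F i) (G j).
Proof.
move=> LF LG; rewrite cov_suml//; last exact: L2_sum.
apply: eq_bigr => i Qi; rewrite covC cov_suml//; last exact: LF.
by apply: eq_bigr => j Sj; rewrite covC.
Qed.

Lemma cov_cstl c h : L1 h -> cov (fun=> c) h = 0.
Proof. by move=> Lh; rewrite /cov Ex_scale// Ex_cst subrr. Qed.

End Expectation.

(** * Covariance inequalities under strong mixing *)

Section Covariance.
Context {disp : measure_display} {T : measurableType disp} {R : realType}.
Variable P : probability T R.
Implicit Types (G H : set_system T) (U V : T -> R).

Definition meas_for G U :=
  @measurable_fun _ _ (g_sigma_algebraType G) R setT U.

Definition sub_salgebra G := G `<=` (measurable : set_system T).

(** An upper bound on the strong mixing (alpha) coefficient of the two generated sigma-algebras. *)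
Definition dependence_le G H (a : R) := forall A B, <<s G>> A -> <<s H>> B ->
  `|fine (P (A `&` B)) - fine (P A) * fine (P B)| <= a.

Lemma sub_salgebra_gen G A : sub_salgebra G -> <<s G>> A -> measurable A.
Proof.
move=> sG; apply: smallest_sub => //; exact: sigma_algebra_measurable.
Qed.

Lemma meas_for_meas G U : sub_salgebra G -> meas_for G U -> measurable_fun setT U.
Proof. by move=> sG mU _ B mB; apply: (sub_salgebra_gen sG); exact: mU. Qed.

Lemma meas_for_ge G U c : meas_for G U -> <<s G>> [set w | c <= U w].
Proof.
move=> mU; have := mU measurableT `[c, +oo[%classic (measurable_itv _).
rewrite setTI (_ : _ @^-1` _ = [set w | c <= U w])//.
by apply/seteqP; split=> w /=; rewrite in_itv/= andbT.
Qed.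

(** The sum counts the integers from 1 to [N] that do not exceed [x], so it is the integer part of
    [x]. *)
Lemma floor_sum_approx (N : nat) (x : R) : 0 <= x -> x <= N%:R ->
  `|x - \sum_(j < N) (j.+1%:R <= x)%R%:R| <= 1.
Proof.
elim: N => [|N IH] x0.
  by move=> xN; rewrite big_ord0 subr0 ger0_norm// (le_trans xN).
move=> xN; rewrite big_ord_recr/=.
have [xge|xlt] := leP N.+1%:R x.
  have -> : x = N.+1%:R by apply/eqP; rewrite eq_le xN xge.
  rewrite (eq_bigr (fun=> 1)); last by move=> i _; rewrite ler_nat ltnS ltnW.
  by rewrite sumr_const card_ord -natr1 subrr normr0.
rewrite addr0; have [xleN|xgt] := leP x N%:R; first exact: IH.
rewrite (eq_bigr (fun=> 1)); last first.
  by move=> i _; rewrite (le_trans _ (ltW xgt))// ler_nat.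
rewrite sumr_const card_ord ger0_norm; last by rewrite subr_ge0 ltW.
by rewrite lerBlDl natr1 ltW.
Qed.

Section dependence.
Variables (G H : set_system T) (a : R).
Hypotheses (sG : sub_salgebra G) (sH : sub_salgebra H).
Hypothesis dep : dependence_le G H a.

(** A discrete layer-cake formula: [D f N] is [f] rounded down to a multiple of [1 / (N + 1)], which
    is the average of the indicators of level sets. The covariance of two such averages is an
    average of covariances of events, each at most [a] in absolute value, so no factor is lost; [N]
    is then taken large. *)
Lemma cov_unit U V : meas_for G U -> meas_for H V ->
  (forall w, 0 <= U w <= 1) -> (forall w, 0 <= V w <= 1) ->
  `|cov P U V| <= a.
Proof.
move=> mU mV U01 V01.
have mU' := meas_for_meas sG mU; have mV' := meas_for_meas sH mV.
pose D (f : T -> R) (N : nat) w : R := N.+1%:R^-1 * \sum_(j < N.+1) \1_[set w | j.+1%:R / N.+1%:R <= f w] w.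
have mD (f : T -> R) (N : nat) (j : 'I_N.+1) : measurable_fun setT f ->
    measurable [set w | j.+1%:R / N.+1%:R <= f w].
  move=> mf; have := mf measurableT `[j.+1%:R / N.+1%:R, +oo[%classic (measurable_itv _).
  rewrite setTI (_ : _ @^-1` _ = [set w | j.+1%:R / N.+1%:R <= f w])//.
  by apply/seteqP; split=> w /=; rewrite in_itv/= andbT.
have D01 f N w : (0 <= D f N w <= 1).
  rewrite /D; apply/andP; split.
    by rewrite mulr_ge0 ?invr_ge0// sumr_ge0.
  rewrite ler_pdivrMl ?ltr0n// mulr1.
  apply: (@le_trans _ _ (\sum_(j < N.+1) 1)); last by rewrite sumr_const card_ord.
  by apply: ler_sum => j _; rewrite indicE; case: (w \in _).
have Dapp (f : T -> R) N w : 0 <= f w <= 1 -> `|f w - D f N w| <= N.+1%:R^-1.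
  move=> /andP[f0 f1]; rewrite /D.
  rewrite (_ : f w - _ = N.+1%:R^-1 * (N.+1%:R * f w - \sum_(j < N.+1) (j.+1%:R <= N.+1%:R * f w)%R%:R)).
    rewrite normrM ger0_norm ?invr_ge0// ler_piMr ?invr_ge0//.
    by apply: floor_sum_approx; rewrite ?mulr_ge0// ler_piMr.
  rewrite mulrBr mulKf// ; congr (_ - _ * _); apply: eq_bigr => j _.
  rewrite indicE; congr ((nat_of_bool _)%:R).
  by apply/idP/idP; rewrite inE/= ler_pdivrMr ?ltr0n// [f w * _]mulrC.
have mDD (f : T -> R) N : measurable_fun setT f -> measurable_fun setT (D f N).
  move=> mf; apply: measurable_funM => //; apply: measurable_sum => j.
  exact/measurable_indicP/mD.
have LD (f : T -> R) N : measurable_fun setT f -> L2 P (D f N).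
  move=> mf; apply: (@L2_bounded _ _ _ _ _ 1); first exact: mDD.
  by move=> w; have /andP[? ?] := D01 f N w; rewrite ger0_norm.
have LU : L2 P U.
  apply: (@L2_bounded _ _ _ _ _ 1) => // w.
  by have /andP[? ?] := U01 w; rewrite ger0_norm.
have LV : L2 P V.
  apply: (@L2_bounded _ _ _ _ _ 1) => // w.
  by have /andP[? ?] := V01 w; rewrite ger0_norm.
have covD N : `|cov P (D U N) (D V N)| <= a.
  have LI (f : T -> R) (j : 'I_N.+1) : measurable_fun setT f -> L2 P \1_[set w | j.+1%:R / N.+1%:R <= f w].
    move=> mf; apply: (@L2_bounded _ _ _ _ _ 1); first exact/measurable_indicP/mD.
    by move=> w; rewrite indicE; case: (w \in _); rewrite ?normr1 ?normr0.
  rewrite /D cov_scale; [|by apply: L2_sum => j _; exact: LI..].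
  rewrite cov_sum; [|by move=> j _; exact: LI..].
  rewrite normrM ger0_norm; last by rewrite mulr_ge0 ?invr_ge0.
  rewrite -invfM ler_pdivrMl; last by rewrite -natrM ltr0n.
  apply: le_trans (ler_norm_sum _ _ _) _.
  apply: (@le_trans _ _ (\sum_(i < N.+1) \sum_(j < N.+1) a)); last first.
    by rewrite !sumr_const card_ord -mulrnA -natrM mulr_natl.
  apply: ler_sum => i _; apply: le_trans (ler_norm_sum _ _ _) _.
  apply: ler_sum => j _.
  rewrite /cov !Ex_indic; [|exact: mD..].
  rewrite (_ : (fun w => _ * _) = \1_([set w | i.+1%:R / N.+1%:R <= U w] `&` [set w | j.+1%:R / N.+1%:R <= V w])); last first.
    by rewrite indicI.
  rewrite Ex_indic; last by apply: measurableI; exact: mD.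
  by apply: dep; exact: meas_for_ge.
apply/ler_addgt0Pr => e e0.
have [N Ne] : exists N : nat, 4 * N.+1%:R^-1 <= e.
  exists (Num.truncn (4 / e)).
  rewrite ler_pdivrMr ?ltr0n// -ler_pdivrMl// mulrC ltW//.
  by have := truncnS_gt (4 / e).
rewrite -[cov P U V](subrK (cov P (D U N) (D V N))) addrC.
apply: le_trans (ler_normD _ _) _; apply: lerD; first exact: covD.
apply: le_trans _ Ne.
have [LDU LDV] := (LD U N mU', LD V N mV').
have key (f g : T -> R) (c : R) : L2 P f -> L2 P g -> (forall w, `|f w| <= c) -> (forall w, `|g w| <= 1) ->
   `|cov P f g| <= 2 * c.
  move=> Lf Lg fc g1; have Lfg := L2_mul Lf Lg.
  rewrite /cov; apply: le_trans (ler_normB _ _) _.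
  rewrite mulr2n mulrDl mul1r lerD//.
    apply: Ex_absle_cst => // w; rewrite normrM -[leRHS]mulr1 ler_pM//.
  rewrite normrM -[leRHS]mulr1 ler_pM//; apply: Ex_absle_cst => //; exact: L2_L1.
have -> : cov P U V - cov P (D U N) (D V N) =
    cov P (fun w => U w - D U N w) V + cov P (fun w => V w - D V N w) (D U N).
  have L1U := L2_sub LU LDU; have L1V := L2_sub LV LDV.
  have E1 : cov P U V = cov P (fun w => U w - D U N w) V + cov P (D U N) V.
    rewrite -cov_addl//; congr cov; apply/funext => w; by rewrite subrK.
  have E2 : cov P V (D U N) = cov P (fun w => V w - D V N w) (D U N) + cov P (D V N) (D U N).
    rewrite -cov_addl//; congr cov; apply/funext => w; by rewrite subrK.
  by rewrite E1 (covC _ (D U N) V) E2 (covC _ (D V N)) addrA addrK.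
rewrite (_ : 4 * N.+1%:R^-1 = 2 * N.+1%:R^-1 + 2 * N.+1%:R^-1); last by ring.
apply: le_trans (ler_normD _ _) _; apply: lerD; apply: key => //.
- exact: L2_sub.
- by move=> w; apply: Dapp.
- by move=> w; have /andP[? ?] := V01 w; rewrite ger0_norm.
- exact: L2_sub.
- by move=> w; apply: Dapp.
- by move=> w; have /andP[? ?] := D01 U N w; rewrite ger0_norm.
Qed.

(** The maps [x |-> (x + c) / (2 c)] and [x |-> (x + e) / (2 e)] carry the variables into the unit
    interval; undoing them multiplies the covariance by [4 c e]. *)
Lemma cov_bounded U V (c e : R) : meas_for G U -> meas_for H V -> 0 < c -> 0 < e ->
  (forall w, `|U w| <= c) -> (forall w, `|V w| <= e) ->
  `|cov P U V| <= 4 * c * e * a.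
Proof.
move=> mU mV c0 e0 Uc Ve.
pose N (c : R) (f : T -> R) w := (2 * c)^-1 * (f w + c).
have N01 k f w : 0 < k -> (forall w, `|f w| <= k) -> 0 <= N k f w <= 1.
  move=> k0 /(_ w); rewrite ler_norml /N => /andP[l u].
  apply/andP; split; first by rewrite mulr_ge0 ?invr_ge0//; lra.
  by rewrite ler_pdivrMl ?mulr_gt0//; lra.
have mN K k f : meas_for K f -> meas_for K (N k f).
  by move=> mf; apply: measurable_funM => //; apply: measurable_funD.
have LU : L2 P U by apply: (L2_bounded _ _ Uc); exact: (meas_for_meas sG).
have LV : L2 P V by apply: (L2_bounded _ _ Ve); exact: (meas_for_meas sH).
have := cov_unit (mN _ c _ mU) (mN _ e _ mV) (fun w => N01 _ _ w c0 Uc) (fun w => N01 _ _ w e0 Ve).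
rewrite /N cov_scale; [|by apply: L2_add => //; exact: L2_cst..].
have Lc x : L2 P (fun=> x) := L2_cst P x.
rewrite cov_addl//; last exact: L2_add.
rewrite cov_cstl ?addr0; last by apply: L2_L1; exact: L2_add.
rewrite covC cov_addl// cov_cstl ?addr0; last exact: L2_L1.
rewrite covC normrM ger0_norm; last by rewrite mulr_ge0 ?invr_ge0 ?mulr_ge0 ?ltW.
rewrite -invfM ler_pdivrMl; last by rewrite !mulr_gt0.
by move=> h; apply: le_trans h _; rewrite le_eqVlt; apply/orP; left; apply/eqP; ring.
Qed.

End dependence.

Definition clip (N x : R) : R := Num.max (- N) (Num.min x N).

Lemma clip_abs N x : 0 <= N -> `|clip N x| <= N.
Proof.
move=> N0; rewrite /clip ler_norml le_max lexx/= ge_max ge_min lexx orbT andbT.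
by lra.
Qed.

Lemma clip_id N x : `|x| <= N -> clip N x = x.
Proof.
rewrite ler_norml => /andP[l u]; rewrite /clip.
by rewrite (min_idPl u) (max_idPr l).
Qed.

Lemma clip_scale N x : 0 < N -> exists2 s, 0 <= s <= 1 & clip N x = s * x.
Proof.
move=> N0; have [xN|xN] := leP `|x| N.
  by exists 1; rewrite ?ler01 ?lexx// mul1r clip_id.
exists (N / `|x|).
  apply/andP; split; first by rewrite divr_ge0// ltW.
  by rewrite ler_pdivrMr ?mul1r ?(ltW xN)// (lt_trans N0).
have [x0|x0] := leP 0 x.
  rewrite ger0_norm// in xN *; rewrite divfK ?gt_eqF// ?(lt_trans N0)//.
  by rewrite /clip (min_idPr (ltW xN)); apply/max_idPr; lra.
rewrite ltr0_norm// in xN *.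
rewrite invrN mulrN mulNr divfK ?lt_eqF//.
rewrite /clip (min_idPl _); last by lra.
by apply/max_idPl; lra.
Qed.

Lemma measurable_clip N : measurable_fun setT (clip N).
Proof. by apply: measurable_maxr => //; exact: measurable_minr. Qed.

Lemma sqr_le_powR (N m p : R) : 0 < N -> N <= m -> 2 <= p -> m ^+ 2 <= N `^ (2 - p) * m `^ p.
Proof.
move=> N0 Nm p2; have m0 : 0 < m by exact: lt_le_trans Nm.
have -> : m `^ p = m `^ (p - 2) * m ^+ 2.
  rewrite -powR_mulrn ?ltW// -powRD ?subrK//.
  by apply/implyP => _; rewrite gt_eqF.
rewrite mulrA ler_peMl ?sqr_ge0// -opprB powRN ler_pdivlMl ?powR_gt0// mulr1.
by rewrite ge0_ler_powR ?nnegrE ?subr_ge0// ltW.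
Qed.

(** By symmetry [|u| <= |v|]. If [|v| <= N] nothing is clipped; otherwise the difference is at most
    [v^2], and above the level [N] a square is at most [N^(2 - p)] times the power of order [p]. *)
Lemma clip_mul_powR N u v p : 0 < N -> 2 <= p ->
  `|u * v - clip N u * clip N v| <= N `^ (2 - p) * (`|u| `^ p + `|v| `^ p).
Proof.
move=> N0 p2.
have H x y : `|x| <= `|y| -> `|x * y - clip N x * clip N y| <= N `^ (2 - p) * `|y| `^ p.
  move=> xy; have [yN|yN] := leP `|y| N.
    by rewrite !clip_id ?subrr ?normr0 ?mulr_ge0 ?powR_ge0// (le_trans xy).
  apply: le_trans (sqr_le_powR N0 (ltW yN) p2).
  have [s /andP[s0 s1] ->] := clip_scale x N0; have [t /andP[t0 t1] ->] := clip_scale y N0.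
  rewrite (_ : _ - _ = (1 - s * t) * (x * y)); last by ring.
  rewrite !normrM ger0_norm; last by nra.
  rewrite -[leRHS]mul1r ler_pM ?mulr_ge0//; [by nra|by nra|].
  by rewrite expr2 ler_pM.
have [uv|/ltW vu] := leP `|u| `|v|.
  by apply: le_trans (H _ _ uv) _; rewrite ler_wpM2l ?powR_ge0// lerDr powR_ge0.
rewrite (mulrC u) (mulrC (clip N u)).
by apply: le_trans (H _ _ vu) _; rewrite ler_wpM2l ?powR_ge0// lerDl powR_ge0.
Qed.

Lemma clip_powR N u p : 1 <= N -> 2 <= p ->
  `|u - clip N u| <= N `^ (2 - p) * `|u| `^ p.
Proof.
move=> N1 p2; have N0 : 0 < N by exact: lt_le_trans N1.
have [uN|uN] := leP `|u| N.
  by rewrite clip_id// subrr normr0 mulr_ge0 ?powR_ge0.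
apply: le_trans (sqr_le_powR N0 (ltW uN) p2).
have [s /andP[s0 s1] ->] := clip_scale u N0.
rewrite (_ : _ - _ = (1 - s) * u); last by ring.
rewrite normrM ger0_norm ?subr_ge0// expr2 ler_pM ?subr_ge0//.
by apply: le_trans (ltW uN); apply: le_trans N1; lra.
Qed.

Lemma clip_sqr_powR N u p : 0 < N -> 2 <= p ->
  (u - clip N u) ^+ 2 <= N `^ (2 - p) * `|u| `^ p.
Proof.
move=> N0 p2; have [uN|uN] := leP `|u| N.
  by rewrite clip_id// subrr expr0n/= mulr_ge0 ?powR_ge0.
apply: le_trans (sqr_le_powR N0 (ltW uN) p2).
have [s /andP[s0 s1] ->] := clip_scale u N0.
rewrite (_ : _ - _ = (1 - s) * u); last by ring.
rewrite exprMn real_normK ?num_real// ler_piMl ?sqr_ge0//; nra.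
Qed.

Lemma le1_powR (x : R) p : 2 <= p -> `|x| <= 1 + `|x| `^ p.
Proof.
move=> p2; have [x1|x1] := leP `|x| 1.
  by rewrite (le_trans x1)// lerDl powR_ge0.
have x0 : 0 < `|x| by rewrite (lt_trans _ x1).
apply: (@le_trans _ _ (`|x| `^ p)); last by rewrite lerDr.
rewrite -[leLHS]powRr1//; apply: ler_powR; rewrite ?ltW//; lra.
Qed.

(** Clipped variables obey the bounded estimate, and clipping changes the three expectations of the
    covariance by multiples of [N^(2 - p)]. In the constant, 4 comes from the clipped covariance and
    [6 K^2] from the errors [2 K + 4 K^2], as [K >= 1]. *)
Lemma cov_davydov G H (a b : R) U V p K : sub_salgebra G -> sub_salgebra H ->
  dependence_le G H a -> meas_for G U -> meas_for H V ->
  2 < p -> 1 <= K -> L2 P U -> L2 P V ->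
  L1 P (fun w => `|U w| `^ p) -> L1 P (fun w => `|V w| `^ p) ->
  Ex P (fun w => `|U w| `^ p) <= K -> Ex P (fun w => `|V w| `^ p) <= K ->
  a <= b -> 0 < b -> b <= 1 ->
  `|cov P U V| <= (4 + 6 * K ^+ 2) * b `^ (1 - 2 / p).
Proof.
move=> sG sH dep mU mV p2 K1 LU LV LUp LVp EU EV ab b0 b1.
have p0 : 0 < p by rewrite (lt_trans _ p2).
(* The level [N = b^(-1/p)] balances the two errors: [N^2 b] and [N^(2 - p)] are both equal to
   [b^(1 - 2/p)]. *)
pose N := (b `^ p^-1)^-1.
have bp0 : 0 < b `^ p^-1 by rewrite powR_gt0.
have N1 : 1 <= N.
  rewrite /N -[leLHS]invr1 lef_pV2 ?posrE// -(powRr0 b).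
  by apply: ger_powR; rewrite ?b0// invr_ge0 ltW.
have N0 : 0 < N by rewrite invr_gt0.
have N2 : N ^+ 2 * b = b `^ (1 - 2 / p).
  rewrite powRD; last by apply/implyP => _; rewrite gt_eqF.
  rewrite powRr1 ?ltW// mulrC; congr (_ * _).
  by rewrite powRN [2 / p]mulrC powRrM powR_mulrn ?powR_ge0// exprVn.
have Np : N `^ (2 - p) = b `^ (1 - 2 / p).
  rewrite /N -powRN -powRrM; congr (_ `^ _).
  by field; rewrite gt_eqF.
set r := b `^ (1 - 2 / p) in N2 Np *.
pose U' w := clip N (U w); pose V' w := clip N (V w).
have mU' : meas_for G U' by apply: measurableT_comp => //; exact: measurable_clip.
have mV' : meas_for H V' by apply: measurableT_comp => //; exact: measurable_clip.
have U'N w : `|U' w| <= N by apply: clip_abs; exact: ltW.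
have V'N w : `|V' w| <= N by apply: clip_abs; exact: ltW.
have LU' : L2 P U' by apply: (L2_bounded _ _ U'N); exact: (meas_for_meas sG).
have LV' : L2 P V' by apply: (L2_bounded _ _ V'N); exact: (meas_for_meas sH).
have C' : `|cov P U' V'| <= 4 * r.
  apply: le_trans (cov_bounded sG sH dep mU' mV' N0 N0 U'N V'N) _.
  have : N * N * a <= N * N * b by rewrite ler_wpM2l// mulr_ge0// ltW.
  rewrite -N2 expr2; clear; lra.
have r0 : 0 <= r by exact: powR_ge0.
have [LUV LUV'] := (L2_mul LU LV, L2_mul LU' LV').
have [[[L1U L1V] L1U'] L1V'] := (L2_L1 LU, L2_L1 LV, L2_L1 LU', L2_L1 LV').
have D1 : `|Ex P (fun w => U w * V w) - Ex P (fun w => U' w * V' w)| <= r * (2 * K).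
  rewrite -Ex_sub//.
  apply: le_trans (Ex_absle (g := fun w => r * (`|U w| `^ p + `|V w| `^ p)) _ _ _) _.
  - exact: L1_sub.
  - by apply: L1_scale; exact: L1_add.
  - by move=> w; rewrite -Np; apply: clip_mul_powR => //; exact: ltW.
  rewrite Ex_scale ?Ex_add//; last exact: L1_add.
  by rewrite ler_wpM2l// [leRHS]mulr_natl mulr2n; exact: lerD.
have D2 (f : T -> R) : L2 P f -> L1 P (fun w => `|f w| `^ p) -> Ex P (fun w => `|f w| `^ p) <= K ->
    `|Ex P f - Ex P (fun w => clip N (f w))| <= r * K.
  move=> Lf Lfp EK.
  have Lf' : L1 P (fun w => clip N (f w)).
    apply: (@L1_bounded _ _ _ _ _ N); last by move=> w; apply: clip_abs; exact: ltW.
    by apply: measurableT_comp; [exact: measurable_clip|exact: (L2_meas Lf)].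
  rewrite -Ex_sub//; last exact: L2_L1.
  apply: le_trans (Ex_absle (g := fun w => r * (`|f w| `^ p)) _ _ _) _.
  - by apply: L1_sub => //; exact: L2_L1.
  - exact: L1_scale.
  - by move=> w; rewrite -Np; apply: clip_powR => //; exact: ltW.
  by rewrite Ex_scale// ler_wpM2l.
have D3 (f : T -> R) : L2 P f -> L1 P (fun w => `|f w| `^ p) -> Ex P (fun w => `|f w| `^ p) <= K ->
    `|Ex P f| <= 2 * K.
  move=> Lf Lfp EK; have Lc := L1_cst P 1.
  apply: le_trans (Ex_absle (g := fun w => 1 + `|f w| `^ p) _ _ _) _.
  - exact: L2_L1.
  - exact: L1_add.
  - by move=> w; apply: le1_powR; exact: ltW.
  by rewrite Ex_add// Ex_cst [leRHS]mulr_natl mulr2n lerD.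
have D4 : `|Ex P U'| <= 2 * K.
  apply: le_trans (Ex_absle (g := fun w => 1 + `|U w| `^ p) _ _ _) _ => //.
  - by apply: L1_add => //; exact: L1_cst.
  - move=> w; have [s /andP[s0 s1] E] := clip_scale (U w) N0.
    rewrite /U' E normrM; apply: le_trans (le1_powR (U w) (ltW p2)).
    by rewrite ger0_norm// ler_piMl.
  have Lc := L1_cst P 1; rewrite Ex_add// Ex_cst [leRHS]mulr_natl mulr2n; exact: lerD.
rewrite (_ : cov P U V = cov P U' V' + ((Ex P (fun w => U w * V w) - Ex P (fun w => U' w * V' w)) -
   ((Ex P U - Ex P U') * Ex P V + Ex P U' * (Ex P V - Ex P V')))); last by rewrite /cov; ring.
have E1 : `|(Ex P U - Ex P U') * Ex P V| <= (r * K) * (2 * K).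
  by rewrite normrM ler_pM//; [exact: D2|exact: D3].
have E2 : `|Ex P U' * (Ex P V - Ex P V')| <= (2 * K) * (r * K).
  by rewrite normrM ler_pM//; exact: D2.
apply: le_trans (ler_normD _ _) _; rewrite [leRHS]mulrDl; apply: lerD => //.
apply: le_trans (ler_normB _ _) _.
apply: (@le_trans _ _ (r * (2 * K) + (r * K * (2 * K) + 2 * K * (r * K)))).
  by apply: lerD => //; apply: le_trans (ler_normD _ _) _; exact: lerD.
have : 0 <= r * (K * (K - 1)) by rewrite mulr_ge0// mulr_ge0 ?subr_ge0// (le_trans ler01).
clear -r0; lra.
Qed.

End Covariance.

(** * Stein's method for mixing fields *)

Section Trigonometry.
Context {R : realType}.
Implicit Types x y h : R.

(** Serves to differentiate an expectation: a quadratic bound on the remainder of the integrand,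
    once integrated, has the same form. *)
Lemma is_derive_quadratic (f : R -> R) x D C :
  (forall h, `|f (h + x) - f x - h * D| <= C * h ^+ 2) -> is_derive x 1 f D.
Proof.
move=> H.
have C0 : 0 <= C.
  by have := H 1; rewrite expr1n mulr1; apply: le_trans.
have cv : h^-1 *: ((f \o shift x) (h *: (1:R)) - f x) @[h --> 0^'] --> D.
  apply/cvgrPdist_le => e e0; near=> h.
  have h0 : h != 0 by near: h; exact: nbhs_dnbhs_neq.
  rewrite distrC /= [h *: 1]mulr1 [_ *: _]mulrC.
  have -> : (f (h + x) - f x) / h - D = (f (h + x) - f x - h * D) / h.
    by field.
  rewrite normrM normfV ler_pdivrMr ?normr_gt0//.
  apply: le_trans (H h) _; rewrite -(real_normK (num_real h)) expr2 mulrA.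
  rewrite ler_wpM2r//.
  have : `|h| <= e / (C + 1).
    near: h; apply: dnbhs0_le; rewrite divr_gt0//; lra.
  rewrite ler_pdivlMr; last by lra.
  by have := normr_ge0 h; nra.
apply: DeriveDef; first by apply/cvg_ex; exists D.
by rewrite /derive; apply/cvg_lim.
Unshelve. all: by end_near. Qed.

Lemma MVT_abs (f df : R -> R) x y (C : R) :
  (forall z : R, is_derive z 1 f (df z)) -> (forall z, `|df z| <= C) ->
  `|f y - f x| <= C * `|y - x|.
Proof.
move=> dfP dfC.
have cf : continuous f.
  by move=> z; apply: differentiable_continuous; apply/derivable1_diffP; have [] := dfP z.
wlog xy : x y / x < y.
  move=> H; have [xy|yx|->] := ltgtP x y; first exact: H.
  - by rewrite distrC (distrC y); exact: H.
  - by rewrite !subrr normr0 mulr0.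
have [c _ ->] := MVT xy (fun z _ => dfP z) (continuous_subspaceT cf).
by rewrite normrM ler_wpM2r.
Qed.

Lemma cos_lipschitz x y : `|cos y - cos x| <= `|y - x|.
Proof.
rewrite -[leRHS]mul1r; apply: (@MVT_abs _ (fun z => - sin z)) => z.
by rewrite normrN ler_norml sin_geN1 sin_le1.
Qed.

Lemma sin_lipschitz x y : `|sin y - sin x| <= `|y - x|.
Proof.
rewrite -[leRHS]mul1r; apply: (@MVT_abs _ cos) => z.
by rewrite ler_norml cos_geN1 cos_le1.
Qed.

(** The mean value theorem writes the increment as [h * df c] with [c] between [x] and [h + x], and
    [df] is 1-Lipschitz. *)
Lemma taylor1 (f df : R -> R) x h :
  (forall z : R, is_derive z 1 f (df z)) ->
  (forall y z, `|df y - df z| <= `|y - z|) ->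
  `|f (h + x) - f x - h * df x| <= h ^+ 2.
Proof.
move=> dfP lip.
have cf : continuous f.
  by move=> z; apply: differentiable_continuous; apply/derivable1_diffP; have [] := dfP z.
have [h0|h0|->] := ltgtP h 0; last first.
- by rewrite add0r subrr mul0r subrr normr0 expr0n.
- have [c /[!in_itv]/= /andP[c1 c2] E] := @MVT _ f df x (h + x) ltac:(lra) (fun z _ => dfP z) (continuous_subspaceT cf).
  rewrite E addrK mulrC -mulrBr normrM -(real_normK (num_real h)) expr2 ler_wpM2l//.
  apply: le_trans (lip _ _) _; rewrite !ger0_norm; lra.
- have [c /[!in_itv]/= /andP[c1 c2] E] := @MVT _ f df (h + x) x ltac:(lra) (fun z _ => dfP z) (continuous_subspaceT cf).
  have -> : f (h + x) - f x = h * df c by rewrite -opprB E; ring.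
  rewrite -mulrBr normrM -(real_normK (num_real h)) expr2 ler_wpM2l//.
  by apply: le_trans (lip _ _) _; rewrite !ltr0_norm; lra.
Qed.

Lemma sin_taylor x h : `|sin (h + x) - sin x - h * cos x| <= h ^+ 2.
Proof. by apply: taylor1 => // y z; exact: cos_lipschitz. Qed.

Lemma cos_taylor x h : `|cos (h + x) - cos x + h * sin x| <= h ^+ 2.
Proof.
rewrite -[h * sin x]opprK -mulrN; apply: (@taylor1 cos (fun z => - sin z)) => y z.
by rewrite -opprD normrN; exact: sin_lipschitz.
Qed.

Lemma sin_abs_le1 x : `|sin x| <= 1.
Proof. by rewrite ler_norml sin_geN1 sin_le1. Qed.

Lemma cos_abs_le1 x : `|cos x| <= 1.
Proof. by rewrite ler_norml cos_geN1 cos_le1. Qed.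

Lemma measurable_sin : measurable_fun setT (@sin R).
Proof. by apply: continuous_measurable_fun; exact: continuous_sin. Qed.

Lemma measurable_cos : measurable_fun setT (@cos R).
Proof. by apply: continuous_measurable_fun; exact: continuous_cos. Qed.

End Trigonometry.

Section CharacteristicODE.
Context {disp : measure_display} {T : measurableType disp} {R : realType}.
Variable P : probability T R.
Implicit Types (V : T -> R) (l t v : R).

Lemma L1_cos V l t : measurable_fun setT V -> L1 P (fun w => cos (l * V w + t)).
Proof.
move=> mV; apply: (@L1_bounded _ _ _ _ _ 1); last by move=> w; exact: cos_abs_le1.
apply: measurableT_comp; first exact: measurable_cos.
by apply: measurable_funD => //; exact: measurable_funM.
Qed.

Lemma L1_mul_sin V l t : L2 P V -> L1 P (fun w => V w * sin (l * V w + t)).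
Proof.
move=> LV; apply: L2_mul => //; apply: (@L2_bounded _ _ _ _ _ 1); last by move=> w; exact: sin_abs_le1.
apply: measurableT_comp; first exact: measurable_sin.
by apply: measurable_funD => //; apply: measurable_funM => //; exact: L2_meas LV.
Qed.

Lemma is_derive_Ex_cos V t l : L2 P V ->
  is_derive l 1 (fun l => Ex P (fun w => cos (l * V w + t)))
    (- Ex P (fun w => V w * sin (l * V w + t))).
Proof.
move=> LV; have mV := L2_meas LV.
apply: (@is_derive_quadratic _ _ _ _ (Ex P (fun w => V w ^+ 2))) => h.
have [A B] := (L1_cos (h + l) t mV, L1_cos l t mV).
have D := L1_mul_sin l t LV.
rewrite mulrN opprK -Ex_sub// -Ex_scale// -Ex_add//; [|exact: L1_sub|exact: L1_scale].
rewrite mulrC -Ex_scale; last exact: L2_sqr.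
apply: Ex_absle.
- by apply: L1_add; [exact: L1_sub|exact: L1_scale].
- by apply: L1_scale; exact: L2_sqr.
- move=> w; rewrite mulrC -exprMn; have := cos_taylor (l * V w + t) (h * V w).
  by rewrite addrA -mulrDl [V w * (h + l)]mulrC mulrA.
Qed.

(* [expR (l ^+ 2 * v / 2)] is the integrating factor of the equation
   [f' = - l v f] solved by [f l = E cos (l V + t)] up to an error. *)
Lemma Ex_cos_gaussian V t v (err : R) : L2 P V -> 0 <= v ->
  (forall l, 0 <= l <= 1 -> `|Ex P (fun w => V w * sin (l * V w + t)) -
      l * v * Ex P (fun w => cos (l * V w + t))| <= err) ->
  `|Ex P (fun w => cos (V w + t)) - expR (- (v / 2)) * cos t| <= err.
Proof.
move=> LV v0 H.
pose f l := Ex P (fun w => cos (l * V w + t)).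
pose s l := Ex P (fun w => V w * sin (l * V w + t)).
pose e l : R := expR (l ^+ 2 * (v / 2)).
have df l : is_derive l 1 f (- s l) by exact: is_derive_Ex_cos.
have de l : is_derive l 1 e (e l * (l * v)).
  rewrite /e; apply: is_derive_eq.
  by rewrite /GRing.scale/=; field.
have dfe l : is_derive l 1 (f * e) (e l * (l * v * f l - s l)).
  by apply: is_derive_eq; rewrite /GRing.scale/=; ring.
have cfe : continuous (f * e).
  by move=> z; apply: differentiable_continuous; apply/derivable1_diffP; have [] := dfe z.
have [c /[!in_itv]/= /andP[c0 c1]] := MVT ltr01 (fun z _ => dfe z) (continuous_subspaceT cfe).
rewrite subr0 mulr1 => E.
have f0 : f 0 = cos t.
  by rewrite /f; under eq_fun do rewrite mul0r add0r; rewrite Ex_cst.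
have f1 : f 1 = Ex P (fun w => cos (V w + t)).
  by rewrite /f; under eq_fun do rewrite mul1r.
have e0 : e 0 = 1 by rewrite /e expr0n mul0r expR0.
have e1 : expR (- (v / 2)) * e 1 = 1 by rewrite /e expr1n mul1r -expRD addNr expR0.
rewrite -f1 -f0 (_ : _ - _ = expR (- (v / 2)) * ((f * e) 1 - (f * e) 0)); last first.
  rewrite (_ : (f * e) 1 = f 1 * e 1)// (_ : (f * e) 0 = f 0 * e 0)// e0.
  by rewrite mulrBr mulrCA e1 !mulr1.
rewrite E mulrA normrM.
rewrite -[leRHS]mul1r ler_pM//; last by rewrite distrC; apply: H; rewrite (ltW c0) ltW.
(* The factors [exp(- v / 2)] and [exp(c^2 v / 2)] have a product at most 1 since [c <= 1], so the
   error is not amplified, however large [v] is. *)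
rewrite ger0_norm ?mulr_ge0 ?expR_ge0// /e -expRD -[leRHS]expR0 ler_expR.
by have : c ^+ 2 <= 1 by [rewrite expr_le1// ltW]; nra.
Qed.

End CharacteristicODE.

(** [near i m] and [far i m] stand for the sigma-algebras of the variables at distance at most [m]
    and at least [m] from [i]. In [mi_dep] the shift [m + r + 2] leaves a strip of width [r] once
    sites are thickened into unit cells, and [m < r] keeps to the regime where the half-width of the
    inner cube is at most the gap, in which the rate carries no factor depending on [m]. *)
Record mixing_index {disp : measure_display} {T : measurableType disp} {R : realType}
    (P : probability T R) (d : nat) (al : nat -> R) (I : finType)
    (dist : I -> I -> nat) (near far : I -> nat -> set_system T) : Prop :=
  MixingIndex {
    mi_dist0 : forall i, dist i i = 0%N;
    mi_sym : forall i j, dist i j = dist j i;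
    mi_tri : forall i j k, (dist i k <= dist i j + dist j k)%N;
    mi_ball : forall i r, (#|[pred j | dist i j <= r]| <= (r.*2.+1) ^ d)%N;
    mi_near : forall i m, sub_salgebra (near i m);
    mi_far : forall i m, sub_salgebra (far i m);
    mi_dep : forall i m r, (m < r)%N ->
      dependence_le P (near i m) (far i (m + r + 2)%N) (al r) }.

Definition adapted {disp : measure_display} {T : measurableType disp} {R : realType}
    (I : finType) (dist : I -> I -> nat) (near far : I -> nat -> set_system T)
    (xi : I -> T -> R) : Prop :=
  (forall i m j, (dist i j <= m)%N -> meas_for (near i m) (xi j)) /\
  (forall i m j, (m <= dist i j)%N -> meas_for (far i m) (xi j)).

Lemma div4_le_sub2 s : (4 <= s)%N -> (s %/ 4 <= s - 2)%N.
Proof. lia. Qed.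

Lemma div4_le_pred m : (4 <= m)%N ->
  [/\ (0 < m.-1)%N, m.+1 = (0 + m.-1 + 2)%N & (m %/ 4 <= m.-1)%N].
Proof. by move=> m4; split; lia. Qed.

(** Balls of radius [m] about two points at distance [D > 4 m] are separated by a strip wider than
    [m] and at least [D / 4] wide. This is the origin of the quarter at which the rates are
    evaluated. *)
Lemma far_gap m D : (4 <= m)%N -> (4 * m < D)%N ->
  [/\ (m < D - m - m - 2)%N, (m + (D - m - m - 2) + 2 = D - m)%N,
      (D %/ 4 <= D - m - m - 2)%N, (4 <= D)%N & (m <= D)%N].
Proof. by move=> m4 mD; split; lia. Qed.

Lemma ball_volume_4 d m : (((4 * m).*2.+1) ^ d <= (m.*2.+1 * 4) ^ d)%N.
Proof. by case: d => [|d]; rewrite ?expn0// leq_exp2r//; lia. Qed.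

Lemma avg_sqr_le {R : realType} (N g : R) : 1 <= g ->
  2^-1 * (N ^+ 2 + N ^+ 2) <= 4 * N ^+ 2 * g.
Proof. by move=> g1; have := sqr_ge0 N; nra. Qed.

(** * Stein estimate for a bounded centred field *)

Section BoundedField.
Context {disp : measure_display} {T : measurableType disp} {R : realType}.
Variables (P : probability T R) (d : nat) (al : nat -> R) (I : finType).
Variables (dist : I -> I -> nat) (near far : I -> nat -> set_system T).
Hypothesis MI : mixing_index P d al dist near far.
Hypothesis al0 : forall r, 0 <= al r.
Hypothesis al_noninc : forall r s, (r <= s)%N -> al s <= al r.
Variables (ga : nat -> R) (Ga : R).
Hypothesis ga_near : forall s, (s < 4)%N -> 1 <= ga s.
Hypothesis ga_far : forall s, (4 <= s)%N -> al (s %/ 4) <= ga s.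
Hypothesis ga_sum : forall i, \sum_j ga (dist i j) <= Ga.

Variables (Y : I -> T -> R) (N : R).
Hypothesis Yad : adapted dist near far Y.
Hypothesis N1 : 1 <= N.
Hypothesis YN : forall i w, `|Y i w| <= N.
Hypothesis Y0 : forall i, Ex P (Y i) = 0.

Let N0 : 0 < N. Proof. exact: lt_le_trans N1. Qed.

Lemma ga_ge0 s : 0 <= ga s.
Proof.
have [s4|s4] := ltnP s 4; first exact: le_trans (ga_near s4).
exact: le_trans (ga_far s4).
Qed.

Lemma ga_total_ge1 (i : I) : 1 <= Ga.
Proof.
apply: le_trans (ga_sum i); rewrite (bigD1 i)//= (mi_dist0 MI).
by apply: (le_trans (ga_near (isT : (0 < 4)%N))); rewrite lerDl sumr_ge0// => *; exact: ga_ge0.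
Qed.

Lemma field_measurable i : measurable_fun setT (Y i).
Proof. by apply: (meas_for_meas (mi_near MI (i := i) (m := 0%N))); apply: Yad.1; rewrite (mi_dist0 MI). Qed.

Lemma field_L2 i : L2 P (Y i).
Proof. by apply: (L2_bounded _ _ (YN i)); exact: field_measurable. Qed.

Lemma field_cov i j : `|cov P (Y i) (Y j)| <= 4 * N ^+ 2 * ga (dist i j).
Proof.
have [s4|s4] := ltnP (dist i j) 4.
  have : `|cov P (Y i) (Y j)| <= 2^-1 * (N ^+ 2 + N ^+ 2).
    apply: le_trans (cov_le_sqr (field_L2 i) (field_L2 j)) _.
    rewrite ler_pM2l ?invr_gt0//.
    have sq k : Ex P (fun w => Y k w ^+ 2) <= N ^+ 2.
      rewrite -[leRHS](Ex_cst P); apply: Ex_le; [exact: L2_sqr (field_L2 k)|exact: L1_cst|].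
      by move=> w; rewrite -(real_normK (num_real (Y k w))) lerXn2r ?nnegrE// ltW.
    by apply: lerD; exact: sq.
  by move=> h; apply: le_trans h _; exact: avg_sqr_le (ga_near s4).
have E : dist i j = (0 + (dist i j - 2) + 2)%N by rewrite add0n subnK// (leq_trans _ s4).
have r0 : (0 < dist i j - 2)%N by rewrite subn_gt0 (leq_trans _ s4).
have D := mi_dep MI (i := i) r0; rewrite -E in D.
apply: le_trans (cov_bounded (mi_near MI (i:=i) (m:=0%N)) (mi_far MI (i:=i) (m:=dist i j)) D _ _ N0 N0 (YN i) (YN j)) _.
- by apply: Yad.1; rewrite (mi_dist0 MI).
- exact: Yad.2.
rewrite expr2 -!mulrA !ler_pM2l//; apply: le_trans (ga_far s4).
by apply: al_noninc; exact: div4_le_sub2.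
Qed.

Variables (F : {set I}) (m : nat) (tau : R).
Hypothesis m4 : (4 <= m)%N.
Hypothesis F0 : F != finset.set0.
Hypothesis tau_tail : forall i, \sum_(j | (m < dist i j)%N) ga (dist i j) <= tau.

(** The neighbourhood sum of Stein's method: what remains of the total sum is almost independent of
    [Y i]. *)
Definition local_sum i w := \sum_(j in F | (dist i j <= m)%N) Y j w.

Let b : R := (m.*2.+1 ^ d)%:R.
Let n : R := #|F|%:R.

Let b1 : 1 <= b. Proof. by rewrite ler1n expn_gt0. Qed.
Let b0 : 0 <= b. Proof. exact: le_trans b1. Qed.
Let Ga1 : 1 <= Ga.
Proof. by have /set0Pn[i _] := F0; exact: ga_total_ge1 i. Qed.
Let Ga0 : 0 <= Ga. Proof. exact: le_trans Ga1. Qed.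

Lemma local_sum_L2 i : L2 P (local_sum i).
Proof. by apply: L2_sum => j _; exact: field_L2. Qed.

Lemma card_ball_le i r : #|[pred j | (dist i j <= r)%N]|%:R <= (r.*2.+1 ^ d)%:R :> R.
Proof. by rewrite ler_nat (mi_ball MI). Qed.

Lemma local_sum_abs i w : `|local_sum i w| <= N * b.
Proof.
apply: le_trans (ler_norm_sum _ _ _) _.
apply: (@le_trans _ _ (\sum_(j | (dist i j <= m)%N) N)).
  rewrite big_mkcondl; apply: ler_sum => j _; case: ifP => // _; exact: ltW.
by rewrite sumr_const -mulr_natr ler_pM2l// card_ball_le.
Qed.

(** A full row of covariances for each of at most [b] indices gives the order [b], against [b^2] for
    the trivial bound; this linear growth is what allows neighbourhoods of about [sqrt n] sites. *)
Lemma local_sum_sqr i : Ex P (fun w => local_sum i w ^+ 2) <= 4 * N ^+ 2 * Ga * b.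
Proof.
rewrite Ex_sqr_sum; last by move=> j _; exact: field_L2.
apply: (@le_trans _ _ (\sum_(j | (dist i j <= m)%N) (4 * N ^+ 2 * Ga))); last first.
  rewrite sumr_const -[_ *+ _]mulr_natr; apply: ler_wpM2l; last exact: card_ball_le.
  by apply: mulr_ge0 => //; apply: mulr_ge0 => //; exact: sqr_ge0.
rewrite [leLHS]big_mkcondl; apply: ler_sum => j _; case: ifP => _; last first.
  by apply: mulr_ge0 => //; apply: mulr_ge0 => //; exact: sqr_ge0.
apply: (@le_trans _ _ (\sum_k (4 * N ^+ 2 * ga (dist j k)))); last first.
  by rewrite -mulr_sumr ler_wpM2l// mulr_ge0// sqr_ge0.
rewrite big_mkcond; apply: ler_sum => k _; case: ifP => _; last first.
  by apply: mulr_ge0; [apply: mulr_ge0 => //; exact: sqr_ge0|exact: ga_ge0].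
apply: le_trans (field_cov j k).
by rewrite /cov !Y0 mulr0 subr0 ler_norm.
Qed.

Definition local_prod i w := Y i w * local_sum i w.

Lemma local_prod_abs i w : `|local_prod i w| <= N * (N * b).
Proof. by rewrite normrM ler_pM// local_sum_abs. Qed.

Lemma local_prod_near i : meas_for (near i m) (local_prod i).
Proof.
apply: measurable_funM; first by apply: Yad.1; rewrite (mi_dist0 MI).
by apply: measurable_sum_cond => j /andP[_ jm]; exact: Yad.1.
Qed.

Lemma local_prod_far i k s : (s + m <= dist i k)%N -> meas_for (far i s) (local_prod k).
Proof.
move=> sk; have H j : (dist k j <= m)%N -> meas_for (far i s) (Y j).
  move=> jm; apply: Yad.2; rewrite -(leq_add2r m) (leq_trans sk)//.
  by rewrite (leq_trans (mi_tri MI i j k))// leq_add2l (mi_sym MI).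
apply: measurable_funM; first by apply: H; rewrite (mi_dist0 MI).
by apply: measurable_sum_cond => j /andP[_ jm]; exact: H.
Qed.

Lemma local_prod_meas i : measurable_fun setT (local_prod i).
Proof. exact: (meas_for_meas (mi_near MI (i := i) (m := m)) (@local_prod_near i)). Qed.

Lemma local_prod_L2 i : L2 P (local_prod i).
Proof. by apply: (L2_bounded _ _ (local_prod_abs i)); exact: local_prod_meas. Qed.

Lemma local_prod_sqr i : Ex P (fun w => local_prod i w ^+ 2) <= N ^+ 2 * (4 * N ^+ 2 * Ga * b).
Proof.
apply: (@le_trans _ _ (Ex P (fun w => N ^+ 2 * local_sum i w ^+ 2))).
  apply: Ex_le; [exact: L2_sqr (local_prod_L2 i)|exact: L1_scale (L2_sqr (local_sum_L2 i))|].
  move=> w; rewrite exprMn ler_wpM2r ?sqr_ge0//.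
  by rewrite -(real_normK (num_real (Y i w))) lerXn2r ?nnegrE// ltW.
rewrite Ex_scale; last exact: L2_sqr (local_sum_L2 i).
by rewrite ler_wpM2l ?sqr_ge0// local_sum_sqr.
Qed.

(** The indices within [4 m] number at most [4^d b] and are handled by second moments. Beyond, the
    products live on balls of radius [m] separated by at least a quarter of the distance, and the
    mixing bound is summed through [ga]. Both parts are of order [b^2]. *)
Lemma local_prod_cov i :
  \sum_k `|cov P (local_prod i) (local_prod k)| <= 4 * N ^+ 4 * b ^+ 2 * Ga * (1 + (4 ^ d)%:R).
Proof.
have N40 : 0 <= 4 * N ^+ 4 * b ^+ 2 by rewrite !mulr_ge0 ?exprn_ge0// ltW.
have N2b : 0 < N * (N * b) by rewrite !mulr_gt0// (lt_le_trans _ b1).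
apply: (@le_trans _ _ (\sum_k (4 * N ^+ 4 * b ^+ 2 * ga (dist i k) +
    if (dist i k <= 4 * m)%N then N ^+ 2 * (4 * N ^+ 2 * Ga * b) else 0))); last first.
  rewrite big_split/= -mulr_sumr -big_mkcond/= mulrDr mulr1; apply: lerD.
    by rewrite ler_wpM2l.
  rewrite sumr_const -[_ *+ _]mulr_natr.
  rewrite (_ : 4 * N ^+ 4 * b ^+ 2 * Ga * (4 ^ d)%:R =
     N ^+ 2 * (4 * N ^+ 2 * Ga * b) * (b * (4 ^ d)%:R)); last by ring.
  apply: ler_wpM2l.
    by rewrite !mulr_ge0// ?exprn_ge0// ltW.
  apply: le_trans (card_ball_le i (4 * m)) _.
  rewrite -natrM -expnMn ler_nat.
  exact: ball_volume_4.
apply: ler_sum => k _.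
have [km|km] := leqP (dist i k) (4 * m).
  apply: (@le_trans _ _ (N ^+ 2 * (4 * N ^+ 2 * Ga * b))); last first.
    by rewrite lerDr mulr_ge0 ?ga_ge0.
  apply: le_trans (cov_le_sqr (local_prod_L2 i) (local_prod_L2 k)) _.
  rewrite ler_pdivrMl// [leRHS]mulr_natl mulr2n.
  by apply: lerD; exact: local_prod_sqr.
rewrite addr0; set D := dist i k in km *.
have [mr E D4 D4' mD] := far_gap m4 km.
have dep := mi_dep MI (i := i) mr; rewrite E in dep.
have H := cov_bounded (mi_near MI (i := i) (m := m)) (mi_far MI (i := i) (m := (D - m)%N)) dep
  (@local_prod_near i) (@local_prod_far i k (D - m)%N _) N2b N2b
  (local_prod_abs i) (local_prod_abs k).
apply: le_trans (H _) _; first by rewrite subnK.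
rewrite (_ : 4 * _ * _ = 4 * N ^+ 4 * b ^+ 2); last by ring.
apply: ler_wpM2l => //; apply: le_trans (ga_far D4').
exact: al_noninc.
Qed.

Let c : R := (Num.sqrt n)^-1.

Let n0 : 0 < n. Proof. by rewrite ltr0n card_gt0. Qed.
Let c0 : 0 < c. Proof. by rewrite invr_gt0 sqrtr_gt0. Qed.
Let ccn : c ^+ 2 * n = 1.
Proof. by rewrite exprVn sqr_sqrtr ?ltW// mulVf// gt_eqF. Qed.

Definition normalized_sum w := c * \sum_(i in F) Y i w.

Lemma normalized_sum_L2 : L2 P normalized_sum.
Proof. by apply: L2_scale; apply: L2_sum => i _; exact: field_L2. Qed.

Lemma normalized_sum_meas : measurable_fun setT normalized_sum.
Proof. exact: L2_meas normalized_sum_L2. Qed.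

Lemma normalized_var : Ex P (fun w => normalized_sum w ^+ 2) =
  c ^+ 2 * \sum_(i in F) \sum_(j in F) Ex P (fun w => Y i w * Y j w).
Proof.
under eq_fun do rewrite exprMn.
rewrite Ex_scale; last by apply: L2_sqr; apply: L2_sum => i _; exact: field_L2.
by rewrite Ex_sqr_sum// => i _; exact: field_L2.
Qed.

Lemma local_prod_mean i : Ex P (local_prod i) =
  \sum_(j in F | (dist i j <= m)%N) Ex P (fun w => Y i w * Y j w).
Proof.
rewrite -Ex_sum; last by move=> j _; apply: L2_mul; exact: field_L2.
by congr Ex; apply/funext => w; rewrite /local_prod mulr_sumr.
Qed.

(** The variance keeps all pairs, the local products only those within [m]; the covariances lost in
    each row are a tail of [ga], and [c^2 n = 1]. *)
Lemma normalized_var_local :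
  `|c ^+ 2 * (\sum_(i in F) Ex P (local_prod i)) - Ex P (fun w => normalized_sum w ^+ 2)| <= 4 * N ^+ 2 * tau.
Proof.
rewrite normalized_var -mulrBr -sumrB normrM (ger0_norm (sqr_ge0 c)).
apply: (@le_trans _ _ (c ^+ 2 * \sum_(i in F) (4 * N ^+ 2 * tau))); last first.
  by rewrite sumr_const -[_ *+ _]mulr_natr mulrCA ccn mulr1.
rewrite ler_wpM2l ?sqr_ge0//; apply: le_trans (ler_norm_sum _ _ _) _.
apply: ler_sum => i _; rewrite local_prod_mean.
rewrite (bigID (fun j => (dist i j <= m)%N) (fun j => j \in F))/= opprD addrA subrr add0r normrN.
apply: le_trans (ler_norm_sum _ _ _) _.
apply: (@le_trans _ _ (\sum_(j | (m < dist i j)%N) (4 * N ^+ 2 * ga (dist i j)))); last first.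
  by rewrite -mulr_sumr ler_wpM2l// mulr_ge0// sqr_ge0.
under eq_bigl do rewrite -ltnNge.
rewrite big_mkcondl; apply: ler_sum => j _; case: ifP => _; last first.
  by apply: mulr_ge0; [apply: mulr_ge0 => //; exact: sqr_ge0|exact: ga_ge0].
by apply: le_trans (field_cov i j); rewrite /cov !Y0 mulr0 subr0.
Qed.

(** The first absolute moment is at most the root of the variance, itself at most [n] times a row
    sum of covariances; after multiplication by [c^2] the order is [c b]. The root of [K >= 1] is
    replaced by [K]. *)
Lemma local_prod_fluct :
  Ex P (fun w => `|\sum_(i in F) (local_prod i w - Ex P (local_prod i))|) * c ^+ 2 <=
  c * (2 * N ^+ 2 * b * (Ga * (1 + (4 ^ d)%:R))).
Proof.
pose Z i w := local_prod i w - Ex P (local_prod i).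
have LZ i : L2 P (Z i) by apply: L2_sub; [exact: local_prod_L2|exact: L2_cst].
have EZ i k : Ex P (fun w => Z i w * Z k w) = cov P (local_prod i) (local_prod k).
  have [A B] := (local_prod_L2 i, local_prod_L2 k).
  rewrite (_ : (fun w => _) = fun w => (local_prod i w * local_prod k w - Ex P (local_prod k) * local_prod i w) - (Ex P (local_prod i) * local_prod k w - Ex P (local_prod i) * Ex P (local_prod k))); last first.
    by apply/funext => w; rewrite /Z; ring.
  have LAB := L2_mul A B; have LA := L1_scale (Ex P (local_prod k)) (L2_L1 A).
  have LB := L1_scale (Ex P (local_prod i)) (L2_L1 B).
  have Lc := L1_cst P (Ex P (local_prod i) * Ex P (local_prod k)).
  have L1' := L1_sub LAB LA; have L2' := L1_sub LB Lc.
  rewrite !Ex_sub// Ex_cst !Ex_scale//; [|exact: L2_L1..].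
  by rewrite /cov; ring.
set K := Ga * (1 + (4 ^ d)%:R).
have K1 : 1 <= K by rewrite -[1]mulr1 ler_pM// lerDl.
apply: (@le_trans _ _ (Num.sqrt (n * (4 * N ^+ 4 * b ^+ 2 * K)) * c ^+ 2)).
  rewrite ler_wpM2r ?sqr_ge0//; apply: le_trans (Ex_abs_sqrt _) _.
    by apply: L2_sum => i _; exact: LZ.
  rewrite ler_sqrt; last first.
    by rewrite !mulr_ge0 ?exprn_ge0// ?ltW// (le_trans _ K1).
  rewrite Ex_sqr_sum; last by move=> i _; exact: LZ.
  apply: (@le_trans _ _ (\sum_(i in F) (4 * N ^+ 4 * b ^+ 2 * K))); last first.
    by rewrite sumr_const -[_ *+ _]mulr_natl.
  apply: ler_sum => i _; rewrite /K mulrA.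
  apply: le_trans (local_prod_cov i).
  rewrite [leLHS]big_mkcond; apply: ler_sum => k _; case: ifP => // _.
  by rewrite EZ ler_norm.
rewrite (_ : 4 * N ^+ 4 * b ^+ 2 * K = (2 * N ^+ 2 * b) ^+ 2 * K); last by ring.
rewrite sqrtrM ?(ltW n0)// sqrtrM ?sqr_ge0// sqrtr_sqr ger0_norm; last by rewrite !mulr_ge0 ?exprn_ge0// ltW.
have cn : Num.sqrt n * c ^+ 2 = c by rewrite expr2 mulrA /c mulfV ?mul1r// gt_eqF// sqrtr_gt0.
rewrite mulrAC cn ler_pM2l// ler_wpM2l ?mulr_ge0 ?exprn_ge0// ?(ltW N0)//.
rewrite -[leRHS]ger0_norm ?(le_trans _ K1)// -sqrtr_sqr ler_sqrt ?sqr_ge0//.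
by rewrite expr2 ler_peMl// (le_trans _ K1).
Qed.

(** Once the local sum is removed, only indices at distance at least [m + 1] remain in the sine. As
    [Y i] is centred, the expectation is a covariance across a strip of width [m - 1]. *)
Lemma stein_far (l t : R) i : i \in F ->
  `|Ex P (fun w => Y i w * sin (l * (normalized_sum w - c * local_sum i w) + t))| <= 4 * N * al (m %/ 4).
Proof.
move=> iF.
pose V w := sin (l * (c * \sum_(j in F | (m < dist i j)%N) Y j w) + t).
rewrite (_ : (fun w => _) = fun w => Y i w * V w); last first.
  apply/funext => w; rewrite /V -mulrBr /local_sum.
  rewrite (bigID (fun j => (dist i j <= m)%N) (fun j => j \in F))/= [X in X - _]addrC addrK.
  by under [in RHS]eq_bigl do rewrite ltnNge.
have V1 w : `|V w| <= 1 by exact: sin_abs_le1.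
have mV : meas_for (far i m.+1) V.
  apply: measurableT_comp; first exact: measurable_sin.
  apply: measurable_funD => //; apply: measurable_funM => //; apply: measurable_funM => //.
  by apply: measurable_sum_cond => j /andP[_ jm]; exact: Yad.2.
have [m1 E m4'] := div4_le_pred m4.
have dep := mi_dep MI (i := i) m1; rewrite -E in dep.
have mY : meas_for (near i 0%N) (Y i) by apply: Yad.1; rewrite (mi_dist0 MI).
have := cov_bounded (mi_near MI (i := i) (m := 0%N)) (mi_far MI (i := i) (m := m.+1)) dep mY mV N0 ltr01 (YN i) V1.
rewrite /cov Y0 mul0r subr0 mulr1 => /le_trans; apply.
by apply: ler_wpM2l; [rewrite mulr_ge0// ltW|exact: al_noninc].
Qed.

(** In [E V sin(l V + t) = c sum_i E Y_i sin(l V + t)] the sine is written as its value at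
    [V - c S_i], with [S_i] the local sum, plus [l c S_i cos(l V + t)] plus a remainder. [T1] bounds
    the decoupled part and [T3] the quadratic remainder; [T2] replaces the local products by their
    means, and [T4] the sum of these means by the variance. *)
Lemma stein_bounded (l t : R) : 0 <= l <= 1 ->
  `|Ex P (fun w => normalized_sum w * sin (l * normalized_sum w + t)) -
    l * Ex P (fun w => normalized_sum w ^+ 2) * Ex P (fun w => cos (l * normalized_sum w + t))| <=
  c * n * (4 * N * al (m %/ 4)) +
  (c * (2 * N ^+ 2 * b * (Ga * (1 + (4 ^ d)%:R))) + c * (N * (4 * N ^+ 2 * Ga * b)) + 4 * N ^+ 2 * tau).
Proof.
move=> /andP[l0 l1].
set V := normalized_sum; set v := Ex P (fun w => V w ^+ 2).
have LV := normalized_sum_L2; have mV := normalized_sum_meas.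
pose g w := sin (l * V w + t); pose g' w := cos (l * V w + t).
pose gi i w := sin (l * (V w - c * local_sum i w) + t).
pose rho i w := g w - gi i w - l * c * local_sum i w * g' w.
have mgg (f : T -> R) : measurable_fun setT f -> measurable_fun setT (fun w => sin (l * f w + t)).
  move=> mf; apply: measurableT_comp; first exact: measurable_sin.
  by apply: measurable_funD => //; exact: measurable_funM.
have Lg : L2 P g.
  by apply: (@L2_bounded _ _ _ _ _ 1); [exact: mgg|move=> w; exact: sin_abs_le1].
have Lgi i : L2 P (gi i).
  apply: (@L2_bounded _ _ _ _ _ 1); last by move=> w; exact: sin_abs_le1.
  apply: mgg; apply: measurable_funB => //; apply: measurable_funM => //.
  exact: L2_meas (local_sum_L2 i).
have g'1 w : `|g' w| <= 1 by exact: cos_abs_le1.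
have Lg' : L2 P g'.
  apply: (@L2_bounded _ _ _ _ _ 1) => //.
  apply: measurableT_comp; first exact: measurable_cos.
  by apply: measurable_funD => //; exact: measurable_funM.
have rho_le i w : `|rho i w| <= c ^+ 2 * local_sum i w ^+ 2.
  have := sin_taylor (l * V w + t) (- (l * c * local_sum i w)).
  rewrite (_ : - (l * c * local_sum i w) + (l * V w + t) = l * (V w - c * local_sum i w) + t); last by ring.
  rewrite (_ : _ - _ - _ = - rho i w); last by rewrite /rho /g /gi /g'; ring.
  rewrite normrN.
  move=> /le_trans; apply; rewrite sqrrN -exprMn -mulrA [leLHS]exprMn ler_piMl ?sqr_ge0//.
  by rewrite expr_le1.
have LYrho i : L1 P (fun w => Y i w * rho i w).
  apply: L2_mul; first exact: field_L2.
  apply: L2_sub; first exact: L2_sub.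
  apply: (@L2_dom _ _ _ _ _ (fun w => l * c * `|local_sum i w|)).
  - apply: measurable_funM; last exact: L2_meas Lg'.
    by apply: measurable_funM => //; exact: L2_meas (local_sum_L2 i).
  - apply: L2_scale; apply: (@L2_bounded _ _ _ _ _ (N * b)).
      by apply: measurableT_comp => //; exact: L2_meas (local_sum_L2 i).
    by move=> w; rewrite normr_id local_sum_abs.
  - move=> w; rewrite normrM -[leRHS]mulr1 ler_pM//.
    by rewrite normrM (@ger0_norm _ (l * c))// mulr_ge0// ltW.
have LYgi i : L1 P (fun w => Y i w * gi i w) by apply: L2_mul => //; exact: field_L2.
have LZg i : L1 P (fun w => local_prod i w * g' w) by apply: L2_mul => //; exact: local_prod_L2.
have EVg : Ex P (fun w => V w * g w) = c * (\sum_(i in F) Ex P (fun w => Y i w * gi i w)) +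
   (l * c ^+ 2 * (\sum_(i in F) Ex P (fun w => local_prod i w * g' w)) +
    c * (\sum_(i in F) Ex P (fun w => Y i w * rho i w))).
  rewrite -!Ex_sum//.
  rewrite -!Ex_scale; [|by apply: L1_sum => i _..].
  rewrite -Ex_add; [|by apply: L1_scale; apply: L1_sum => i _..].
  rewrite -Ex_add; first last.
    by apply: L1_add; apply: L1_scale; apply: L1_sum => i _.
    by apply: L1_scale; apply: L1_sum => i _.
  congr Ex; apply/funext => w.
  have E : \sum_(i in F) Y i w * g w = \sum_(i in F) Y i w * gi i w +
      (l * c * (\sum_(i in F) local_prod i w * g' w) + \sum_(i in F) Y i w * rho i w).
    rewrite mulr_sumr -!big_split/=; apply: eq_bigr => i _.
    by rewrite /rho /local_prod; ring.
  by rewrite /V /normalized_sum -mulrA mulr_suml E; ring.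
have T1 : `|c * (\sum_(i in F) Ex P (fun w => Y i w * gi i w))| <= c * n * (4 * N * al (m %/ 4)).
  rewrite normrM gtr0_norm// -mulrA ler_pM2l//; apply: le_trans (ler_norm_sum _ _ _) _.
  apply: (@le_trans _ _ (\sum_(i in F) (4 * N * al (m %/ 4)))).
    by apply: ler_sum => i iF; exact: stein_far.
  by rewrite sumr_const -[_ *+ _]mulr_natl.
have T3 : `|c * (\sum_(i in F) Ex P (fun w => Y i w * rho i w))| <= c * (N * (4 * N ^+ 2 * Ga * b)).
  rewrite normrM gtr0_norm// ler_pM2l//; apply: le_trans (ler_norm_sum _ _ _) _.
  apply: (@le_trans _ _ (\sum_(i in F) (c ^+ 2 * (N * (4 * N ^+ 2 * Ga * b))))); last first.
    by rewrite sumr_const -[_ *+ _]mulr_natl mulrA [n * _]mulrC ccn mul1r.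
  apply: ler_sum => i iF.
  apply: (@le_trans _ _ (Ex P (fun w => (N * c ^+ 2) * local_sum i w ^+ 2))).
    apply: Ex_absle; [exact: LYrho|by apply: L1_scale; exact: L2_sqr (local_sum_L2 i)|].
    by move=> w; rewrite normrM -mulrA ler_pM.
  rewrite Ex_scale; last exact: L2_sqr (local_sum_L2 i).
  rewrite [N * c ^+ 2]mulrC -[leLHS]mulrA ler_wpM2l ?sqr_ge0// ler_pM2l//.
  exact: local_sum_sqr.
set a := c ^+ 2 * (\sum_(i in F) Ex P (local_prod i)).
have T2 : `|l * c ^+ 2 * (\sum_(i in F) Ex P (fun w => local_prod i w * g' w)) - l * a * Ex P g'| <=
    c * (2 * N ^+ 2 * b * (Ga * (1 + (4 ^ d)%:R))).
  have LZ' i : L1 P (fun w => (local_prod i w - Ex P (local_prod i)) * g' w).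
    by apply: L2_mul => //; apply: L2_sub; [exact: local_prod_L2|exact: L2_cst].
  rewrite (_ : _ - _ = l * (c ^+ 2 * Ex P (fun w => (\sum_(i in F) (local_prod i w - Ex P (local_prod i))) * g' w))); last first.
    under [in RHS]eq_fun do rewrite mulr_suml.
    rewrite Ex_sum; last by move=> i _; exact: LZ'.
    rewrite /a -!mulrA -mulrBr; congr (_ * _); rewrite -mulrBr; congr (_ * _).
    rewrite -mulrBr; congr (_ * _).
    rewrite mulr_suml -sumrB; apply: eq_bigr => i _.
    under [in RHS]eq_fun do rewrite mulrBl.
    rewrite Ex_sub//; last by apply: L1_scale; exact: L2_L1.
    by rewrite Ex_scale//; exact: L2_L1.
  rewrite normrM ger0_norm// -[leRHS]mul1r ler_pM//.
  rewrite normrM ger0_norm ?sqr_ge0// mulrC; apply: le_trans local_prod_fluct.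
  rewrite ler_wpM2r ?sqr_ge0//.
  have LZs : L2 P (fun w => \sum_(i in F) (local_prod i w - Ex P (local_prod i))).
    by apply: L2_sum => i _; apply: L2_sub; [exact: local_prod_L2|exact: L2_cst].
  apply: Ex_absle; [exact: L2_mul|exact: L1_abs (L2_L1 LZs)|].
  by move=> w; rewrite normrM -[leRHS]mulr1 ler_pM.
have T4 : `|l * a * Ex P g' - l * v * Ex P g'| <= 4 * N ^+ 2 * tau.
  rewrite -mulrBl -mulrBr -mulrA normrM ger0_norm// -[leRHS]mul1r ler_pM//.
  rewrite normrM -[leRHS]mulr1 ler_pM//; first exact: normalized_var_local.
  by apply: Ex_absle_cst => //; exact: L2_L1.
rewrite EVg.
rewrite (_ : forall A B C D : R, A + (B + C) - D = A + ((B - l * a * Ex P g') + C + (l * a * Ex P g' - D))); last by move=> *; ring.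
apply: le_trans (ler_normD _ _) _; apply: lerD => //.
apply: le_trans (ler_normD _ _) _; apply: lerD => //.
by apply: le_trans (ler_normD _ _) _; apply: lerD.
Qed.

End BoundedField.

Lemma sum_shift2 {R : realType} (F : nat -> R) Q N : (2 <= Q)%N ->
  \sum_(Q <= q < N) F (q - 2)%N = \sum_(Q - 2 <= q < N - 2) F q.
Proof.
move=> Q2; rewrite -{1}(subnK Q2) big_addn; apply: eq_bigr => q _.
by rewrite addnK.
Qed.

(** * Dyadic summation of the mixing rate *)

Section RateTails.
Context {R : realType}.
Variables (d : nat) (al : nat -> R) (ka : R).
Hypothesis al0 : forall r, 0 <= al r.
Hypothesis al1 : forall r, al r <= 1.
Hypothesis al_noninc : forall r s, (r <= s)%N -> al s <= al r.
Hypothesis ka01 : 0 < ka <= 1.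

Definition rate (s : nat) : R := if (s < 4)%N then 1 else al (s %/ 4) `^ ka.

(** The term of the condensed series for the integral of [r^(d - 1) al(r)^ka]: of the order of
    [2^(q d)] sites lie at a distance of the order of [2^q]. *)
Definition dyadic_mass (q : nat) : R := (2 ^ (q * d))%:R * al (2 ^ q) `^ ka.

Hypothesis mass_tail : forall e : R, 0 < e ->
  exists Q, forall M, \sum_(Q <= q < M) dyadic_mass q <= e.

Lemma al_le_powR r : al r <= al r `^ ka.
Proof.
have /andP[k0 k1] := ka01.
have [->|ar] := eqVneq (al r) 0; first exact: powR_ge0.
apply: ger1_powR => //; rewrite al1 andbT lt_neqAle eq_sym ar; exact: al0.
Qed.

Lemma powR_al_noninc r s : (r <= s)%N -> al s `^ ka <= al r `^ ka.
Proof.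
have /andP[k0 k1] := ka01.
by move=> rs; apply: ge0_ler_powR; rewrite ?nnegrE//; [exact: ltW|exact: al_noninc].
Qed.

Lemma powR_al_le1 r : al r `^ ka <= 1.
Proof.
have /andP[k0 k1] := ka01.
have [->|ar] := eqVneq (al r) 0; first by rewrite powR0// gt_eqF.
rewrite -[leRHS](powRr0 (al r)); apply: ger_powR; last exact: ltW.
by rewrite al1 andbT lt_neqAle eq_sym ar; exact: al0.
Qed.

Lemma rate_near s : (s < 4)%N -> 1 <= rate s.
Proof. by rewrite /rate => ->. Qed.

Lemma rate_far s : (4 <= s)%N -> al (s %/ 4) <= rate s.
Proof. by move=> s4; rewrite /rate ltnNge s4/=; exact: al_le_powR. Qed.

Lemma rate_ge0 s : 0 <= rate s.
Proof. by rewrite /rate; case: ifP => // _; exact: powR_ge0. Qed.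

Lemma rate_le1 s : rate s <= 1.
Proof. by rewrite /rate; case: ifP => // _; exact: powR_al_le1. Qed.

Lemma dyadic_mass_ge0 q : 0 <= dyadic_mass q.
Proof. by rewrite mulr_ge0 ?powR_ge0. Qed.

Lemma rate_dyadic q s : (2 <= q)%N -> (2 ^ q <= s)%N -> rate s <= al (2 ^ (q - 2)) `^ ka.
Proof.
move=> q2 qs; have s4 : (4 <= s)%N.
  by apply: leq_trans qs; rewrite -[4%N]/(2 ^ 2)%N leq_exp2l.
rewrite /rate ltnNge s4/=; apply: powR_al_noninc.
by rewrite leq_divRL// -[4%N]/(2 ^ 2)%N -expnD subnK.
Qed.

Lemma dyadic_mass_shift q : (2 <= q)%N ->
  (2 ^ ((q + 2) * d))%:R * al (2 ^ (q - 2)) `^ ka = (16 ^ d)%:R * dyadic_mass (q - 2).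
Proof.
move=> q2; rewrite /dyadic_mass mulrA -natrM; congr (_%:R * _).
rewrite -[16%N]/(2 ^ 4)%N -expnM -expnD -mulnDl; congr (_ ^ (_ * _))%N; lia.
Qed.

Section Index.
Variables (I : finType) (dist : I -> I -> nat).
Hypothesis ball : forall i r, (#|[pred j | dist i j <= r]| <= (r.*2.+1) ^ d)%N.

(** Sites are grouped by the integer logarithm [q] of their distance. Such a shell lies in a ball of
    at most [2^((q + 2) d)] sites, the rate on it is at most [al(2^(q - 2))^ka] because of the
    quarter, and the discrepancy of four doublings is the factor [16^d]. A bound [M] exists because
    the index set is finite. *)
Lemma rate_tail_mass i Q : (2 <= Q)%N ->
  exists M, \sum_(j | (2 ^ Q <= dist i j)%N) rate (dist i j) <=
    (16 ^ d)%:R * \sum_(Q - 2 <= q < M) dyadic_mass q.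
Proof.
move=> Q2; pose M := (\max_j dist i j).+1.
have DM j : (dist i j < M)%N by rewrite ltnS; apply: (leq_bigmax j).
exists (M + Q - 2)%N.
pose tl j := trunc_log 2 (dist i j).
apply: (@le_trans _ _ (\sum_(j | (2 ^ Q <= dist i j)%N) \sum_(Q <= q < M + Q)
    (if tl j == q then al (2 ^ (q - 2)) `^ ka else 0))).
  apply: ler_sum => j Qj.
  have D0 : (0 < dist i j)%N by apply: leq_trans Qj; rewrite expn_gt0.
  have /andP[tlD Dtl] := trunc_log_bounds (isT : (1 < 2)%N) D0.
  have Qtl : (Q <= tl j)%N.
    by rewrite -ltnS -(@ltn_exp2l 2)// (leq_ltn_trans Qj).
  have tlM : (tl j < M + Q)%N.
    apply: ltn_addr; apply: leq_ltn_trans (DM j); apply: leq_trans tlD; exact/ltnW/ltn_expl.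
  rewrite (bigD1_seq (tl j)) ?iota_uniq ?mem_index_iota ?Qtl//= eqxx.
  apply: (@le_trans _ _ (al (2 ^ (tl j - 2)) `^ ka)).
    by apply: rate_dyadic => //; exact: leq_trans Q2 Qtl.
  by rewrite lerDl sumr_ge0// => q _; case: ifP => // _; exact: powR_ge0.
rewrite mulr_sumr -(@sum_shift2 _ (fun q => (16 ^ d)%:R * dyadic_mass q))// exchange_big/=.
rewrite big_nat [leRHS]big_nat; apply: ler_sum => q /andP[Qq _].
rewrite -dyadic_mass_shift ?(leq_trans Q2)//.
apply: (@le_trans _ _ (\sum_(j | (dist i j <= (2 ^ q.+1).-1)%N) al (2 ^ (q - 2)) `^ ka)).
  rewrite big_mkcond [leRHS]big_mkcond; apply: ler_sum => j _.
  case: ifP => Qj; last by case: ifP => // _; exact: powR_ge0.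
  have D0 : (0 < dist i j)%N by apply: leq_trans Qj; rewrite expn_gt0.
  have /andP[_ Dtl] := trunc_log_bounds (isT : (1 < 2)%N) D0.
  case: ifP => [/eqP tlq|_]; last by case: ifP => // _; exact: powR_ge0.
  by rewrite -ltnS prednK ?expn_gt0// -tlq Dtl.
rewrite sumr_const -[_ *+ _]mulr_natl ler_wpM2r ?powR_ge0// ler_nat.
apply: leq_trans (ball _ _) _; rewrite expnM; case: d => [|d']; rewrite ?expn0// leq_exp2r//.
have : (0 < 2 ^ q)%N by rewrite expn_gt0.
by rewrite addn2 !expnS; lia.
Qed.

Lemma rate_tail (e : R) Q : (2 <= Q)%N ->
  (forall M, \sum_(Q - 2 <= q < M) dyadic_mass q <= e) ->
  forall i, \sum_(j | (2 ^ Q <= dist i j)%N) rate (dist i j) <= (16 ^ d)%:R * e.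
Proof.
move=> Q2 He i; have [M HM] := rate_tail_mass i Q2.
by apply: le_trans HM _; rewrite ler_wpM2l.
Qed.

Lemma rate_total (e : R) Q : (2 <= Q)%N ->
  (forall M, \sum_(Q - 2 <= q < M) dyadic_mass q <= e) ->
  forall i, \sum_j rate (dist i j) <= (2 ^ (Q.+1 * d))%:R + (16 ^ d)%:R * e.
Proof.
move=> Q2 He i; rewrite (bigID (fun j => (2 ^ Q <= dist i j)%N))/= addrC.
apply: lerD; last exact: rate_tail.
apply: (@le_trans _ _ (\sum_(j | (dist i j <= (2 ^ Q).-1)%N) 1)).
  rewrite big_mkcond [leRHS]big_mkcond; apply: ler_sum => j _.
  rewrite -ltnNge; case: ifP => [Dj|_]; last by case: ifP.
  by rewrite -ltnS prednK ?expn_gt0// Dj; exact: rate_le1.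
rewrite sumr_const ler_nat; apply: leq_trans (ball _ _) _.
rewrite expnM; case: d => [|d']; rewrite ?expn0// leq_exp2r//.
have : (0 < 2 ^ Q)%N by rewrite expn_gt0.
by rewrite !expnS; lia.
Qed.

End Index.
End RateTails.

Lemma one_add_le_davydov {R : realType} (K : R) : 1 <= K -> 1 + K <= 4 + 6 * K ^+ 2.
Proof. nra. Qed.

(** Young's inequality with weight [s] for the cross term of
    [a^2 - b^2 = 2 (a - b) a - (a - b)^2]. *)
Lemma sqr_diff_le {R : realType} (s a b : R) : 0 < s ->
  `|a ^+ 2 - b ^+ 2| <= (s^-1 * (a - b) ^+ 2 + s * a ^+ 2) + (a - b) ^+ 2.
Proof.
move=> s0; have E : a ^+ 2 - b ^+ 2 = 2 * ((a - b) * a) - (a - b) ^+ 2 by ring.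
rewrite E; apply: le_trans (ler_normB _ _) _; rewrite (ger0_norm (sqr_ge0 _)).
rewrite lerD2r ler_norml.
set r := Num.sqrt s; have r0 : 0 < r by rewrite sqrtr_gt0.
have -> : s = r ^+ 2 by rewrite sqr_sqrtr// ltW.
have H1 := sqr_ge0 (r^-1 * (a - b) - r * a); have H2 := sqr_ge0 (r^-1 * (a - b) + r * a).
have P1 : r^-1 * (a - b) * (r * a) = (a - b) * a by field; rewrite gt_eqF.
rewrite -exprVn -!exprMn; apply/andP; split.
  by move: H2; rewrite sqrrD P1 -mulr_natl; lra.
by move: H1; rewrite sqrrB P1 -mulr_natl; lra.
Qed.

(** * Truncation of fields with bounded moments of order p *)

Section MomentField.
Context {disp : measure_display} {T : measurableType disp} {R : realType}.
Variables (P : probability T R) (d : nat) (al : nat -> R) (p K : R).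
Hypothesis al0 : forall r, 0 <= al r.
Hypothesis al1 : forall r, al r <= 1.
Hypothesis al_noninc : forall r s, (r <= s)%N -> al s <= al r.
Hypothesis p2 : 2 < p.
Hypothesis K1 : 1 <= K.

Let ka : R := 1 - 2 / p.

Lemma kappa01 : 0 < ka <= 1.
Proof.
have p0 : 0 < p by rewrite (lt_trans _ p2).
by rewrite subr_gt0 ltr_pdivrMr// mul1r p2/= gerBl divr_ge0// ltW.
Qed.

Definition moment_le (f : T -> R) :=
  [/\ L2 P f, L1 P (fun w => `|f w| `^ p) & Ex P (fun w => `|f w| `^ p) <= K].

Lemma sqr_le1_powR (x : R) : x ^+ 2 <= 1 + `|x| `^ p.
Proof.
have := sqr_le_powR ltr01 (_ : 1 <= `|x|) (ltW p2).
have [x1|x1] := leP `|x| 1.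
  move=> _; apply: (@le_trans _ _ 1); last by rewrite lerDl powR_ge0.
  by rewrite -(real_normK (num_real x)) expr_le1.
by rewrite powR1 mul1r real_normK ?num_real// => /(_ (ltW x1)) h; rewrite (le_trans h)// lerDr.
Qed.

Lemma moment_sqr f : moment_le f -> Ex P (fun w => f w ^+ 2) <= 1 + K.
Proof.
move=> [Lf Lp Ep]; have Lc := L1_cst P 1.
apply: (@le_trans _ _ (Ex P (fun w => 1 + `|f w| `^ p))).
  by apply: Ex_le; [exact: L2_sqr|exact: L1_add|move=> w; exact: sqr_le1_powR].
by rewrite Ex_add// Ex_cst lerD.
Qed.

Let CK : R := 4 + 6 * K ^+ 2.

Lemma davydov_const_ge : 1 + K <= CK.
Proof. exact: one_add_le_davydov. Qed.

(* The case [b = 0], where [b `^ (- p^-1)] is not a truncation level, is obtained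
   by letting [b] tend to 0. *)
Lemma cov_davydov0 G H (a b : R) U V : sub_salgebra G -> sub_salgebra H ->
  dependence_le P G H a -> meas_for G U -> meas_for H V ->
  moment_le U -> moment_le V -> a <= b -> 0 <= b -> b <= 1 ->
  `|cov P U V| <= CK * b `^ ka.
Proof.
move=> sG sH dep mU mV [LU LUp EU] [LV LVp EV] ab b0 b1.
have /andP[ka0 _] := kappa01.
have [b00|bn0] := eqVneq b 0; last first.
  by apply: (cov_davydov sG sH dep mU mV) => //; rewrite lt_neqAle eq_sym bn0.
have C0 : 0 < CK by apply: lt_le_trans davydov_const_ge; rewrite ltr_wpDr// (le_trans _ K1).
rewrite b00 powR0 ?gt_eqF// mulr0; apply/ler_addgt0Pr => e e0; rewrite add0r.
pose b' := Num.min 1 ((e / CK) `^ ka^-1).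
have b'0 : 0 < b' by rewrite lt_min ltr01 powR_gt0// divr_gt0.
have ab' : a <= b' by rewrite (le_trans ab)// b00 ltW.
have b'1 : b' <= 1 by rewrite ge_min lexx.
apply: le_trans (cov_davydov sG sH dep mU mV p2 K1 LU LV LUp LVp EU EV ab' b'0 b'1) _.
have bka : b' `^ ka <= ((e / CK) `^ ka^-1) `^ ka.
  apply: (ge0_ler_powR (ltW ka0)); rewrite ?nnegrE ?powR_ge0//; first exact: ltW b'0.
  by rewrite ge_min lexx orbT.
move: bka; rewrite -powRrM mulVf ?gt_eqF// powRr1; last by rewrite divr_ge0// ltW.
by rewrite ler_pdivlMr// mulrC.
Qed.

Section Field.
Variables (I : finType) (dist : I -> I -> nat) (near far : I -> nat -> set_system T).
Hypothesis MI : mixing_index P d al dist near far.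

Let ga : nat -> R := rate al ka.

Lemma adapted_meas (f : I -> T -> R) i : adapted dist near far f -> measurable_fun setT (f i).
Proof.
by move=> ad; apply: (meas_for_meas (mi_near MI (i := i) (m := 0%N))); apply: ad.1; rewrite (mi_dist0 MI).
Qed.

Lemma field_davydov (f : I -> T -> R) i j : adapted dist near far f -> (forall i, moment_le (f i)) ->
  `|cov P (f i) (f j)| <= CK * ga (dist i j).
Proof.
move=> ad mom; rewrite /ga /rate.
have [[Li _ _] [Lj _ _]] := (mom i, mom j).
case: ltnP => s4.
  rewrite mulr1; apply: le_trans (cov_le_sqr Li Lj) _; rewrite ler_pdivrMl//.
  rewrite [leRHS]mulr_natl mulr2n.
  apply: lerD; apply: le_trans davydov_const_ge; exact: moment_sqr.
have E : dist i j = (0 + (dist i j - 2) + 2)%N by rewrite add0n subnK// (leq_trans _ s4).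
have r0 : (0 < dist i j - 2)%N by rewrite subn_gt0 (leq_trans _ s4).
have D := mi_dep MI (i := i) r0; rewrite -E in D.
apply: (cov_davydov0 (mi_near MI (i:=i) (m:=0%N)) (mi_far MI (i:=i) (m:=dist i j)) D) => //.
- by apply: ad.1; rewrite (mi_dist0 MI).
- exact: ad.2.
- by apply: al_noninc; exact: div4_le_sub2.
Qed.

Lemma adapted_comp (g : R -> R) (f : I -> T -> R) : measurable_fun setT g ->
  adapted dist near far f -> adapted dist near far (fun i w => g (f i w)).
Proof.
by move=> mg [a1 a2]; split=> i m j h; apply: measurableT_comp => //; [exact: a1|exact: a2].
Qed.

Lemma sum_cov_le (F : {set I}) (a : I -> I -> R) B : F != finset.set0 -> (forall i j, 0 <= a i j) ->
  (forall i, \sum_j a i j <= B) ->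
  ((Num.sqrt #|F|%:R)^-1) ^+ 2 * (\sum_(i in F) \sum_(j in F) a i j) <= B.
Proof.
move=> F0 a0 aB; have n0 : 0 < #|F|%:R :> R by rewrite ltr0n card_gt0.
rewrite exprVn sqr_sqrtr ?(ltW n0)// ler_pdivrMl// mulr_natl -sumr_const.
apply: ler_sum => i _; apply: le_trans (aB i).
by rewrite big_mkcond; apply: ler_sum => j _; case: ifP.
Qed.

Lemma cov_shift (f g : T -> R) (a b : R) : L2 P f -> L2 P g ->
  cov P (fun w => f w - a) (fun w => g w - b) = cov P f g.
Proof.
move=> Lf Lg; have Lc x : L2 P (fun=> x) := L2_cst P x.
rewrite cov_addl//; last exact: L2_sub.
rewrite cov_cstl ?addr0; last by apply: L2_L1; exact: L2_sub.
rewrite covC cov_addl// cov_cstl ?addr0; last exact: L2_L1.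
by rewrite covC.
Qed.

Lemma Ex_centered (f g : T -> R) : L2 P f -> L2 P g ->
  Ex P (fun w => (f w - Ex P f) * (g w - Ex P g)) = cov P f g.
Proof.
move=> Lf Lg; rewrite -(cov_shift (Ex P f) (Ex P g) Lf Lg) /cov.
have H (h : T -> R) : L2 P h -> Ex P (fun w => h w - Ex P h) = 0.
  by move=> Lh; rewrite Ex_sub ?Ex_cst ?subrr//; [exact: L2_L1|exact: L1_cst].
by rewrite !H// mulr0 subr0.
Qed.

Lemma moment_le_dom (f g : T -> R) : measurable_fun setT f -> moment_le g ->
  (forall w, `|f w| <= `|g w|) -> moment_le f.
Proof.
have p0 : 0 <= p by rewrite ltW// (lt_trans _ p2).
move=> mf [Lg Lp Ep] fg.
have fgp w : `|f w| `^ p <= `|g w| `^ p by apply: ge0_ler_powR; rewrite ?nnegrE.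
have Lfp : L1 P (fun w => `|f w| `^ p).
  apply: (L1_dom _ Lp); last by move=> w; rewrite ger0_norm ?powR_ge0.
  apply: (@measurableT_comp _ _ _ _ _ _ (fun x : R => x `^ p)); first exact: measurable_powR.
  exact: measurableT_comp.
split=> //; last by apply: le_trans Ep; exact: Ex_le.
apply: (@L2_dom _ _ _ _ f (fun w => `|g w|)) => //.
split; first by apply: measurableT_comp => //; exact: L2_meas Lg.
by under eq_fun do rewrite real_normK ?num_real//; exact: L2_sqr.
Qed.

Lemma clip_remainder_abs N (x : R) : 0 < N -> `|x - clip N x| <= `|x|.
Proof.
move=> N0; have [s /andP[s0 s1] ->] := clip_scale x N0.
rewrite -[X in X - _]mul1r -mulrBl normrM ger0_norm ?subr_ge0// ler_piMl//.
by rewrite gerBl.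
Qed.

Section Clipped.
Variables (xi : I -> T -> R) (F : {set I}) (N : R) (Q : nat) (tau Ga : R).
Hypothesis ad : adapted dist near far xi.
Hypothesis mom : forall i, moment_le (xi i).
Hypothesis xi0 : forall i, Ex P (xi i) = 0.
Hypothesis F0 : F != finset.set0.
Hypothesis N1 : 1 <= N.
Hypothesis tau_tail : forall i, \sum_(j | (2 ^ Q <= dist i j)%N) ga (dist i j) <= tau.
Hypothesis Ga_sum : forall i, \sum_j ga (dist i j) <= Ga.

Let N0 : 0 < N. Proof. exact: lt_le_trans N1. Qed.
Let c : R := (Num.sqrt #|F|%:R)^-1.
Let rem i w := xi i w - clip N (xi i w).

(** Clipping destroys the zero mean on which the bounded estimate relies, hence the recentring and
    the bound [2 N] in place of [N]. *)
Definition clipped i w := clip N (xi i w) - Ex P (fun w => clip N (xi i w)).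

Lemma clip_L2 i : L2 P (fun w => clip N (xi i w)).
Proof.
apply: (@L2_bounded _ _ _ _ _ N); last by move=> w; exact: clip_abs (ltW N0).
by apply: measurableT_comp; [exact: measurable_clip|exact: adapted_meas].
Qed.

Lemma clipped_adapted : adapted dist near far clipped.
Proof.
have mc : measurable_fun setT (clip N) by exact: measurable_clip.
by split=> i m j h; apply: measurable_funB => //; apply: measurableT_comp => //; [exact: ad.1|exact: ad.2].
Qed.

Lemma clipped_abs i w : `|clipped i w| <= 2 * N.
Proof.
rewrite mulr_natl mulr2n; apply: le_trans (ler_normB _ _) _; apply: lerD.
  exact: clip_abs (ltW N0).
by apply: Ex_absle_cst; [exact: L2_L1 (clip_L2 i)|move=> w'; exact: clip_abs (ltW N0)].
Qed.

Lemma clipped_mean i : Ex P (clipped i) = 0.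
Proof. by rewrite Ex_sub ?Ex_cst ?subrr//; [exact: L2_L1 (clip_L2 i)|exact: L1_cst]. Qed.

Let xi_L2 i : L2 P (xi i). Proof. by have [] := mom i. Qed.
Let rem_L2 i : L2 P (rem i). Proof. by apply: L2_sub => //; exact: clip_L2. Qed.

(** Below distance [2^Q] there are at most [2^((Q + 1) d)] sites, each with a covariance made small
    by a large [N]. Beyond, the remainders inherit the moment bound of the field, and Davydov's
    inequality gives a tail of the rate whatever [N] is. So [Q] can be fixed before [N]. *)
Lemma remainder_cov i : \sum_j `|cov P (rem i) (rem j)| <=
  (2 ^ (Q.+1 * d))%:R * (N `^ (2 - p) * K) + CK * tau.
Proof.
have radp : adapted dist near far rem.
  have mc : measurable_fun setT (fun x : R => x - clip N x).
    by apply: measurable_funB => //; exact: measurable_clip.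
  exact: (@adapted_comp (fun x : R => x - clip N x)).
have rmom j : moment_le (rem j).
  apply: (moment_le_dom _ (mom j)); first exact: adapted_meas.
  by move=> w; exact: clip_remainder_abs.
have rsq j : Ex P (fun w => rem j w ^+ 2) <= N `^ (2 - p) * K.
  have [_ Lp Ep] := mom j.
  apply: (@le_trans _ _ (Ex P (fun w => N `^ (2 - p) * `|xi j w| `^ p))).
    apply: Ex_le; [exact: L2_sqr|exact: L1_scale|].
    by move=> w; apply: clip_sqr_powR => //; exact: ltW.
  by rewrite Ex_scale// ler_wpM2l// powR_ge0.
rewrite (bigID (fun j => (2 ^ Q <= dist i j)%N))/= addrC; apply: lerD.
  apply: (@le_trans _ _ (\sum_(j | (dist i j <= (2 ^ Q).-1)%N) (N `^ (2 - p) * K))).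
    rewrite big_mkcond [leRHS]big_mkcond; apply: ler_sum => j _.
    have B0 : 0 <= N `^ (2 - p) * K by rewrite mulr_ge0 ?powR_ge0// (le_trans _ K1).
    rewrite -ltnNge; case: ifP => [Dj|_]; last by case: ifP.
    rewrite -ltnS prednK ?expn_gt0// Dj.
    apply: le_trans (cov_le_sqr (rem_L2 i) (rem_L2 j)) _.
    by rewrite ler_pdivrMl// [leRHS]mulr_natl mulr2n; apply: lerD.
  rewrite sumr_const -[_ *+ _]mulr_natl ler_wpM2r ?mulr_ge0 ?powR_ge0 ?(le_trans _ K1)//.
  rewrite ler_nat; apply: leq_trans (mi_ball MI _ _) _.
  rewrite expnM; case: (d) => [|d']; rewrite ?expn0// leq_exp2r//.
  by have := expn_gt0 2 Q; rewrite !expnS; case: (2 ^ Q)%N => // k _; rewrite -addnn; lia.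
apply: (@le_trans _ _ (\sum_(j | (2 ^ Q <= dist i j)%N) CK * ga (dist i j))).
  by apply: ler_sum => j _; exact: field_davydov.
by rewrite -mulr_sumr ler_wpM2l//; apply: le_trans davydov_const_ge; rewrite addr_ge0// (le_trans _ K1).
Qed.

Let V w := normalized_sum xi F w.
Let VY w := normalized_sum clipped F w.

Lemma clipping_error : Ex P (fun w => (V w - VY w) ^+ 2) <=
  (2 ^ (Q.+1 * d))%:R * (N `^ (2 - p) * K) + CK * tau.
Proof.
rewrite (_ : (fun w => _) = fun w => c ^+ 2 * (\sum_(i in F) (rem i w - Ex P (rem i))) ^+ 2); last first.
  apply/funext => w; rewrite -exprMn /V /VY /normalized_sum -mulrBr -sumrB; congr ((_ * _) ^+ 2).
  apply: eq_bigr => i _; rewrite /clipped /rem Ex_sub; [|exact: L2_L1|exact: L2_L1 (clip_L2 i)].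
  by rewrite xi0; ring.
have Lr i : L2 P (fun w => rem i w - Ex P (rem i)) by apply: L2_sub => //; exact: L2_cst.
rewrite Ex_scale; last by apply: L2_sqr; exact: L2_sum.
rewrite Ex_sqr_sum; last by move=> i _; exact: Lr.
apply: le_trans (sum_cov_le F0 (fun i j => normr_ge0 (cov P (rem i) (rem j))) remainder_cov).
rewrite ler_wpM2l ?sqr_ge0//; apply: ler_sum => i _; apply: ler_sum => j _.
by rewrite Ex_centered// ler_norm.
Qed.

Lemma variance_le : Ex P (fun w => V w ^+ 2) <= CK * Ga.
Proof.
rewrite /V /normalized_sum; under eq_fun do rewrite exprMn.
rewrite Ex_scale; last by apply: L2_sqr; exact: L2_sum.
rewrite Ex_sqr_sum//.
have H i : \sum_j `|cov P (xi i) (xi j)| <= CK * Ga.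
  apply: (@le_trans _ _ (\sum_j CK * ga (dist i j))).
    by apply: ler_sum => j _; exact: field_davydov.
  by rewrite -mulr_sumr ler_wpM2l//; apply: le_trans davydov_const_ge; rewrite addr_ge0// (le_trans _ K1).
apply: le_trans (sum_cov_le F0 (fun i j => normr_ge0 (cov P (xi i) (xi j))) H).
rewrite ler_wpM2l ?sqr_ge0//; apply: ler_sum => i _; apply: ler_sum => j _.
by apply: le_trans (ler_norm _) _; rewrite /cov !xi0 mulr0 subr0.
Qed.

Lemma V_L2 : L2 P V.
Proof. by apply: L2_scale; exact: L2_sum. Qed.

(** Young's inequality with weight [s]: the truncation error [s^2] is divided by [s] only, and the
    other term costs [s] times the variance. *)
Lemma clipped_variance (s : R) : 0 < s ->
  (2 ^ (Q.+1 * d))%:R * (N `^ (2 - p) * K) + CK * tau <= s ^+ 2 ->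
  `|Ex P (fun w => V w ^+ 2) - Ex P (fun w => VY w ^+ 2)| <= s * (1 + CK * Ga) + s ^+ 2.
Proof.
move=> s0 hs; have LV := V_L2.
have LVY : L2 P VY.
  by apply: L2_scale; apply: L2_sum => i _; apply: L2_sub; [exact: clip_L2|exact: L2_cst].
have LD : L2 P (fun w => V w - VY w) by exact: L2_sub.
have ED := le_trans clipping_error hs.
rewrite -Ex_sub; [|exact: L2_sqr..].
apply: (@le_trans _ _ (Ex P (fun w => (s^-1 * (V w - VY w) ^+ 2 + s * V w ^+ 2) + (V w - VY w) ^+ 2))).
  apply: Ex_absle.
  - by apply: L1_sub; exact: L2_sqr.
  - by apply: L1_add; [apply: L1_add; apply: L1_scale|]; exact: L2_sqr.
  move=> w; exact: sqr_diff_le.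
have [A B] := (L2_sqr LD, L2_sqr LV); have A' := L1_scale s^-1 A; have B' := L1_scale s B.
rewrite Ex_add//; last exact: L1_add.
apply: lerD => //; rewrite Ex_add// !Ex_scale// mulrDr mulr1; apply: lerD.
  by rewrite ler_pdivrMl// -expr2.
by rewrite ler_pM2l//; exact: variance_le.
Qed.

Lemma clipped_cos (s t : R) : 0 < s ->
  (2 ^ (Q.+1 * d))%:R * (N `^ (2 - p) * K) + CK * tau <= s ^+ 2 ->
  `|Ex P (fun w => cos (V w + t)) - Ex P (fun w => cos (VY w + t))| <= s.
Proof.
move=> s0 hs; have LV := V_L2.
have LVY : L2 P VY.
  by apply: L2_scale; apply: L2_sum => i _; apply: L2_sub; [exact: clip_L2|exact: L2_cst].
have LD : L2 P (fun w => V w - VY w) by exact: L2_sub.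
have cosL1 f : L2 P f -> L1 P (fun w => cos (f w + t)).
  move=> Lf; have := L1_cos P 1 t (L2_meas Lf).
  by under eq_fun do rewrite mul1r.
have ED := le_trans clipping_error hs.
rewrite -Ex_sub; [|exact: cosL1..].
apply: (@le_trans _ _ (Ex P (fun w => `|V w - VY w|))).
  apply: Ex_absle; [by apply: L1_sub; exact: cosL1|exact: L1_abs (L2_L1 LD)|].
  move=> w; apply: le_trans (cos_lipschitz _ _) _.
  by rewrite opprD addrACA subrr addr0.
apply: le_trans (Ex_abs_sqrt LD) _.
rewrite -[leRHS]gtr0_norm// -sqrtr_sqr ler_sqrt// sqr_ge0//.
Qed.

End Clipped.
End Field.
End MomentField.

(** * Choice of the local scale *)

Section ScaleChoice.
Context {R : realType}.
Variables (d : nat) (al : nat -> R) (ka : R).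
Hypothesis d0 : (0 < d)%N.
Hypothesis al0 : forall r, 0 <= al r.
Hypothesis al1 : forall r, al r <= 1.
Hypothesis ka01 : 0 < ka <= 1.
Let mass := dyadic_mass d al ka.
Hypothesis mass_tail : forall e : R, 0 < e ->
  exists Q, forall M, \sum_(Q <= q < M) mass q <= e.

Lemma mass_tail_from (e : R) : 0 < e ->
  exists Q, forall Q', (Q <= Q')%N -> forall M, \sum_(Q' <= q < M) mass q <= e.
Proof.
move=> e0; have [Q HQ] := mass_tail e0; exists Q => Q' QQ' M.
have [Q'M|MQ'] := leqP Q' M; last by rewrite big_geq ?ltW// ltnW.
apply: le_trans (HQ M); rewrite [leRHS](@big_cat_nat _ _ _ Q')//=.
by rewrite lerDr sumr_ge0// => q _; exact: dyadic_mass_ge0.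
Qed.

(* The local scale [2 ^ q] is the largest one with [2 ^ (q d) <= theta sqrt n]. *)
Lemma scale_choice (A1 A2 e e3 : R) : 0 <= A1 -> 0 <= A2 -> 0 < e -> 0 < e3 ->
  exists n0, forall n, (n0 <= n)%N -> exists q, [/\ (2 <= q)%N,
    Num.sqrt n%:R * (A1 * al (2 ^ q %/ 4)) + (Num.sqrt n%:R)^-1 * (A2 * (2 ^ (q * d))%:R) <= e
    & forall M, \sum_(q - 2 <= r < M) mass r <= e3].
Proof.
move=> A10 A20 e0 e30.
(* So small that [A2 th <= e / 2], which settles the second term of the sum. *)
pose th := e / (2 * (A2 + 1)).
have A2p : 0 < A2 + 1 by rewrite ltr_wpDl.
have th0 : 0 < th by rewrite divr_gt0// mulr_gt0.
pose C := A1 * (8 ^ d)%:R / th + 1.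
have C0 : 0 < C by apply: ltr_wpDl => //; apply: divr_ge0; [exact: mulr_ge0|exact: ltW].
pose e4 := Num.min e3 (e / (2 * C)).
have e40 : 0 < e4 by rewrite lt_min e30 divr_gt0// mulr_gt0.
have [Q HQ] := mass_tail_from e40.
pose B0 := ((2 ^ ((Q + 2) * d))%:R / th : R).
have B00 : 0 < B0 by rewrite divr_gt0// ltr0n expn_gt0.
exists (Num.truncn (B0 ^+ 2)).+1 => n nn.
have wB : B0 <= Num.sqrt n%:R.
  rewrite -[leLHS]gtr0_norm// -sqrtr_sqr ler_sqrt ?ler0n//.
  by apply: (le_trans (ltW (truncnS_gt _))); rewrite ler_nat.
set w := Num.sqrt n%:R in wB *.
have w0 : 0 < w by exact: lt_le_trans wB.
have thw : (2 ^ ((Q + 2) * d))%:R <= th * w by rewrite mulrC -ler_pdivrMr.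
have thw0 : 0 <= th * w by rewrite mulr_ge0// ltW.
pose k := Num.truncn (th * w).
have [kl kg] : k%:R <= th * w /\ th * w < k.+1%:R.
  by have := truncn_itv thw0 => /andP[]; rewrite -/k.
have Qk : (2 ^ ((Q + 2) * d) <= k)%N by rewrite -ltnS -(ltr_nat R) (le_lt_trans thw).
have k0 : (0 < k)%N by rewrite (leq_trans _ Qk)// expn_gt0.
have d1 : (1 < 2 ^ d)%N by rewrite -[1%N](expn0 2) ltn_exp2l.
pose q := trunc_log (2 ^ d) k.
have /andP[ql qg] := trunc_log_bounds d1 k0; rewrite -/q -!expnM in ql qg.
have Qq : (Q + 2 <= q)%N.
  have := leq_ltn_trans Qk qg; rewrite [(d * _)%N]mulnC ltn_exp2l// ltn_pmul2r// ltnS.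
have q2 : (2 <= q)%N by rewrite (leq_trans _ Qq)// leq_addl.
have Qq2 : (Q <= q - 2)%N by rewrite -(leq_add2r 2) subnK.
exists q; split=> // ; last first.
  by move=> M; apply: le_trans (HQ _ Qq2 M) _; rewrite ge_min lexx.
have Bq : (2 ^ (q * d))%:R <= th * w.
  by apply: le_trans kl; rewrite ler_nat mulnC.
(* The next scale is too large, so [sqrt n] is at most [2^((q + 1) d) / th]. Hence
   [sqrt n al(2^(q - 2))] is bounded by a multiple of the single term [mass (q - 2)], which is
   small; the three doublings in between give [8^d]. *)
have wq : w <= (2 ^ (q.+1 * d))%:R / th.
  rewrite ler_pdivlMr// mulrC; apply: (le_trans (ltW kg)); rewrite ler_nat mulnC; exact: qg.
have mq : mass (q - 2) <= e4.
  by have := HQ _ Qq2 (q - 2).+1; rewrite big_nat1.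
rewrite [leRHS](splitr e).
apply: lerD; last first.
  rewrite ler_pdivrMl//.
  apply: (@le_trans _ _ (A2 * (th * w))); first by rewrite ler_wpM2l.
  rewrite mulrA [leRHS]mulrC ler_pM2r// /th mulrA ler_pdivrMr ?mulr_gt0//.
  rewrite (_ : e / 2 * (2 * (A2 + 1)) = (A2 + 1) * e); last by field.
  by rewrite ler_pM2r// lerDl.
have -> : (2 ^ q %/ 4 = 2 ^ (q - 2))%N.
  by rewrite -[in LHS](subnK q2) expnD mulnK.
apply: (@le_trans _ _ ((2 ^ (q.+1 * d))%:R / th * (A1 * al (2 ^ (q - 2)) `^ ka))).
  apply: ler_pM => //; [exact: ltW|by rewrite mulr_ge0|].
  by rewrite ler_wpM2l// al_le_powR.
have -> : (2 ^ (q.+1 * d))%:R / th * (A1 * al (2 ^ (q - 2)) `^ ka) =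
    (A1 * (8 ^ d)%:R / th) * mass (q - 2).
  rewrite /mass /dyadic_mass.
  have -> : (2 ^ (q.+1 * d) = 8 ^ d * 2 ^ ((q - 2) * d))%N.
    rewrite -[8%N]/(2 ^ 3)%N -expnM -expnD -mulnDl; congr (_ ^ (_ * _))%N.
    by rewrite -[in LHS](subnK q2) -addnS addnC.
  by rewrite natrM; ring.
apply: (@le_trans _ _ (C * (e / (2 * C)))).
  apply: ler_pM => //.
  - by apply: divr_ge0; [exact: mulr_ge0|exact: ltW].
  - exact: dyadic_mass_ge0.
  - by rewrite lerDl.
  - by apply: le_trans mq _; rewrite ge_min lexx orbT.
by rewrite (_ : C * (e / (2 * C)) = e / 2)//; field; rewrite gt_eqF.
Qed.

Lemma powR_small (p y : R) : 2 < p -> 0 < y -> exists2 N, 1 <= N & N `^ (2 - p) <= y.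
Proof.
move=> p2 y0; have p20 : 0 < p - 2 by rewrite subr_gt0.
pose z := y^-1 `^ (p - 2)^-1.
have z0 : 0 < z by rewrite powR_gt0// invr_gt0.
exists (1 + z); first by rewrite lerDl ltW.
rewrite -opprB powRN -[y]invrK lef_pV2 ?posrE ?invr_gt0 ?powR_gt0//; last by rewrite ltr_wpDl.
have -> : y^-1 = z `^ (p - 2).
  by rewrite -powRrM mulVf ?lt0r_neq0// powRr1// invr_ge0 ltW.
apply: (ge0_ler_powR (ltW p20)); rewrite ?nnegrE ?powR_ge0//.
- by rewrite addr_ge0// ltW.
- by rewrite lerDr.
Qed.

Lemma expR_lipschitz (a b : R) : 0 <= a -> 0 <= b -> `|expR (- a) - expR (- b)| <= `|a - b|.
Proof.
wlog ab : a b / a <= b.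
  move=> H a0 b0; have [ab|ba] := leP a b; first exact: H.
  by rewrite distrC (distrC a); apply: H => //; exact: ltW.
move=> a0 b0; rewrite ger0_norm; last by rewrite subr_ge0 ler_expR lerN2.
rewrite distrC ger0_norm ?subr_ge0//.
rewrite -[X in _ - expR X](subrK (- a)) expRD -[X in X - _]mul1r -mulrBl.
apply: (@le_trans _ _ ((1 - expR (- b - - a)) * 1)).
  rewrite ler_wpM2l ?subr_ge0//; last by rewrite -[leRHS]expR0 ler_expR oppr_le0.
  by rewrite -[leRHS]expR0 ler_expR opprK; lra.
by rewrite mulr1; have := expR_ge1Dx (- b - - a); lra.
Qed.

End ScaleChoice.

Lemma double_succ_le4 m : (4 <= m)%N -> (m.*2.+1 <= 4 * m)%N.
Proof. lia. Qed.

(** The term [s] pays for the change of the cosine under truncation, the other for the change of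
    [exp(- v / 2)], whose argument moves by half the change of the variance. *)
Lemma error_budget {R : realType} (e C : R) : 0 < e -> 0 <= C ->
  exists2 s, 0 < s & s + (s * (1 + C) + s ^+ 2) / 2 <= e / 2.
Proof.
move=> e0 C0; have C2 : 0 < 2 + C by rewrite ltr_wpDr.
pose s := Num.min 1 (e / (2 * (2 + C))).
have s0 : 0 < s by rewrite lt_min ltr01 divr_gt0// mulr_gt0.
have s1 : s <= 1 by rewrite ge_min lexx.
have se : s * (2 + C) <= e / 2.
  by rewrite -ler_pdivlMr// -mulrA -invfM ge_min lexx orbT.
exists s => //; apply: le_trans se.
have : s ^+ 2 <= s by rewrite expr2 ler_piMl// ltW.
by nra.
Qed.

(** * Central limit theorem, uniform over fields *)

Section FieldCLT.
Context {disp : measure_display} {T : measurableType disp} {R : realType}.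
Variables (P : probability T R) (d : nat) (al : nat -> R) (p K : R).
Hypothesis d0 : (0 < d)%N.
Hypothesis al0 : forall r, 0 <= al r.
Hypothesis al1 : forall r, al r <= 1.
Hypothesis al_noninc : forall r s, (r <= s)%N -> al s <= al r.
Hypothesis p2 : 2 < p.
Hypothesis K1 : 1 <= K.
Let ka : R := 1 - 2 / p.
Hypothesis mass_tail : forall e : R, 0 < e ->
  exists Q, forall M, \sum_(Q <= q < M) dyadic_mass d al ka q <= e.

Lemma field_tails (e : R) : 0 < e -> exists2 Q, (2 <= Q)%N &
  forall Q' : nat, (Q <= Q')%N ->
  forall (I : finType) (dist : I -> I -> nat) (near far : I -> nat -> set_system T),
  mixing_index P d al dist near far ->
  forall i, \sum_(j | (2 ^ Q' <= dist i j)%N) rate al ka (dist i j) <= e.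
Proof.
move=> e0; have e'0 : 0 < e / (16 ^ d)%:R by rewrite divr_gt0// ltr0n expn_gt0.
have [Q HQ] := mass_tail_from mass_tail e'0.
exists (Q + 2)%N; first exact: leq_addl.
move=> Q' QQ' I dist near far MI i.
have Q2 : (2 <= Q')%N by rewrite (leq_trans _ QQ')// leq_addl.
have QQ2 : (Q <= Q' - 2)%N by rewrite -(leq_add2r 2) subnK.
have := rate_tail al0 al_noninc (kappa01 p2) (mi_ball MI) Q2 (HQ _ QQ2) i.
by rewrite [_ * (e / _)]mulrC divfK// pnatr_eq0 expn_eq0.
Qed.

Lemma field_total : exists2 Ga : R, 0 <= Ga &
  forall (I : finType) (dist : I -> I -> nat) (near far : I -> nat -> set_system T),
  mixing_index P d al dist near far ->
  forall i, \sum_j rate al ka (dist i j) <= Ga.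
Proof.
have [Q HQ] := mass_tail_from mass_tail ltr01.
exists ((2 ^ ((Q + 2).+1 * d))%:R + (16 ^ d)%:R * 1); first by rewrite addr_ge0.
move=> I dist near far MI i.
apply: (rate_total al0 al1 al_noninc (kappa01 p2) (mi_ball MI) (leq_addl _ _)).
by rewrite addnK; exact: HQ.
Qed.

(** The constants are fixed in the order [s], [Q], [N], and the radius [m = 2^q] comes last, from
    the number of sites. The first three depend neither on the index set nor on the field nor on the
    phase, so [n0] is common to all windows. The normal factor carries the actual variance of the
    sum, which may be 0 or vary with the field. *)
Theorem field_clt (e : R) : 0 < e -> exists n0,
  forall (I : finType) (dist : I -> I -> nat) (near far : I -> nat -> set_system T),
  mixing_index P d al dist near far ->
  forall (xi : I -> T -> R) (F : {set I}), adapted dist near far xi ->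
  (forall i, moment_le P p K (xi i)) -> (forall i, Ex P (xi i) = 0) ->
  (n0 <= #|F|)%N -> forall t,
  `|Ex P (fun w => cos (normalized_sum xi F w + t)) -
    expR (- (Ex P (fun w => normalized_sum xi F w ^+ 2) / 2)) * cos t| <= e.
Proof.
move=> e0; have [Ga Ga0 HGa] := field_total.
set CK := 4 + 6 * K ^+ 2.
have CK0 : 0 < CK by apply: lt_le_trans (davydov_const_ge K1); rewrite ltr_wpDr// (le_trans _ K1).
have K0 : 0 < K by exact: lt_le_trans K1.
have [s s0 hs] := error_budget e0 (mulr_ge0 (ltW CK0) Ga0).
have s20 : 0 < s ^+ 2 / 2 by rewrite divr_gt0// exprn_gt0.
have tau0 : 0 < s ^+ 2 / 2 / CK by rewrite divr_gt0.
have [Q Q2 HQ] := field_tails tau0.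
have B0 : 0 < (2 ^ (Q.+1 * d))%:R * K by rewrite mulr_gt0// ltr0n expn_gt0.
have [N N1 HN] := powR_small p2 (divr_gt0 s20 B0).
have N0 : 0 < N by exact: lt_le_trans N1.
have clip_small : (2 ^ (Q.+1 * d))%:R * (N `^ (2 - p) * K) + CK * (s ^+ 2 / 2 / CK) <= s ^+ 2.
  rewrite [leRHS](splitr (s ^+ 2)); apply: lerD.
    by rewrite mulrCA -ler_pdivlMr.
  by rewrite mulrC divfK// gt_eqF.
have N21 : 1 <= 2 * N by rewrite (le_trans N1)// mulr_natl mulr2n lerDl (ltW N0).
(* The two terms of the Stein bound proportional to [c b], at the level [2 N] of the recentred
   field; [4^d] absorbs [(2 m + 1)^d <= (4 m)^d]. *)
pose A2 := (4 ^ d)%:R * (2 * (2 * N) ^+ 2 * (Ga * (1 + (4 ^ d)%:R)) + 2 * N * (4 * (2 * N) ^+ 2 * Ga)).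
have A20 : 0 <= A2.
  have P4 : 0 <= (4 ^ d)%:R :> R by [].
  have P2 : 0 <= (2 * N) ^+ 2 by exact: sqr_ge0.
  have PN : 0 <= 2 * N by exact: le_trans N21.
  have N0' := ltW N0; rewrite /A2.
  by do ?[apply: mulr_ge0|apply: addr_ge0] => //.
have A10 : 0 <= 4 * (2 * N) by rewrite mulr_ge0// (le_trans _ N21).
have e40 : 0 < e / 4 by rewrite divr_gt0.
have e30 : 0 < e / 4 / (4 * (2 * N) ^+ 2) by rewrite divr_gt0// mulr_gt0// exprn_gt0// mulr_gt0.
have [Q3 Q32 HQ3] := field_tails e30.
have e3'0 : 0 < Num.min (1:R) (e / 4 / (4 * (2 * N) ^+ 2) / (16 ^ d)%:R).
  by rewrite lt_min ltr01 divr_gt0// ltr0n expn_gt0.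
have [n0 Hn0] := scale_choice d0 al0 al1 (kappa01 p2) mass_tail A10 A20 e40 e3'0.
exists (maxn 1 n0) => I dist near far MI xi F ad mom xi0.
rewrite geq_max => /andP[F1 Fn0] t.
have F0 : F != finset.set0 by rewrite -card_gt0.
have [q [q2 Hq Hm]] := Hn0 _ Fn0.
set m := (2 ^ q)%N.
have m4 : (4 <= m)%N by rewrite -[4%N]/(2 ^ 2)%N leq_exp2l.
have ck_tail := HQ Q (leqnn Q) I dist near far MI.
have ga_tot := HGa I dist near far MI.
pose Y := clipped P xi N.
have tau_m i : \sum_(j | (m < dist i j)%N) rate al ka (dist i j) <= e / 4 / (4 * (2 * N) ^+ 2).
  apply: (@le_trans _ _ (\sum_(j | (2 ^ q <= dist i j)%N) rate al ka (dist i j))).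
    rewrite big_mkcond [leRHS]big_mkcond; apply: ler_sum => j _.
    case: ifP => [mj|_]; first by rewrite ltnW.
    by case: ifP => // _; exact: rate_ge0.
  have := rate_tail al0 al_noninc (kappa01 p2) (mi_ball MI) q2 Hm i.
  move=> /le_trans; apply; rewrite mulrC -ler_pdivlMr ?ltr0n ?expn_gt0//.
  by rewrite ge_min lexx orbT.
pose V := normalized_sum xi F; pose VY := normalized_sum Y F.
have Yad := clipped_adapted P N ad.
have YN := clipped_abs MI ad N1.
have Y0 := clipped_mean MI ad N1.
have LVY : L2 P VY by exact: (normalized_sum_L2 MI Yad YN).
have bounded : `|Ex P (fun w => cos (VY w + t)) - expR (- (Ex P (fun w => VY w ^+ 2) / 2)) * cos t| <= e / 2.
  apply: Ex_cos_gaussian => //; first exact: Ex_sqr_ge0.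
  move=> l l01.
  have := stein_bounded MI al0 al_noninc (@rate_near _ al ka) (rate_far al0 al1 (kappa01 p2)) ga_tot Yad N21 YN Y0 m4 F0 tau_m t l01.
  move=> /le_trans; apply.
  rewrite (_ : e / 2 = e / 4 + e / 4); last by field.
  rewrite addrA; apply: lerD; last by rewrite mulrC divfK// gt_eqF// mulr_gt0// exprn_gt0// mulr_gt0.
  apply: le_trans Hq.
  have wn : (Num.sqrt #|F|%:R)^-1 * #|F|%:R = Num.sqrt #|F|%:R :> R.
    have n0' : 0 < #|F|%:R :> R by rewrite ltr0n.
    by rewrite -[X in _ * X = _](@sqr_sqrtr _ #|F|%:R) ?(ltW n0')// expr2 mulKf// gt_eqF// sqrtr_gt0.
  rewrite wn lerD2l -mulrDr ler_wpM2l ?invr_ge0 ?sqrtr_ge0//.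
  rewrite (_ : _ + _ = (2 * (2 * N) ^+ 2 * (Ga * (1 + (4 ^ d)%:R)) + 2 * N * (4 * (2 * N) ^+ 2 * Ga)) * (m.*2.+1 ^ d)%:R); last by ring.
  rewrite /A2 -[leRHS]mulrA [leRHS]mulrCA; apply: ler_wpM2l.
    have P2 : 0 <= (2 * N) ^+ 2 by exact: sqr_ge0.
    have PN : 0 <= 2 * N by exact: le_trans N21.
    have N0' := ltW N0.
    by do ?[apply: mulr_ge0|apply: addr_ge0] => //.
  rewrite -natrM ler_nat expnM -expnMn leq_exp2r//.
  exact: (double_succ_le4 m4).
have cos_close := clipped_cos al0 al1 al_noninc p2 K1 MI ad mom xi0 F0 N1 ck_tail t s0 clip_small.
have var_close := clipped_variance al0 al1 al_noninc p2 K1 MI ad mom xi0 F0 N1 ck_tail ga_tot s0 clip_small.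
set v := Ex P (fun w => V w ^+ 2) in var_close *.
set vY := Ex P (fun w => VY w ^+ 2) in bounded var_close.
have e_close : `|expR (- (vY / 2)) * cos t - expR (- (v / 2)) * cos t| <= (s * (1 + CK * Ga) + s ^+ 2) / 2.
  rewrite -mulrBl normrM -[leRHS]mulr1 ler_pM//; last exact: cos_abs_le1.
  apply: le_trans (expR_lipschitz _ _) _.
  - by rewrite divr_ge0// Ex_sqr_ge0.
  - by rewrite divr_ge0// Ex_sqr_ge0.
  - by rewrite -mulrBl normrM (@ger0_norm _ 2^-1)// ler_pM2r// distrC.
rewrite (_ : _ - _ = (Ex P (fun w => cos (V w + t)) - Ex P (fun w => cos (VY w + t))) +
  (expR (- (vY / 2)) * cos t - expR (- (v / 2)) * cos t) +
  (Ex P (fun w => cos (VY w + t)) - expR (- (vY / 2)) * cos t)); last by rewrite /V; ring.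
rewrite [leRHS](splitr e); apply: le_trans (ler_normD _ _) _; apply: lerD => //.
apply: le_trans hs; apply: le_trans (ler_normD _ _) _; apply: lerD => //.
Qed.

End FieldCLT.

(** * Characteristic functions and Gaussian vectors *)

Section RowMeasurability.
Context {R : realType} {l : nat}.

(** The rational cubes contained in [U] are countably many; this reduces the Borel measurability of
    a row to that of its coordinates. *)
Lemma open_rational_cover (U : set 'rV[R]_l) : open U ->
  U = \bigcup_(p in [set p : 'rV[rat]_l * nat |
         (forall z : 'rV[R]_l, (forall i, `|ratr (p.1 0 i) - z 0 i| < p.2.+1%:R^-1) -> U z)])
      [set z : 'rV[R]_l | forall i, `|ratr (p.1 0 i) - z 0 i| < p.2.+1%:R^-1].
Proof.
move=> oU; apply/seteqP; split=> [y Uy|y [p /= pU]]; last exact: pU.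
have /nbhs_ballP[r /= r0 rU] := open_nbhs_nbhs (conj oU Uy).
pose n := Num.truncn (2 / r).
have nr : 2 * n.+1%:R^-1 < r.
  rewrite ltr_pdivrMr ?ltr0n// mulrC -ltr_pdivrMr//.
  exact: truncnS_gt.
have /choice[c Hc] : forall i, exists q : rat, `|ratr q - y 0 i| < n.+1%:R^-1.
  move=> i.
  have [q] := @rat_in_itvoo R (y 0 i - n.+1%:R^-1) (y 0 i + n.+1%:R^-1)
    ltac:(rewrite ltrD2l gtrN// invr_gt0 ltr0n//).
  rewrite in_itv/= => /andP[q1 q2]; exists q.
  by rewrite ltr_distl q1 q2.
exists (\row_i c i, n) => /=; last by move=> i; rewrite mxE; exact: Hc.
move=> z Hz; apply: rU; split=> // i j; rewrite (ord1 i) /ball/=.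
have := Hz j; rewrite mxE => Hz'.
rewrite -(subrK (ratr (c j)) (y 0 j)) -addrA; apply: le_lt_trans (ler_normD _ _) _.
apply: lt_trans nr; rewrite mulr_natl mulr2n; apply: ltrD => //.
by rewrite distrC; exact: Hc.
Qed.

Lemma coord_measurable i : measurable_fun setT (fun y : borel 'rV[R]_l => (y : 'rV[R]_l) 0 i).
Proof.
apply: (measurability _ (RGenOInfty.measurableE R)) => //.
move=> _ [_ [a ->] <-]; rewrite setTI.
apply: sub_sigma_algebra; apply: open_comp; last exact: interval_open.
by move=> x _; exact: coord_continuous.
Qed.

Lemma row_measurable {disp : measure_display} {T : measurableType disp} (V : T -> 'rV[R]_l) :
  (forall i, measurable_fun setT (fun w => V w 0 i)) ->
  measurable_fun setT (V : T -> borel 'rV[R]_l).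
Proof.
move=> mV; apply: (@measurability _ _ T (borel 'rV[R]_l) setT V (@open 'rV[R]_l)) => //.
move=> _ [U oU <-]; rewrite setTI [U in _ @^-1` U](open_rational_cover oU) preimage_bigcup.
rewrite bigcup_mkcond; apply: countable_bigcupT_measurable; first exact: countableP.
move=> p; case: ifPn => // _.
rewrite (_ : _ @^-1` _ = \bigcap_(i in [set: 'I_l]) [set w | `|ratr (p.1 0 i) - V w 0 i| < p.2.+1%:R^-1]); last first.
  by apply/seteqP; split=> w /= h i => [_|]; [exact: h|exact: h].
apply: fin_bigcap_measurable; first exact: finite_finset.
move=> i _; have mf : measurable_fun setT (fun w => `|ratr (p.1 0 i) - V w 0 i|).
  by apply: measurableT_comp => //; exact: measurable_funB.
have := mf measurableT `]-oo, (p.2.+1%:R^-1)[%classic (measurable_itv _).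
rewrite setTI (_ : _ @^-1` _ = [set w | `|ratr (p.1 0 i) - V w 0 i| < p.2.+1%:R^-1])//.
Qed.

Lemma continuous_borel_measurable (f : 'rV[R]_l -> R) : continuous f ->
  measurable_fun setT (f : borel 'rV[R]_l -> R).
Proof.
move=> cf; apply: (measurability _ (RGenOInfty.measurableE R)) => //.
move=> _ [_ [a ->] <-]; rewrite setTI.
apply: sub_sigma_algebra; apply: open_comp; last exact: interval_open.
by move=> x _; exact: cf.
Qed.

(** Only [x] is confined to [K]: the nodes of a Bernstein polynomial will play the part of [y],
    without their position being discussed. *)
Lemma uniform_continuity_compact (g : 'rV[R]_l -> R) (K : set 'rV[R]_l) (e : R) :
  continuous g -> compact K -> 0 < e ->
  exists2 del : R, 0 < del & forall x y : 'rV[R]_l, K x -> (forall i, `|x 0 i - y 0 i| < del) -> `|g x - g y| <= e.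
Proof.
move=> cg cK e0.
have := (@compact_near_coveringP _ K).1 cK R (0^'+)
  (fun (del : R) x => forall y : 'rV[R]_l, (forall i, `|x 0 i - y 0 i| < del) -> `|g x - g y| <= e).
case=> [x Kx|del /= del0 H].
  have e20 : 0 < e / 2 by rewrite divr_gt0.
  have /cvgrPdist_lt/(_ _ e20) := cg x; rewrite near_nbhs => /nbhs_ballP[r /= r0 rg].
  have r20 : 0 < r / 2 by rewrite divr_gt0.
  exists (ball x (r / 2), [set d | 0 < d < r / 2]) => /=.
    split; first exact: nbhsx_ballx.
    near=> d; apply/andP; split; first by near: d; exact: nbhs_right_gt.
    by near: d; exact: nbhs_right_lt.
  move=> [x' d] /= [[_ xx'] /andP[d0 dr]] y xy.
  have b1 : ball x r x'.
    by apply: (@le_ball _ _ _ (r / 2)); [lra|split].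
  have b2 : ball x r y.
    split=> // i j; rewrite (ord1 i); rewrite /ball/= -(subrK (x' 0 j) (x 0 j)) -addrA.
    apply: le_lt_trans (ler_normD _ _) _; rewrite (splitr r); apply: ltrD.
      exact: xx'.
    exact: lt_trans (xy j) dr.
  have := rg _ b1; have := rg _ b2; rewrite /= => h1 h2.
  rewrite -(subrK (g x) (g x')) -addrA; apply: le_trans (ler_normD _ _) _.
  by rewrite (splitr e) distrC; apply: lerD; exact: ltW.
exists (del / 2); first by rewrite divr_gt0.
move=> x y Kx xy.
apply: (H (del / 2) _ _ x Kx) => //; rewrite ?divr_gt0//= sub0r normrN gtr0_norm ?divr_gt0//.
by rewrite ltr_pdivrMr// ltr_pMr// ltr1n.
Unshelve. all: by end_near. Qed.

End RowMeasurability.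

(** * Bernstein approximation on the unit cube *)

Section BernoulliWeights.
Context {R : realType} {X : finType}.
Variable v : X -> R.
Hypothesis v01 : forall x, 0 <= v x <= 1.

(** The law of independent coin tosses with success probabilities [v x]. *)
Definition bern_weight (om : {ffun X -> bool}) : R :=
  \prod_x (if om x then v x else 1 - v x).

Lemma bern_weight_ge0 om : 0 <= bern_weight om.
Proof.
apply: prodr_ge0 => x _; have /andP[v0 v1] := v01 x.
by case: (om x); rewrite ?subr_ge0.
Qed.

(** Independence of the tosses, in the form of distributivity of a product over sums. *)
Lemma bern_prod (phi : X -> bool -> R) :
  \sum_om bern_weight om * (\prod_x phi x (om x)) =
  \prod_x (v x * phi x true + (1 - v x) * phi x false).
Proof.
rewrite (eq_bigr (fun x => \sum_(b : bool) (if b then v x else 1 - v x) * phi x b)); last first.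
  by move=> x _; rewrite big_bool.
rewrite bigA_distr_bigA; apply: eq_bigr => om _.
by rewrite /bern_weight -big_split.
Qed.

Lemma bern_total : \sum_om bern_weight om = 1.
Proof.
have H := bern_prod (fun _ _ => 1).
rewrite [RHS]big1 in H; last by move=> x _; rewrite !mulr1 addrC subrK.
by rewrite -H; apply: eq_bigr => om _; rewrite big1 ?mulr1.
Qed.

Lemma bern_cov a b :
  \sum_om bern_weight om * (((om a)%:R - v a) * ((om b)%:R - v b)) =
  if a == b then v a * (1 - v a) else 0.
Proof.
have [<-|ab] := eqVneq a b.
  have H := bern_prod (fun x c => if x == a then (c%:R - v x) ^+ 2 else 1).
  rewrite [RHS](bigD1 a)//= eqxx [X in _ = _ * X]big1 in H; last first.
    by move=> x /negPf xa; rewrite xa !mulr1 addrC subrK.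
  rewrite (_ : v a * (1 - v a) = (v a * (1%:R - v a) ^+ 2 + (1 - v a) * (0%:R - v a) ^+ 2) * 1); last by ring.
  rewrite -H; apply: eq_bigr => om _; congr (_ * _).
  by rewrite (bigD1 a)//= eqxx big1 ?mulr1 ?expr2// => x /negPf ->.
have H := bern_prod (fun x c => if (x == a) || (x == b) then c%:R - v x else 1).
rewrite [RHS](bigD1 a)//= eqxx/= in H.
rewrite (_ : v a * _ + _ = 0) ?mul0r in H; last by ring.
apply: etrans H; apply: eq_bigr => om _; congr (_ * _).
rewrite [RHS](bigD1 a)//= eqxx/=; congr (_ * _).
rewrite (bigD1 b)/= ?(eq_sym b a) ?ab// eqxx orbT big1 ?mulr1//.
by move=> x /andP[/negPf -> /negPf ->].
Qed.

End BernoulliWeights.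

Section BernsteinApproximation.
Context {R : realType} {l n : nat}.
Hypothesis n0 : (0 < n)%N.
Implicit Types u : 'rV[R]_l.

Let X : finType := ('I_l * 'I_n)%type.

Definition bern_mean (om : {ffun X -> bool}) : 'rV[R]_l :=
  \row_i (n%:R^-1 * \sum_(a < n) (om (i, a))%:R).

(** The expectation of [G] at the empirical means of [n] tosses per coordinate: the multivariate
    Bernstein polynomial, with single tosses in place of binomial coefficients. *)
Definition bern_approx (G : 'rV[R]_l -> R) u : R :=
  \sum_om bern_weight (fun x : X => u 0 x.1) om * G (bern_mean om).

Lemma bern_variance u i : (forall i, 0 <= u 0 i <= 1) ->
  \sum_om bern_weight (fun x : X => u 0 x.1) om * (bern_mean om 0 i - u 0 i) ^+ 2 <= n%:R^-1.
Proof.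
move=> u01; have n0R : 0 < n%:R :> R by rewrite ltr0n.
pose w := bern_weight (fun x : X => u 0 x.1).
have E om : (bern_mean om 0 i - u 0 i) ^+ 2 = n%:R^-1 ^+ 2 *
   \sum_(a < n) \sum_(b < n) ((om (i, a))%:R - u 0 i) * ((om (i, b))%:R - u 0 i).
  have -> : bern_mean om 0 i - u 0 i = n%:R^-1 * \sum_(a < n) ((om (i, a))%:R - u 0 i).
    rewrite mxE sumrB mulrBr; congr (_ - _).
    by rewrite sumr_const card_ord -[u 0 i *+ n]mulr_natl mulKf// gt_eqF.
  rewrite exprMn; congr (_ * _); rewrite expr2 mulr_suml; apply: eq_bigr => a _.
  by rewrite mulr_sumr.
have -> : \sum_om w om * (bern_mean om 0 i - u 0 i) ^+ 2 =
    n%:R^-1 ^+ 2 * \sum_(a < n) \sum_(b < n)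
      \sum_om w om * (((om (i, a))%:R - u 0 i) * ((om (i, b))%:R - u 0 i)).
  under [in RHS]eq_bigr do rewrite exchange_big/=.
  rewrite exchange_big/= mulr_sumr; apply: eq_bigr => om _.
  rewrite E mulrCA; congr (_ * _); rewrite mulr_sumr; apply: eq_bigr => a _.
  by rewrite mulr_sumr.
have C a b : \sum_om w om * (((om (i, a))%:R - u 0 i) * ((om (i, b))%:R - u 0 i)) =
   if a == b then u 0 i * (1 - u 0 i) else 0.
  have := @bern_cov R X (fun x => u 0 x.1) (i, a) (i, b).
  by rewrite xpair_eqE eqxx.
rewrite (eq_bigr (fun=> u 0 i * (1 - u 0 i))); last first.
  move=> a _; rewrite (bigD1 a)//= C eqxx big1 ?addr0// => b /negPf ba.
  by rewrite C eq_sym ba.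
have /andP[u0 u1] := u01 i.
rewrite sumr_const card_ord -[(_ * _) *+ n]mulr_natl expr2 -mulrA mulKf ?gt_eqF//.
rewrite ler_piMr ?invr_ge0 ?ler0n//; nra.
Qed.

Lemma bern_approx_bound G u K : (forall i, 0 <= u 0 i <= 1) ->
  (forall y, `|G y| <= K) -> `|bern_approx G u| <= K.
Proof.
move=> u01 GK; have w0 := bern_weight_ge0 (v := fun x : X => u 0 x.1) (fun x => u01 x.1).
apply: le_trans (ler_norm_sum _ _ _) _.
rewrite -[leRHS]mul1r -(bern_total (fun x : X => u 0 x.1)) mulr_suml.
by apply: ler_sum => om _; rewrite normrM ger0_norm// ler_wpM2l.
Qed.

Lemma bern_approx_error G u K e del : (forall i, 0 <= u 0 i <= 1) ->
  (forall y, `|G y| <= K) -> 0 < del -> 0 <= e ->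
  (forall y : 'rV[R]_l, (forall i, `|u 0 i - y 0 i| < del) -> `|G u - G y| <= e) ->
  `|bern_approx G u - G u| <= e + 2 * K * l%:R / del ^+ 2 * n%:R^-1.
Proof.
move=> u01 GK del0 e0 Gu.
have K0 : 0 <= K by exact: le_trans (GK u).
pose w := bern_weight (fun x : X => u 0 x.1).
have w0 om : 0 <= w om by apply: bern_weight_ge0 => x; exact: u01.
have w1 : \sum_om w om = 1 by exact: bern_total.
have key om : `|G (bern_mean om) - G u| <= e + 2 * K / del ^+ 2 * \sum_i (bern_mean om 0 i - u 0 i) ^+ 2.
  have S0 : 0 <= 2 * K / del ^+ 2 * \sum_i (bern_mean om 0 i - u 0 i) ^+ 2.
    apply: mulr_ge0; first by apply: divr_ge0; [exact: mulr_ge0|exact: sqr_ge0].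
    by apply: sumr_ge0 => i _; exact: sqr_ge0.
  have [small|/existsNP[i big]] := pselect (forall i, `|u 0 i - bern_mean om 0 i| < del).
    by rewrite distrC; apply: le_trans (Gu _ small) _; rewrite lerDl.
  have {}big : del <= `|bern_mean om 0 i - u 0 i| by rewrite distrC leNgt; apply/negP.
  apply: (@le_trans _ _ (2 * K / del ^+ 2 * \sum_i (bern_mean om 0 i - u 0 i) ^+ 2)); last by rewrite lerDr.
  apply: (@le_trans _ _ (2 * K)).
    by apply: le_trans (ler_normB _ _) _; rewrite mulr_natl mulr2n; exact: lerD.
  rewrite -mulrA ler_peMr ?mulr_ge0// ler_pdivlMl ?exprn_gt0// mulr1.
  rewrite (bigD1 i)//=; apply: (@le_trans _ _ ((bern_mean om 0 i - u 0 i) ^+ 2)).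
    by rewrite -[leRHS](real_normK (num_real _)) lerXn2r ?nnegrE ?(ltW del0).
  by rewrite lerDl sumr_ge0// => j _; exact: sqr_ge0.
have -> : bern_approx G u - G u = \sum_om w om * (G (bern_mean om) - G u).
  under eq_bigr do rewrite mulrBr; rewrite sumrB; congr (_ - _).
  by rewrite -mulr_suml w1 mul1r.
apply: le_trans (ler_norm_sum _ _ _) _.
apply: (@le_trans _ _ (\sum_om w om * (e + 2 * K / del ^+ 2 * \sum_i (bern_mean om 0 i - u 0 i) ^+ 2))).
  by apply: ler_sum => om _; rewrite normrM ger0_norm// ler_wpM2l.
under eq_bigr do rewrite mulrDr mulrCA; rewrite big_split/=; apply: lerD.
  by rewrite -mulr_suml w1 mul1r.
rewrite -mulr_sumr.
rewrite (_ : 2 * K * l%:R / del ^+ 2 * n%:R^-1 = 2 * K / del ^+ 2 * (\sum_(i < l) n%:R^-1)); last first.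
  by rewrite sumr_const card_ord -[_ *+ l]mulr_natl; ring.
apply: ler_wpM2l; first by apply: divr_ge0; [exact: mulr_ge0|exact: sqr_ge0].
under eq_bigr do rewrite mulr_sumr; rewrite exchange_big/=.
by apply: ler_sum => i _; exact: bern_variance.
Qed.

End BernsteinApproximation.

(** * Approximation by trigonometric polynomials *)

Section TrigonometricPolynomials.
Context {R : realType} {l : nat}.
Implicit Types (t y : 'rV[R]_l) (f g : 'rV[R]_l -> R).

Definition dotp t y : R := \sum_i t 0 i * y 0 i.

(** The free phase [th] makes cosines include sines, so that characteristic functions can be handled
    in real form. *)
Inductive trig_poly : ('rV[R]_l -> R) -> Prop :=
| trig_cos c t th : trig_poly (fun y => c * cos (dotp t y + th))
| trig_add f g : trig_poly f -> trig_poly g -> trig_poly (fun y => f y + g y).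

Lemma dotpD t s y : dotp (t + s) y = dotp t y + dotp s y.
Proof. by rewrite -big_split; apply: eq_bigr => i _; rewrite mxE mulrDl. Qed.

Lemma dotpN t y : dotp (- t) y = - dotp t y.
Proof. by rewrite -sumrN; apply: eq_bigr => i _; rewrite mxE mulNr. Qed.

Lemma trig_cst c : trig_poly (fun=> c).
Proof.
rewrite (_ : (fun=> c) = fun y => c * cos (dotp 0 y + 0)); first exact: trig_cos.
apply/funext => y; rewrite addr0 (_ : dotp 0 y = 0) ?cos0 ?mulr1//.
by rewrite /dotp big1// => i _; rewrite mxE mul0r.
Qed.

(** A product of two cosines is half the sum of the cosines of the sum and of the difference of the
    arguments. *)
Lemma trig_mul f g : trig_poly f -> trig_poly g -> trig_poly (fun y => f y * g y).
Proof.
move=> tf tg; elim: tf => [c t th|f1 f2 _ IH1 _ IH2]; last first.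
  by under eq_fun do rewrite mulrDl; exact: trig_add.
elim: tg => [e s ph|g1 g2 _ IH1 _ IH2]; last first.
  by under eq_fun do rewrite mulrDr; exact: trig_add.
rewrite (_ : (fun y => _) = fun y => (c * e / 2) * cos (dotp (t + s) y + (th + ph)) +
    (c * e / 2) * cos (dotp (t - s) y + (th - ph))).
  by apply: trig_add; exact: trig_cos.
apply/funext => y; rewrite !dotpD dotpN.
rewrite (_ : dotp t y + dotp s y + (th + ph) = (dotp t y + th) + (dotp s y + ph)); last by ring.
rewrite (_ : dotp t y - dotp s y + (th - ph) = (dotp t y + th) - (dotp s y + ph)); last by ring.
by move: (dotp t y + th) (dotp s y + ph) => A B; rewrite cosB cosD; field.
Qed.

Lemma trig_sum (I : Type) (s : seq I) (F : I -> 'rV[R]_l -> R) :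
  (forall i, trig_poly (F i)) -> trig_poly (fun y => \sum_(i <- s) F i y).
Proof.
move=> tF; elim: s => [|i s IH].
  by under eq_fun do rewrite big_nil; exact: trig_cst.
by under eq_fun do rewrite big_cons; exact: trig_add.
Qed.

Lemma trig_prod (I : Type) (s : seq I) (F : I -> 'rV[R]_l -> R) :
  (forall i, trig_poly (F i)) -> trig_poly (fun y => \prod_(i <- s) F i y).
Proof.
move=> tF; elim: s => [|i s IH].
  by under eq_fun do rewrite big_nil; exact: trig_cst.
by under eq_fun do rewrite big_cons; exact: trig_mul.
Qed.

Lemma sin_as_cos (x : R) : sin x = cos (x + - (pi / 2)).
Proof. by rewrite cosB cos_pihalf sin_pihalf mulr0 add0r mulr1. Qed.

Lemma trig_sin_coord (T : R) i : trig_poly (fun y => sin (y 0 i / T)).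
Proof.
rewrite (_ : (fun y => _) = fun y => 1 * cos (dotp (\row_j (if j == i then T^-1 else 0)) y + - (pi / 2))).
  exact: trig_cos.
apply/funext => y; rewrite mul1r -sin_as_cos; congr sin.
rewrite /dotp (bigD1 i)//= mxE eqxx big1 ?addr0; first by rewrite mulrC.
by move=> j /negPf ji; rewrite mxE ji mul0r.
Qed.

Lemma row_map_continuous (h : R -> R) : continuous h ->
  continuous (fun u : 'rV[R]_l => \row_i h (u 0 i) : 'rV[R]_l).
Proof.
move=> hc u A /nbhs_ballP[r /= r0 rA].
have H : \forall z \near (u : 'rV[R]_l), forall i, ball (h (u 0 i)) r (h ((z : 'rV[R]_l) 0 i)).
  apply: (@filter_forall 'rV[R]_l 'I_l (fun i z => ball (h (u 0 i)) r (h (z 0 i))) (nbhs (u : 'rV[R]_l)) (nbhs_filter _)) => i.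
  have : continuous (fun z : 'rV[R]_l => h (z 0 i)).
    move=> z; apply: (@continuous_comp _ _ _ (fun z : 'rV[R]_l => z 0 i) h); last exact: hc.
    exact: coord_continuous.
  by move=> /(_ u)/cvg_ballP; apply.
by apply: filterS H => z Hz; apply: rA; split=> // i j; rewrite (ord1 i) !mxE; exact: Hz.
Qed.

(* The parameter [u] below runs through the unit cube, so that the Bernstein
   polynomial of [G], read through [y |-> u], is a bounded trigonometric
   polynomial; [G] inverts this change of variables on the box of half-width [T]. *)
Lemma trig_approx f K (T e : R) : continuous f -> (forall y, `|f y| <= K) ->
  0 < T -> 0 < e ->
  exists2 q, trig_poly q & (forall y, `|q y| <= K) /\
    (forall y, (forall i, `|y 0 i| <= T) -> `|q y - f y| <= e).
Proof.
move=> cf fK T0 e0.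
pose s1 : R := sin 2^-1.
have p1 : 1 <= pi / 2 :> R by exact: pihalf_ge1.
have h0 : 0 < 2^-1 :> R by rewrite invr_gt0.
have h1 : 2^-1 < 1 :> R by rewrite invf_lt1// ltr1n.
have s10 : 0 < s1 by rewrite sin_gt0_pihalf// h0 (lt_le_trans h1).
have itvh x : -2^-1 <= x <= 2^-1 -> x \in `[(- (pi / 2)), pi / 2 : R].
  by move=> /andP[x1 x2]; rewrite in_itv/=; apply/andP; split; lra.
have s11 : s1 < 1.
  rewrite -(sin_pihalf R) ltr_sin ?(lt_le_trans h1)//; first by apply: itvh; lra.
  by rewrite in_itv/= lexx andbT; lra.
(* Clipping at [s1 = sin(1/2) < 1] keeps the argument of [asin] away from the endpoints, so [h] is
   continuous on the whole line. On the box the argument [y 0 i / (2 T)] is at most [1/2] in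
   absolute value, and the clipping is not felt. *)
pose cl (x : R) := Num.max (- s1) (Num.min s1 x).
pose h (x : R) := 2 * T * asin (cl (2 * x - 1)).
have hc : continuous h.
  move=> x; apply: cvgM; first exact: cvg_cst.
  have lin : continuous (fun x : R => 2 * x - 1).
    by move=> z; apply: cvgB; [apply: cvgM; [exact: cvg_cst|exact: cvg_id]|exact: cvg_cst].
  have clc : continuous cl.
    move=> z; apply: (@continuous_max _ _ (cst (- s1)) (fun z => Num.min s1 z)); first exact: cvg_cst.
    by apply: (@continuous_min _ _ (cst s1) id); [exact: cvg_cst|exact: cvg_id].
  apply: (@continuous_comp _ _ _ (fun x : R => cl (2 * x - 1)) (@asin R)).
    by apply: (@continuous_comp _ _ _ (fun x : R => 2 * x - 1) cl); [exact: lin|exact: clc].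
  apply: continuous_asin; rewrite /cl lt_max gt_max ltrN2 gt_min s11/=.
  by apply/andP; split=> //; lra.
pose G (u : 'rV[R]_l) := f (\row_i h (u 0 i)).
have Gc : continuous G.
  move=> u; apply: (@continuous_comp _ _ _ (fun u : 'rV[R]_l => \row_i h (u 0 i)) f).
    exact: row_map_continuous.
  exact: cf.
have GK u : `|G u| <= K by exact: fK.
pose uu (y : 'rV[R]_l) : 'rV[R]_l := \row_i (2^-1 + 2^-1 * sin (y 0 i / (2 * T))).
have uu01 y i : 0 <= uu y 0 i <= 1.
  rewrite mxE; have := sin_geN1 (y 0 i / (2 * T)); have := sin_le1 (y 0 i / (2 * T)).
  by move=> a1 a2; apply/andP; split; lra.
have Guu y : (forall i, `|y 0 i| <= T) -> G (uu y) = f y.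
  move=> yT; congr f; apply/rowP => i; rewrite !mxE /h.
  have Hz : - 2^-1 <= y 0 i / (2 * T) <= 2^-1.
    rewrite -ler_norml normrM (@ger0_norm _ (2 * T)^-1) ?invr_ge0 ?mulr_ge0 ?(ltW T0)//.
    by rewrite ler_pdivrMr ?mulr_gt0// mulrA mulVf// mul1r.
  have -> : 2 * (2^-1 + 2^-1 * sin (y 0 i / (2 * T))) - 1 = sin (y 0 i / (2 * T)) by field.
  have [z1 z2] := andP Hz.
  have sle : sin (y 0 i / (2 * T)) <= s1 by rewrite leNgt ltr_sin ?itvh -?leNgt//; lra.
  have sge : - s1 <= sin (y 0 i / (2 * T)) by rewrite -sinN leNgt ltr_sin ?itvh -?leNgt//; lra.
  rewrite /cl (min_idPr sle) (max_idPr sge) sinK ?itvh//.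
  by field; rewrite gt_eqF.
have cube_compact : compact [set u : 'rV[R]_l | forall i, 0 <= u 0 i <= 1].
  rewrite (_ : mkset _ = [set v : 'rV[R]_l | forall i, `[0 : R, 1]%classic (v ord0 i)]).
    by apply: (@rV_compact R l (fun=> `[0 : R, 1]%classic)) => i; exact: segment_compact.
  by apply/seteqP; split=> u /= Hu i; have := Hu i; rewrite /= in_itv.
have e20 : 0 < e / 2 by rewrite divr_gt0.
have [del del0 Hdel] := uniform_continuity_compact Gc cube_compact e20.
have K0 : 0 <= K by exact: le_trans (fK 0).
pose B := 2 * K * l%:R / del ^+ 2.
have B0 : 0 <= B by rewrite /B; apply: divr_ge0; [rewrite mulr_ge0 ?mulr_ge0|exact: sqr_ge0].
pose n := (Num.truncn (B / (e / 2))).+1.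
have n0 : (0 < n)%N by [].
have nB : B * n%:R^-1 <= e / 2.
  by rewrite ler_pdivrMr ?ltr0n// mulrC -ler_pdivrMr// ltW// truncnS_gt.
exists (fun y => bern_approx (n := n) G (uu y)).
  apply: trig_sum => om; apply: trig_mul; last exact: trig_cst.
  apply: trig_prod => x.
  have tu : trig_poly (fun y => uu y 0 x.1).
    under eq_fun do rewrite mxE.
    apply: trig_add; first exact: trig_cst.
    by apply: trig_mul; [exact: trig_cst|exact: trig_sin_coord].
  case: (om x) => //.
  rewrite (_ : (fun y => _) = fun y => 1 + (-1) * uu y 0 x.1); last first.
    by apply/funext => y; rewrite mulN1r.
  by apply: trig_add; [exact: trig_cst|apply: trig_mul => //; exact: trig_cst].
split=> [y|y yT]; first exact: bern_approx_bound.
rewrite -Guu//; apply: le_trans (bern_approx_error n0 (uu01 y) GK del0 (ltW e20) _) _.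
  by move=> z Hz; apply: Hdel => //; exact: uu01.
by rewrite [leRHS](splitr e); apply: lerD.
Qed.

End TrigonometricPolynomials.

(** * Convergence in law from characteristic functions *)

Section LevyContinuity.
Context {R : realType} {l : nat}.
Implicit Types (f q : 'rV[R]_l -> R).

Lemma dotp_continuous t : continuous (dotp t : 'rV[R]_l -> R).
Proof.
rewrite /dotp; elim: (index_enum _) => [|i s IH] y; have FF := nbhs_filter y.
  by under eq_fun do rewrite big_nil; exact: cvg_cst.
under eq_fun do rewrite big_cons; apply: cvgD; last exact: IH.
by apply: cvgM; [exact: cvg_cst|exact: coord_continuous].
Qed.

Lemma trig_continuous q : trig_poly q -> continuous q.
Proof.
elim=> [c t th|f g _ cf _ cg]; last first.
  by move=> y; have FF := nbhs_filter y; apply: cvgD; [exact: cf|exact: cg].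
move=> y; have FF := nbhs_filter y.
apply: cvgM; first exact: cvg_cst.
apply: (@continuous_comp _ _ _ (fun y : 'rV[R]_l => dotp t y + th) (@cos R)); last exact: continuous_cos.
apply: cvgD; last exact: cvg_cst.
exact: dotp_continuous.
Qed.

Section Moments.
Context {disp : measure_display} {T : measurableType disp}.
Variable P : probability T R.

Definition row_L2 (V : T -> 'rV[R]_l) := forall i, L2 P (fun w => V w 0 i).

Lemma comp_row_measurable f (V : T -> 'rV[R]_l) : continuous f ->
  (forall i, measurable_fun setT (fun w => V w 0 i)) -> measurable_fun setT (fun w => f (V w)).
Proof.
move=> cf mV; apply: (@measurableT_comp _ _ _ _ _ _ (f : borel 'rV[R]_l -> R)).
  exact: continuous_borel_measurable.
exact: row_measurable.
Qed.

Lemma comp_row_L1 f K (V : T -> 'rV[R]_l) : continuous f -> (forall y, `|f y| <= K) ->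
  (forall i, measurable_fun setT (fun w => V w 0 i)) -> L1 P (fun w => f (V w)).
Proof.
by move=> cf fK mV; apply: (@L1_bounded _ _ _ _ _ K) => //; exact: comp_row_measurable.
Qed.

(** Off the box both functions are only known to be bounded by [K], but there [2 K] is at most
    [2 K / S^2] times the squared norm, and second moments control the tail. *)
Lemma tail_approx f q (K e S C : R) (V : T -> 'rV[R]_l) : continuous f -> trig_poly q ->
  (forall y, `|f y| <= K) -> (forall y, `|q y| <= K) -> 0 < S ->
  (forall y : 'rV[R]_l, (forall i, `|y 0 i| <= S) -> `|q y - f y| <= e) ->
  row_L2 V -> (forall i, Ex P (fun w => V w 0 i ^+ 2) <= C) ->
  `|Ex P (fun w => q (V w)) - Ex P (fun w => f (V w))| <= e + 2 * K / S ^+ 2 * (l%:R * C).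
Proof.
move=> cf tq fK qK S0 qf LV VC.
have cq := trig_continuous tq.
have K0 : 0 <= K by exact: le_trans (fK 0).
have e0 : 0 <= e.
  by apply: le_trans (qf 0 _) => // i; rewrite mxE normr0 ltW.
have B0 : 0 <= 2 * K / S ^+ 2 by apply: divr_ge0; [exact: mulr_ge0|exact: sqr_ge0].
have mV i := L2_meas (LV i).
have pw (y : 'rV[R]_l) : `|q y - f y| <= e + 2 * K / S ^+ 2 * \sum_i y 0 i ^+ 2.
  have S2 : 0 <= \sum_i y 0 i ^+ 2 by apply: sumr_ge0 => i _; exact: sqr_ge0.
  have [small|/existsNP[i big]] := pselect (forall i, `|y 0 i| <= S).
    by apply: le_trans (qf _ small) _; rewrite lerDl mulr_ge0.
  have {}big : S <= `|y 0 i| by rewrite ltW// ltNge; apply/negP.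
  apply: (@le_trans _ _ (2 * K / S ^+ 2 * \sum_i y 0 i ^+ 2)); last by rewrite lerDr.
  apply: (@le_trans _ _ (2 * K)).
    by apply: le_trans (ler_normB _ _) _; rewrite mulr_natl mulr2n; exact: lerD.
  rewrite -mulrA ler_peMr ?mulr_ge0// ler_pdivlMl ?exprn_gt0// mulr1.
  rewrite (bigD1 i)//=; apply: (@le_trans _ _ (y 0 i ^+ 2)).
    by rewrite -[leRHS](real_normK (num_real _)) lerXn2r ?nnegrE ?(ltW S0).
  by rewrite lerDl sumr_ge0// => j _; exact: sqr_ge0.
have [Lq Lf] := (comp_row_L1 cq qK mV, comp_row_L1 cf fK mV).
have LS : L1 P (fun w => \sum_i V w 0 i ^+ 2) by apply: L1_sum => i _; exact: L2_sqr.
have LBS := L1_scale (2 * K / S ^+ 2) LS; have Le := L1_cst P e.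
rewrite -Ex_sub//; apply: le_trans (Ex_absle _ (L1_add Le LBS) (fun w => pw (V w))) _.
  exact: L1_sub.
rewrite Ex_add// Ex_cst Ex_scale// lerD2l ler_wpM2l// Ex_sum; last by move=> i _; exact: L2_sqr.
apply: (@le_trans _ _ (\sum_(i < l) C)); first exact: ler_sum.
by rewrite sumr_const card_ord -[_ *+ l]mulr_natl.
Qed.

End Moments.

Context {disp : measure_display} {T : measurableType disp} (P : probability T R).
Context {disp' : measure_display} {T' : measurableType disp'} (P' : probability T' R).
Variables (V : nat -> T -> 'rV[R]_l) (Z : T' -> 'rV[R]_l) (C : R).
Hypothesis LV : \forall k \near \oo, row_L2 P (V k).
Hypothesis LZ : row_L2 P' Z.
Hypothesis VC : \forall k \near \oo, forall i, Ex P (fun w => V k w 0 i ^+ 2) <= C.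
Hypothesis ZC : forall i, Ex P' (fun w => Z w 0 i ^+ 2) <= C.
Hypothesis Vcos : forall t th, Ex P (fun w => cos (dotp t (V k w) + th)) @[k --> \oo] -->
  Ex P' (fun w => cos (dotp t (Z w) + th)).

Lemma trig_bounded q : trig_poly q -> exists K, forall y, `|q y| <= K.
Proof.
elim=> [c t th|f g _ [K Kf] _ [L Lg]].
  by exists `|c| => y; rewrite normrM ler_piMr// cos_abs_le1.
by exists (K + L) => y; apply: le_trans (ler_normD _ _) _; exact: lerD.
Qed.

Lemma trig_L1 {disp0 : measure_display} {T0 : measurableType disp0} (P0 : probability T0 R) q (U : T0 -> 'rV[R]_l) :
  trig_poly q -> row_L2 P0 U -> L1 P0 (fun w => q (U w)).
Proof.
move=> tq LU; have [K qK] := trig_bounded tq.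
by apply: comp_row_L1 qK _; [exact: trig_continuous|move=> i; exact: L2_meas].
Qed.

Lemma trig_cvg q : trig_poly q ->
  Ex P (fun w => q (V k w)) @[k --> \oo] --> Ex P' (fun w => q (Z w)).
Proof.
elim=> [c t th|f g tf cf tg cg].
  have LZ' : L1 P' (fun w => cos (dotp t (Z w) + th)).
    have := trig_L1 (trig_cos 1 t th) LZ; by under eq_fun do rewrite mul1r.
  rewrite Ex_scale//.
  have H : c * Ex P (fun w => cos (dotp t (V k w) + th)) @[k --> \oo] -->
      c * Ex P' (fun w => cos (dotp t (Z w) + th)).
    by apply: cvgM; [exact: cvg_cst|exact: Vcos].
  apply: cvg_trans H; apply: near_eq_cvg.
  near=> k; rewrite Ex_scale//.
  have LVk : row_L2 P (V k) by near: k.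
  have := trig_L1 (trig_cos 1 t th) LVk; by under eq_fun do rewrite mul1r.
rewrite Ex_add; [|exact: trig_L1..].
apply: cvg_trans (cvgD cf cg); apply: near_eq_cvg; near=> k.
have LVk : row_L2 P (V k) by near: k.
by rewrite Ex_add//; exact: trig_L1.
Unshelve. all: by end_near. Qed.

(** Bounded second moments supply tightness: on a box outside which little mass is left, [f] is
    replaced by a trigonometric polynomial with the same bound [K], and for that polynomial the
    limit is known. *)
Theorem levy_continuity f K : continuous f -> (forall y, `|f y| <= K) ->
  Ex P (fun w => f (V k w)) @[k --> \oo] --> Ex P' (fun w => f (Z w)).
Proof.
move=> cf fK; apply/cvgrPdist_le => e e0.
have K0 : 0 <= K by exact: le_trans (fK 0).
have e80 : 0 < e / 8 by rewrite divr_gt0.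
pose D := 2 * K * (l%:R * `|C|).
have D0 : 0 <= D by rewrite !mulr_ge0.
pose S := Num.sqrt (D / (e / 8)) + 1.
have S0 : 0 < S by rewrite ltr_wpDl// sqrtr_ge0.
have DS : 2 * K / S ^+ 2 * (l%:R * C) <= e / 8.
  apply: (@le_trans _ _ (D / S ^+ 2)).
    rewrite /D mulrAC ler_wpM2r ?invr_ge0 ?sqr_ge0//.
    by rewrite ler_wpM2l ?mulr_ge0// ler_wpM2l// ler_norm.
  rewrite ler_pdivrMr ?exprn_gt0// -ler_pdivrMl// mulrC.
  have Q0 : 0 <= D / (e / 8) by apply: divr_ge0 => //; exact: ltW.
  rewrite -[leLHS](sqr_sqrtr Q0); apply: lerXn2r; rewrite ?nnegrE ?sqrtr_ge0//; first exact: ltW.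
  by rewrite lerDl.
have [q tq [qK qf]] := trig_approx cf fK S0 e80.
have e20 : 0 < e / 2 by rewrite divr_gt0.
have /cvgrPdist_le/(_ _ e20) := trig_cvg tq => Hq.
near=> k.
have LVk : row_L2 P (V k) by near: k.
have VCk : forall i, Ex P (fun w => V k w 0 i ^+ 2) <= C by near: k.
have h1 := tail_approx cf tq fK qK S0 qf LVk VCk.
have h2 := tail_approx cf tq fK qK S0 qf LZ ZC.
have h3 : `|Ex P' (fun w => q (Z w)) - Ex P (fun w => q (V k w))| <= e / 2 by near: k.
rewrite (_ : _ - _ = (Ex P' (fun w => q (Z w)) - Ex P (fun w => q (V k w))) -
  (Ex P' (fun w => q (Z w)) - Ex P' (fun w => f (Z w))) +
  (Ex P (fun w => q (V k w)) - Ex P (fun w => f (V k w)))); last by ring.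
apply: le_trans (ler_normD _ _) _; apply: le_trans (lerD (ler_normB _ _) (lexx _)) _.
apply: (le_trans (lerD (lerD h3 h2) h1)).
rewrite [leRHS](_ : e = e / 2 + (e / 8 + e / 8) + (e / 8 + e / 8)); last by field.
by apply: lerD; [apply: lerD => //; exact: lerD|exact: lerD].
Unshelve. all: by end_near. Qed.

End LevyContinuity.

(** * A law on the line is determined by its characteristic function *)

Section Uniqueness.
Context {R : realType}.
Local Notation RT := (measurableTypeR R).
Variables mu nu : probability RT R.
Hypothesis L2mu : L2 mu (fun x : R => x).
Hypothesis L2nu : L2 nu (fun x : R => x).
Hypothesis char_eq : forall t th,
  Ex mu (fun x : R => cos (t * x + th)) = Ex nu (fun x : R => cos (t * x + th)).

(** The constant sequence of law [mu] converges to [nu] by the continuity theorem, so the two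
    expectations agree. *)
Lemma char_eq_continuous (f : R -> R) K : continuous f -> (forall x, `|f x| <= K) ->
  Ex mu f = Ex nu f.
Proof.
move=> cf fK.
pose V (x : R) : 'rV[R]_1 := \row__ x.
have E (m : probability RT R) : row_L2 m V <-> L2 m (fun x : R => x).
  split; first by move=> /(_ 0); rewrite /V; under eq_fun do rewrite mxE.
  by move=> L i; rewrite /V; under eq_fun do rewrite mxE.
pose C := Num.max (Ex mu (fun x : R => x ^+ 2)) (Ex nu (fun x : R => x ^+ 2)).
have cf0 : continuous (fun y : 'rV[R]_1 => f (y 0 0)).
  move=> y; apply: (@continuous_comp _ _ _ (fun y : 'rV[R]_1 => y 0 0) f); last exact: cf.
  exact: coord_continuous.
have row1 (m : probability RT R) i : Ex m (fun x => V x 0 i ^+ 2) = Ex m (fun x : R => x ^+ 2).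
  by rewrite /V; under eq_fun do rewrite mxE.
have H : Ex mu (fun x => f (V x 0 0)) @[k --> \oo] --> Ex nu (fun x => f (V x 0 0)).
  apply: (@levy_continuity R 1 _ _ mu _ _ nu (fun=> V) V C _ _ _ _ _ (fun y => f (y 0 0)) K cf0).
  - by near=> k; apply/E.
  - exact/E.
  - by near=> k => i; rewrite row1 le_max lexx.
  - by move=> i; rewrite row1 le_max lexx orbT.
  - move=> t th; have D x : dotp t (V x) = t 0 0 * x by rewrite /dotp big_ord1 mxE.
    have D' : (fun x => cos (dotp t (V x) + th)) = fun x => cos (t 0 0 * x + th).
      by apply/funext => x; rewrite D.
    by rewrite /= D' char_eq; exact: cvg_cst.
  - by move=> y; exact: fK.
have D (m : probability RT R) : Ex m (fun x => f (V x 0 0)) = Ex m f.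
  by rewrite /V; under eq_fun do rewrite mxE.
by rewrite !D in H; apply: (cvg_unique _ (cvg_cst _) H).
Unshelve. all: by end_near. Qed.

(** The ramps [f n] are continuous and tend pointwise to the indicator of the open ray, the value at
    [a] being 0. *)
Lemma char_eq_ray (a : R) : mu `]a, +oo[%classic = nu `]a, +oo[%classic.
Proof.
pose f (n : nat) (x : R) : R := Num.min 1 (Num.max 0 (n%:R * (x - a))).
have cf n : continuous (f n).
  move=> x; apply: (@continuous_min _ _ (cst 1) (fun x => Num.max 0 (n%:R * (x - a)))); first exact: cvg_cst.
  apply: (@continuous_max _ _ (cst 0) (fun x => n%:R * (x - a))); first exact: cvg_cst.
  by apply: cvgM; [exact: cvg_cst|apply: cvgB; [exact: cvg_id|exact: cvg_cst]].
have f01 n x : 0 <= f n x <= 1.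
  by rewrite /f le_min ler01 le_max lexx/= ge_min lexx.
have f1 n x : `|f n x| <= 1 by have /andP[? ?] := f01 n x; rewrite ger0_norm.
have flim x : f n x @[n --> \oo] --> (\1_`]a, +oo[%classic x : R).
  rewrite indicE; have [xa|ax] := leP x a.
    rewrite memNset; last by rewrite /= in_itv/= andbT ltNge xa.
    apply: cvg_trans (@cvg_cst _ (0 : R) nat \oo _); apply: near_eq_cvg; near=> n.
    rewrite /f (_ : Num.max 0 _ = 0); first by rewrite (min_idPr _).
    by apply/max_idPl; rewrite mulr_ge0_le0// subr_le0.
  rewrite mem_set; last by rewrite /= in_itv/= andbT.
  apply: cvg_trans (@cvg_cst _ (1 : R) nat \oo _); apply: near_eq_cvg; near=> n.
  have xa0 : 0 < x - a by rewrite subr_gt0.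
  have : (Num.truncn (x - a)^-1).+1%:R <= n%:R :> R.
    by rewrite ler_nat; near: n; exact: nbhs_infty_ge.
  move=> /(lt_le_trans (truncnS_gt _)) h.
  have h1 : 1 <= n%:R * (x - a) by rewrite -ler_pdivrMr// mul1r ltW.
  by rewrite /f (max_idPr _) ?(le_trans ler01)// (min_idPl h1).
have mI : measurable (`]a, +oo[%classic : set RT) by exact: measurable_itv.
have lim (m : probability RT R) : Ex m (f n) @[n --> \oo] --> Ex m (\1_`]a, +oo[%classic).
  have mf n : measurable_fun setT (f n) by apply: continuous_measurable_fun; exact: cf.
  have Lf n : L1 m (f n) by apply: (@L1_bounded _ _ _ _ _ 1); [exact: mf|exact: f1].
  have := @dominated_cvg _ RT R m setT measurableT (fun n x => (f n x)%:E)
     (fun x => (\1_`]a, +oo[%classic x)%:E) (fun=> 1%E) _ _ _ _ _.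
  move=> H; apply/fine_cvg; rewrite -ExE; last exact: L1_indic.
  apply: H.
  - by move=> n; apply/measurable_EFinP; exact: mf.
  - by move=> x _; apply/fine_cvgP; split; [exact: nearW|exact: flim].
  - by [].
  - exact: (L1_cst m 1).
  - by move=> x n _; rewrite lee_fin.
have E : Ex mu (\1_`]a, +oo[%classic) = Ex nu (\1_`]a, +oo[%classic).
  have := lim mu; have -> : (fun n => Ex mu (f n)) = fun n => Ex nu (f n).
    by apply/funext => n; apply: char_eq_continuous (f1 n); exact: cf.
  by move=> h; apply: (cvg_unique _ h (lim nu)).
move: E; rewrite !Ex_indic// => E.
by rewrite -[LHS]fineK ?fin_num_measure// E fineK// fin_num_measure.
Unshelve. all: by end_near. Qed.

Lemma char_eq_measure (A : set RT) : measurable A -> mu A = nu A.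
Proof.
move=> mA; apply: (@measure_unique _ R RT (@RGenOInfty.G R) (fun n => `](- n%:R), +oo[%classic)) => //.
- exact: RGenOInfty.measurableE.
- move=> _ _ [x ->] [y ->]; exists (Num.max x y).
  by apply/seteqP; split=> z /=; rewrite !in_itv/= !andbT gt_max => /andP.
- by move=> n; exists (- n%:R).
- apply/seteqP; split=> // x _; exists (Num.truncn `|x|).+1 => //=.
  rewrite in_itv/= andbT ltrNl; apply: le_lt_trans (truncnS_gt `|x|).
  by rewrite -normrN ler_norm.
- by move=> _ [a ->]; exact: char_eq_ray.
- by move=> n; rewrite (le_lt_trans (probability_le1 _ _)) ?ltry//; exact: measurable_itv.
Qed.

End Uniqueness.

(** * Integrals against the normal density *)

Section ImproperFTC.
Context {R : realType}.
Local Notation mu := (@lebesgue_measure R).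

Lemma integral_derivative_eq0 (G g : R -> R) :
  (forall x : R, is_derive x 1 G (g x)) -> continuous g ->
  mu.-integrable setT (EFin \o g) ->
  G n%:R @[n --> \oo] --> 0 -> G (- n%:R) @[n --> \oo] --> 0 ->
  (\int[mu]_x (g x)%:E = 0)%E.
Proof.
move=> dG cg Lg Gp Gn.
pose I (n : nat) : set R := `[- n.+1%:R, n.+1%:R]%classic.
have mI n : measurable (I n) by exact: measurable_itv.
have mg : measurable_fun setT (EFin \o g) := measurable_int _ Lg.
have cv : (\int[mu]_x ((EFin \o g) \_ (I n)) x)%E @[n --> \oo] --> (\int[mu]_x (g x)%:E)%E.
  apply: (@dominated_cvg _ _ R mu setT measurableT (fun n => (EFin \o g) \_ (I n)) (EFin \o g) (fun x => `|(EFin \o g) x|%E)).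
  - by move=> n; exact: ((measurable_restrictT (EFin \o g) (mI n)).1 (measurable_funTS mg)).
  - move=> x _; apply: cvg_trans (@cvg_cst _ (EFin (g x)) nat \oo _); apply: near_eq_cvg.
    near=> n; rewrite patchE mem_set// /I /= in_itv/= -ler_norml.
    apply: (le_trans (ltW (truncnS_gt _))); rewrite ler_nat ltnS.
    by near: n; exact: nbhs_infty_ge.
  - by move=> x _; rewrite fin_numElt; rewrite /= ltry andbT; exact: ltNyr.
  - exact: integrable_abse.
  - by move=> x n _; rewrite patchE; case: ifP => // _; rewrite abse0 abse_ge0.
have cG : continuous G.
  by move=> z; apply: differentiable_continuous; apply/derivable1_diffP; have [] := dG z.
have FTC n : (\int[mu]_x ((EFin \o g) \_ (I n)) x = (G n.+1%:R)%:E - (G (- n.+1%:R))%:E)%E.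
  rewrite -integral_mkcond; apply: continuous_FTC2.
  - by rewrite gtrN// ltr0n.
  - exact: continuous_subspaceT.
  - split.
    + by move=> x _; have [] := dG x.
    + by apply: cvg_at_right_filter; exact: cG.
    + by apply: cvg_at_left_filter; exact: cG.
  - by move=> x _; rewrite derive1E; have [_ ->] := dG x.
have lim0 : (\int[mu]_x ((EFin \o g) \_ (I n)) x)%E @[n --> \oo] --> (0 : R)%:E.
  under eq_fun do rewrite FTC -EFinB.
  apply/fine_cvgP; split; first exact: nearW.
  rewrite -[X in _ --> X](subrr (0 : R)); apply: cvgB.
    by rewrite (cvg_shiftS (fun n => G n%:R)).
  by rewrite (cvg_shiftS (fun n => G (- n%:R))).
exact: (cvg_unique _ cv lim0).
Unshelve. all: by end_near. Qed.

End ImproperFTC.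

Section NormalIntegrals.
Context {R : realType}.
Variable s : R.
Hypothesis s0 : 0 < s.
Local Notation mu := (@lebesgue_measure R).
Local Notation RT := (measurableTypeR R).
Local Notation N := (normal_prob 0 s : probability RT R).
Let pdf : R -> R := normal_pdf 0 s.

Lemma normal_pdf0E x : pdf x = normal_peak s * expR (- (x ^+ 2 / (s ^+ 2 *+ 2))).
Proof. by rewrite /pdf normal_pdfE ?gt_eqF// /normal_fun subr0 mulNr. Qed.

(** The Radon-Nikodym derivative of the normal law and the density have the same integral over every
    measurable set, hence agree almost everywhere. *)
Lemma ge0_integral_normal (f : R -> R) : measurable_fun setT f -> (forall x, 0 <= f x) ->
  (\int[N]_x (f x)%:E = \int[mu]_x (f x * pdf x)%:E)%E.
Proof.
move=> mf f0.
have dom : N `<< mu by exact: normal_prob_dominates.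
have mpdf : measurable_fun setT pdf by exact: measurable_normal_pdf.
pose h := Radon_Nikodym_SigmaFinite.f N mu.
have ih : mu.-integrable setT h by exact: Radon_Nikodym_SigmaFinite.f_integrable.
have hpdf : ae_eq mu setT h (EFin \o pdf).
  apply: integral_ae_eq => //; first exact/measurable_EFinP.
  by move=> A _ mA; rewrite -Radon_Nikodym_SigmaFinite.f_integral.
have mEf : measurable_fun setT (EFin \o f) by exact/measurable_EFinP.
have <- := @Radon_Nikodym_SigmaFinite.change_of_variables _ RT R N mu dom (EFin \o f) setT _ measurableT mEf.
  apply: ae_eq_integral => //.
  - by apply: emeasurable_funM => //; exact: measurable_int ih.
  - by apply/measurable_EFinP; exact: measurable_funM.
  - by apply: filterS hpdf => x E xT; rewrite EFinM; congr (_ * _)%E; exact: E.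
by move=> x; rewrite lee_fin.
Qed.

Lemma integral_normal (f : R -> R) : L1 N f ->
  mu.-integrable setT (fun x => (f x * pdf x)%:E) /\
  (Ex N f)%:E = (\int[mu]_x (f x * pdf x)%:E)%E.
Proof.
move=> Lf; have mf := L1_meas Lf.
have pdf0 x : 0 <= pdf x by exact: normal_pdf_ge0.
have mpdf : measurable_fun setT pdf by exact: measurable_normal_pdf.
have mfp (g : R -> R) : measurable_fun setT g -> measurable_fun setT (fun x => (g x * pdf x)%:E).
  by move=> mg; apply/measurable_EFinP; exact: measurable_funM.
have int_of (g : R -> R) : L1 N g -> mu.-integrable setT (fun x => (g x * pdf x)%:E).
  move=> Lg; have mg := L1_meas Lg.
  apply/integrableP; split; first exact: mfp.
  have -> : (\int[mu]_x `|(g x * pdf x)%:E| = \int[mu]_x (`|g x| * pdf x)%:E)%E.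
    by apply: eq_integral => x _; rewrite abse_EFin normrM (ger0_norm (pdf0 x)).
  rewrite -ge0_integral_normal//; last exact: measurableT_comp.
  by rewrite (ExE (L1_abs Lg)) ltry.
split; first exact: int_of.
pose fp x := Num.max (f x) 0; pose fn x := Num.max (- f x) 0.
have mfp' : measurable_fun setT fp by exact: measurable_maxr.
have mfn' : measurable_fun setT fn by apply: measurable_maxr => //; exact: measurableT_comp.
have fE x : f x = fp x - fn x.
  by rewrite /fp /fn; case: (leP (f x) 0) => h; case: (leP (- f x) 0) => h'; lra.
have fp0 x : 0 <= fp x by rewrite le_max lexx orbT.
have fn0 x : 0 <= fn x by rewrite le_max lexx orbT.
have Lp : L1 N fp.
  apply: (@L1_dom _ RT R N fp (fun x => `|f x|)) => //; first exact: L1_abs.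
  move=> x; rewrite ger0_norm// /fp ge_max normr_ge0 andbT.
  exact: ler_norm.
have Ln : L1 N fn.
  apply: (@L1_dom _ RT R N fn (fun x => `|f x|)) => //; first exact: L1_abs.
  move=> x; rewrite ger0_norm// /fn ge_max normr_ge0 andbT.
  by rewrite -normrN ler_norm.
have Ep : (Ex N fp)%:E = (\int[mu]_x (fp x * pdf x)%:E)%E.
  by rewrite -ge0_integral_normal// ExE.
have En : (Ex N fn)%:E = (\int[mu]_x (fn x * pdf x)%:E)%E.
  by rewrite -ge0_integral_normal// ExE.
have -> : Ex N f = Ex N fp - Ex N fn.
  by rewrite -Ex_sub//; congr Ex; apply/funext.
rewrite EFinB Ep En -integralB//; [|exact: int_of..].
by apply: eq_integral => x _; rewrite -EFinB -mulrBl -fE.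
Qed.

Let B : R := 8 * s ^+ 2 * (normal_peak s / normal_peak (2 * s)).

Let B0 : 0 <= B.
Proof.
apply: mulr_ge0; first by apply: mulr_ge0 => //; exact: sqr_ge0.
by apply: divr_ge0; exact: normal_peak_ge0.
Qed.

(** With [y = x^2 / (8 s^2)], the density of deviation [s] decays as [exp(- 4 y)], that of deviation
    [2 s] as [exp(- y)], and [y exp(- 3 y) <= 1]. The integrand of the second moment is thus
    dominated by a multiple of a density. *)
Lemma sqr_normal_pdf_le x : x ^+ 2 * pdf x <= B * normal_pdf 0 (2 * s) x.
Proof.
have s20 : 2 * s != 0 by rewrite mulf_neq0 ?gt_eqF.
have p0 := normal_peak_gt0 s20.
rewrite normal_pdf0E normal_pdfE// /normal_fun subr0.
set c := normal_peak s; set c2 := normal_peak (2 * s) in p0 *.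
have c0 : 0 <= c by exact: normal_peak_ge0.
pose y := x ^+ 2 / (8 * s ^+ 2).
have s2 : 0 < s ^+ 2 by rewrite exprn_gt0.
have y0 : 0 <= y by rewrite divr_ge0 ?sqr_ge0// mulr_ge0// ltW.
have -> : - x ^+ 2 / ((2 * s) ^+ 2 *+ 2) = - y by rewrite /y; field; rewrite gt_eqF.
have -> : - (x ^+ 2 / (s ^+ 2 *+ 2)) = - y + - (3 * y) by rewrite /y; field; rewrite gt_eqF.
have -> : x ^+ 2 = 8 * s ^+ 2 * y by rewrite /y; field; rewrite gt_eqF.
rewrite expRD (_ : B * _ = (8 * s ^+ 2 * c * expR (- y)) * 1); last first.
  by rewrite /B -/c -/c2; field; rewrite gt_eqF.
rewrite (_ : _ * _ = (8 * s ^+ 2 * c * expR (- y)) * (y * expR (- (3 * y)))); last by ring.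
apply: ler_wpM2l; first by rewrite mulr_ge0 ?expR_ge0// mulr_ge0// mulr_ge0// ltW.
rewrite expRN ler_pdivrMr ?expR_gt0// mul1r.
by apply: le_trans (expR_ge1Dx _); lra.
Qed.

Let sqr_normal_pdf_bound x : x ^+ 2 * pdf x <= B * normal_peak (2 * s).
Proof.
apply: le_trans (sqr_normal_pdf_le x) _; rewrite ler_wpM2l//.
by apply: normal_pdf_ub; rewrite mulf_neq0 ?gt_eqF.
Qed.

Lemma normal_id_L2 : L2 N (fun x : R => x).
Proof.
split; first exact: measurable_id.
have mpdf : measurable_fun setT pdf by exact: measurable_normal_pdf.
apply/integrableP; split; first by apply/measurable_EFinP; exact: measurable_funX.
under eq_integral do rewrite /= ger0_norm ?sqr_ge0//.
rewrite (ge0_integral_normal (f := fun x => x ^+ 2)); [|exact: measurable_funX|by move=> x; exact: sqr_ge0].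
have IB : mu.-integrable setT (fun x => (B * normal_pdf 0 (2 * s) x)%:E).
  by under eq_fun do rewrite EFinM; apply: integrableZl => //; exact: integrable_normal_pdf.
have /integrableP[_] : mu.-integrable setT (fun x => (x ^+ 2 * pdf x)%:E).
  apply: le_integrable IB => //.
    by apply/measurable_EFinP; apply: measurable_funM => //; exact: measurable_funX.
  move=> x _ /=; rewrite lee_fin !ger0_norm; first exact: sqr_normal_pdf_le.
    by apply: mulr_ge0 => //; exact: normal_pdf_ge0.
  by apply: mulr_ge0; [exact: sqr_ge0|exact: normal_pdf_ge0].
apply: le_lt_trans; apply: ge0_le_integral => //.
- by move=> x _; rewrite lee_fin; apply: mulr_ge0; [exact: sqr_ge0|exact: normal_pdf_ge0].
- by apply/measurable_EFinP; apply: measurable_funM => //; exact: measurable_funX.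
- apply: measurableT_comp => //; apply/measurable_EFinP.
  by apply: measurable_funM; [exact: measurable_funX|exact: mpdf].
- by move=> x _; rewrite lee_fin ler_norm.
Qed.

Lemma is_derive_normal_pdf (x : R) : is_derive x 1 pdf (- (x / s ^+ 2) * pdf x).
Proof.
rewrite (_ : pdf = fun x => normal_peak s * expR (- (x ^+ 2 / (s ^+ 2 *+ 2)))); last first.
  by apply/funext => z; exact: normal_pdf0E.
apply: is_derive_eq; rewrite /GRing.scale/=.
by field; rewrite gt_eqF.
Qed.

Lemma normal_pdf_decay (k : R) (G : R -> R) : 0 <= k ->
  (forall x, 1 <= `|x| -> `|G x| <= k * (`|x| * pdf x)) ->
  G n%:R @[n --> \oo] --> (0 : R) /\ G (- n%:R) @[n --> \oo] --> (0 : R).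
Proof.
move=> k0 HG.
have C0 : 0 <= k * (B * normal_peak (2 * s)) by do 2?apply: mulr_ge0 => //; exact: normal_peak_ge0.
have key x : 1 <= `|x| -> `|G x| <= k * (B * normal_peak (2 * s)) / `|x|.
  move=> x1; have x0 : 0 < `|x| by rewrite (lt_le_trans _ x1).
  apply: le_trans (HG _ x1) _; rewrite -mulrA ler_wpM2l//.
  rewrite ler_pdivlMr//; apply: le_trans (sqr_normal_pdf_bound x).
  by rewrite -(real_normK (num_real x)) expr2 mulrAC.
have main (sg : nat -> R) : (forall n, `|sg n| = n%:R) -> G (sg n) @[n --> \oo] --> (0 : R).
  move=> sgn; apply/cvgrPdist_le => e e0; near=> n.
  rewrite sub0r normrN.
  have n1 : (0 < n)%N by near: n; exact: nbhs_infty_gt.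
  apply: le_trans (key _ _) _; first by rewrite sgn ler1n.
  rewrite sgn ler_pdivrMr ?ltr0n// [leRHS]mulrC -ler_pdivrMr//.
  apply: le_trans (ltW (truncnS_gt _)) _; rewrite ler_nat.
  by near: n; exact: nbhs_infty_ge.
by split; apply: main => n; rewrite ?normrN ger0_norm.
Unshelve. all: by end_near. Qed.

(** [g] times the density is the derivative of [G], which vanishes at both ends. Each [G] gives an
    identity: a multiple of the density yields the mean, [x] times the density the variance, a sine
    times the density Stein's identity. *)
Lemma normal_stein_gen (k : R) (G g : R -> R) : 0 <= k -> continuous g -> L1 N g ->
  (forall x : R, is_derive x 1 G (g x * pdf x)) ->
  (forall x, 1 <= `|x| -> `|G x| <= k * (`|x| * pdf x)) -> Ex N g = 0.
Proof.
move=> k0 cg Lg dG HG; have [Lgp E] := integral_normal Lg.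
have [d1 d2] := normal_pdf_decay k0 HG.
apply: EFin_inj; rewrite E; apply: (integral_derivative_eq0 (G := G)) => //.
move=> x; apply: cvgM; first exact: cg.
by apply: continuous_normal_pdf; rewrite gt_eqF.
Qed.

Let pdf0 x : 0 <= pdf x. Proof. exact: normal_pdf_ge0. Qed.

Lemma normal_mean : Ex N (fun x : R => x) = 0.
Proof.
apply: (@normal_stein_gen (s ^+ 2) (fun x => - s ^+ 2 * pdf x)); first exact: sqr_ge0.
- by move=> x; exact: cvg_id.
- exact: L2_L1 normal_id_L2.
- move=> x; have dp := is_derive_normal_pdf x; apply: is_derive_eq.
  by rewrite /GRing.scale/=; field; rewrite gt_eqF.
- move=> x x1; rewrite normrM normrN (ger0_norm (pdf0 x)) ger0_norm ?sqr_ge0//.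
  by rewrite ler_wpM2l ?sqr_ge0// ler_peMl.
Qed.

Lemma normal_var : Ex N (fun x : R => x ^+ 2) = s ^+ 2.
Proof.
have Lx := L2_sqr normal_id_L2; have Lc := L1_cst N 1.
have : Ex N (fun x : R => 1 - (s ^+ 2)^-1 * x ^+ 2) = 0.
  apply: (@normal_stein_gen 1 (fun x => x * pdf x)) => //.
  - move=> x; apply: cvgB; first exact: cvg_cst.
    by apply: cvgM; [exact: cvg_cst|rewrite expr2; under eq_fun do rewrite expr2; apply: cvgM; exact: cvg_id].
  - by apply: L1_sub => //; exact: L1_scale.
  - move=> x; have dp := is_derive_normal_pdf x; apply: is_derive_eq.
    by rewrite /GRing.scale/=; field; rewrite gt_eqF.
  - by move=> x x1; rewrite mul1r normrM (ger0_norm (pdf0 x)).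
rewrite Ex_sub// ?Ex_cst ?Ex_scale//; last exact: L1_scale.
move=> /eqP; rewrite subr_eq0 => /eqP h.
by rewrite -[LHS](mulVKf (x := s ^+ 2)) ?gt_eqF ?exprn_gt0// -h mulr1.
Qed.

Lemma normal_stein l t : Ex N (fun x : R => x * sin (l * x + t)) =
  s ^+ 2 * (l * Ex N (fun x : R => cos (l * x + t))).
Proof.
have Ls := L1_mul_sin l t normal_id_L2.
have Lc := L1_cos N l t (L2_meas normal_id_L2).
have : Ex N (fun x : R => l * cos (l * x + t) - (s ^+ 2)^-1 * (x * sin (l * x + t))) = 0.
  have cl : continuous (fun x : R => l * x + t).
    by move=> x; apply: cvgD; [apply: cvgM; [exact: cvg_cst|exact: cvg_id]|exact: cvg_cst].
  apply: (@normal_stein_gen 1 (fun x => sin (l * x + t) * pdf x)) => //.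
  - move=> x; apply: cvgB; (apply: cvgM; first exact: cvg_cst).
      by apply: (@continuous_comp _ _ _ (fun x : R => l * x + t) (@cos R)); [exact: cl|exact: continuous_cos].
    apply: cvgM; first exact: cvg_id.
    by apply: (@continuous_comp _ _ _ (fun x : R => l * x + t) (@sin R)); [exact: cl|exact: continuous_sin].
  - by apply: L1_sub; exact: L1_scale.
  - move=> x; have dp := is_derive_normal_pdf x; apply: is_derive_eq.
    by rewrite /GRing.scale/=; field; rewrite gt_eqF.
  - move=> x x1; rewrite mul1r normrM (ger0_norm (pdf0 x)) ler_wpM2r//.
    by apply: le_trans x1; exact: sin_abs_le1.
rewrite Ex_sub; [|exact: L1_scale..]; rewrite !Ex_scale// => /eqP; rewrite subr_eq0 => /eqP h.
by rewrite h mulVKf// gt_eqF ?exprn_gt0.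
Qed.

(** Stein's identity for the normal law is the differential equation of [Ex_cos_gaussian] with error
    0. *)
Lemma normal_char a t :
  Ex N (fun x : R => cos (a * x + t)) = expR (- (a ^+ 2 * s ^+ 2 / 2)) * cos t.
Proof.
apply/eqP; rewrite -subr_eq0 -normr_le0.
apply: (@Ex_cos_gaussian _ _ _ N (fun x : R => a * x)).
- exact: L2_scale normal_id_L2.
- by rewrite mulr_ge0// sqr_ge0.
move=> l /andP[l0 l1]; rewrite normr_le0 subr_eq0; apply/eqP.
have E : (fun x : R => a * x * sin (l * (a * x) + t)) = fun x => a * (x * sin ((l * a) * x + t)).
  by apply/funext => x; rewrite -!mulrA.
rewrite E Ex_scale; last exact: L1_mul_sin normal_id_L2.
rewrite normal_stein; under [in RHS]eq_fun do rewrite mulrA; ring.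
Qed.

End NormalIntegrals.

Section ImageProbability.
Context {R : realType} {d1 d2 : measure_display}.
Context {T : measurableType d1} {U : measurableType d2}.

Lemma image_probability (P : probability T R) (X : T -> U) : measurable_fun setT X ->
  exists Q : probability U R, (forall A, measurable A -> Q A = P (X @^-1` A)) /\
    forall f : U -> R, measurable_fun setT f -> L1 P (f \o X) ->
      L1 Q f /\ Ex Q f = Ex P (f \o X).
Proof.
move=> mX.
pose Xm : {mfun T >-> U} := HB.pack X (isMeasurableFun.Build _ _ _ _ X mX).
exists (distribution P Xm); split=> // f mf Lf.
have mEf : measurable_fun setT (EFin \o f) by exact/measurable_EFinP.
have L : L1 (distribution P Xm) f.
  apply/integrableP; split=> //.
  rewrite ge0_integral_distribution//; last exact: measurableT_comp.
  by have /integrableP[] := Lf.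
by split=> //; rewrite /Ex integral_distribution.
Qed.

End ImageProbability.

Lemma leq_sub_succ n i l : (i + n < l)%N -> (n < l)%N -> (i <= l - n.+1)%N.
Proof. lia. Qed.

Lemma ltn_sub_succ n i l : (n < l)%N -> (i < l - n.+1)%N -> (i + n.+1 < l)%N.
Proof. lia. Qed.

Lemma integral_cst_probability {R : realType} {d : measure_display} {T : measurableType d}
  (P : probability T R) (c : \bar R) : (\int[P]_x c = c)%E.
Proof.
by rewrite integral_cst// -[RHS]mule1; congr (_ * _)%E; exact: probability_setT.
Qed.

Section ProductExpectation.
Context {R : realType} {d1 d2 : measure_display}.
Context {T : measurableType d1} {U : measurableType d2}.
Variables (P : probability T R) (Q : probability U R).

Lemma L2_fst f : L2 P f -> L2 (P \x Q)%E (fun p => f p.1).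
Proof.
move=> [mf Lf]; split; first exact: measurableT_comp.
apply/integrableP; split.
  by apply/measurable_EFinP; apply: measurable_funX; exact: measurableT_comp.
have mF : measurable_fun setT (fun p : T * U => `|(f p.1 ^+ 2)%:E|%E).
  apply: measurableT_comp => //; apply/measurable_EFinP; apply: measurable_funX.
  exact: measurableT_comp.
rewrite (@fubini_tonelli1 _ _ T U R P Q (fun p : T * U => `|(f p.1 ^+ 2)%:E|%E))//.
have /integrableP[_] := Lf; apply: le_lt_trans.
rewrite le_eqVlt; apply/orP; left; apply/eqP; apply: eq_integral => x _.
by rewrite /fubini_F/= integral_cst_probability.
Qed.

Lemma L2_snd g : L2 Q g -> L2 (P \x Q)%E (fun p => g p.2).
Proof.
move=> [mg Lg]; split; first exact: measurableT_comp.
apply/integrableP; split.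
  by apply/measurable_EFinP; apply: measurable_funX; exact: measurableT_comp.
have mF : measurable_fun setT (fun p : T * U => `|(g p.2 ^+ 2)%:E|%E).
  apply: measurableT_comp => //; apply/measurable_EFinP; apply: measurable_funX.
  exact: measurableT_comp.
rewrite (@fubini_tonelli1 _ _ T U R P Q (fun p : T * U => `|(g p.2 ^+ 2)%:E|%E))//.
have /integrableP[_] := Lg; by rewrite /fubini_F/= integral_cst_probability.
Qed.

Lemma Ex_prod (h : T * U -> R) : L1 (P \x Q)%E h ->
  (forall x, L1 Q (fun y => h (x, y))) ->
  Ex (P \x Q)%E h = Ex P (fun x => Ex Q (fun y => h (x, y))).
Proof.
move=> Lh Lx; rewrite /Ex -(@integral12_prod_meas1 _ _ T U R P Q (EFin \o h) Lh); congr fine.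
by apply: eq_integral => x _; rewrite /fubini_F/= -ExE// Lx.
Qed.

End ProductExpectation.

(** * Existence of Gaussian vectors, singular covariance included *)

Section GaussianExistence.
Context {R : realType} {l : nat}.
Implicit Types (t v : 'rV[R]_l) (s : seq 'rV[R]_l).
Local Notation Rl := (borel 'rV[R]_l).
Local Notation N := (normal_prob 0 1 : probability (measurableTypeR R) R).

Definition quad s t : R := \sum_(v <- s) dotp t v ^+ 2.

Lemma dotp_measurable t : measurable_fun setT (fun y : Rl => dotp t (y : 'rV[R]_l)).
Proof. exact: continuous_borel_measurable (dotp_continuous (t := t)). Qed.

(** The law of a sum of independent standard normals times the vectors of [s]: each vector adds one
    normal factor to a product measure, whose image is taken. *)
Lemma gaussian_sum s : exists nu : probability Rl R,
  row_L2 nu (fun y => y) /\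
  forall t th, Ex nu (fun y => cos (dotp t y + th)) = expR (- (quad s t / 2)) * cos th.
Proof.
elim: s => [|v s [nu [L IH]]].
  have m0 : measurable_fun setT (fun _ : measurableTypeR R => (0 : 'rV[R]_l) : Rl) by exact: measurable_cst.
  have [Q [_ HQ]] := image_probability N m0.
  exists Q; split.
    move=> i; split; first exact: coord_measurable.
    apply: (HQ (fun y : Rl => (y : 'rV[R]_l) 0 i ^+ 2) _ _).1.
      by apply: measurable_funX; exact: coord_measurable.
    by rewrite (_ : _ \o _ = fun=> (0 : R) ^+ 2); [exact: L1_cst|apply/funext => x; rewrite /= mxE].
  move=> t th; rewrite (HQ (fun y : Rl => cos (dotp t y + th)) _ _).2.
  - rewrite /quad big_nil mul0r oppr0 expR0 mul1r.
    rewrite (_ : _ \o _ = fun=> cos th); first exact: Ex_cst.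
    apply/funext => x /=; rewrite /dotp big1 ?add0r// => i _.
    by rewrite mxE mulr0.
  - apply: (@measurableT_comp _ _ _ _ _ _ (@cos R)); first exact: measurable_cos.
    by apply: measurable_funD => //; exact: dotp_measurable.
  - rewrite (_ : _ \o _ = fun=> cos (dotp t 0 + th))//; exact: L1_cst.
pose X (p : Rl * measurableTypeR R) : 'rV[R]_l := (p.1 : 'rV[R]_l) + (p.2 : R) *: v.
pose PQ := (nu \x N)%E : probability _ R.
have LN : L2 N (fun x : R => x) by exact: normal_id_L2.
have LX : row_L2 PQ X.
  move=> i; rewrite /X; under eq_fun do rewrite !mxE.
  apply: L2_add; first exact: (L2_fst N (L i)).
  under eq_fun do rewrite mulrC.
  by apply: L2_scale; exact: (L2_snd nu LN).
have mX : measurable_fun setT (X : _ -> Rl) by apply: row_measurable => i; exact: L2_meas (LX i).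
have [Q [_ HQ]] := image_probability PQ mX.
exists Q; split.
  move=> i; split; first exact: coord_measurable.
  apply: (HQ (fun y : Rl => (y : 'rV[R]_l) 0 i ^+ 2) _ _).1.
    by apply: measurable_funX; exact: coord_measurable.
  exact: L2_sqr (LX i).
move=> t th.
have mcos : measurable_fun setT (fun y : Rl => cos (dotp t (y : 'rV[R]_l) + th)).
  apply: (@measurableT_comp _ _ _ _ _ _ (@cos R)); first exact: measurable_cos.
  by apply: measurable_funD => //; exact: dotp_measurable.
have Lc : L1 PQ ((fun y : Rl => cos (dotp t (y : 'rV[R]_l) + th)) \o X).
  apply: (@L1_bounded _ _ _ _ _ 1); last by move=> p; exact: cos_abs_le1.
  exact: measurableT_comp.
rewrite (HQ _ mcos Lc).2.
have E y z : dotp t (X (y, z)) + th = dotp t v * z + (dotp t y + th).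
  rewrite /X/= addrA; congr (_ + th); rewrite addrC /dotp mulr_suml -big_split/=.
  by apply: eq_bigr => i _; rewrite !mxE; ring.
rewrite Ex_prod//; last first.
  move=> y; under eq_fun do rewrite /= E.
  exact: L1_cos (L2_meas LN).
transitivity (Ex nu (fun y => expR (- (dotp t v ^+ 2 / 2)) * cos (dotp t y + th))).
  congr Ex; apply/funext => y; under eq_fun do rewrite /= E.
  by rewrite (normal_char ltr01) expr1n mulr1.
rewrite Ex_scale ?IH.
  by rewrite mulrA -expRD /quad big_cons mulrDl opprD.
apply: (@L1_bounded _ _ _ _ _ 1) => // y; exact: cos_abs_le1.
Qed.

Definition qform (S : 'M[R]_l) t : R := \sum_i \sum_j t 0 i * t 0 j * S i j.

Definition psd (S : 'M[R]_l) := (forall i j, S i j = S j i) /\ forall t, 0 <= qform S t.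

Lemma qform_add_delta (S : 'M[R]_l) t i c : (forall i j, S i j = S j i) ->
  qform S (t - c *: delta_mx 0 i) = qform S t - 2 * c * (\sum_j S i j * t 0 j) + c ^+ 2 * S i i.
Proof.
move=> sym.
have D k : (t - c *: delta_mx 0 i) 0 k = t 0 k - c * (k == i)%:R.
  by rewrite !mxE eqxx.
rewrite /qform; under eq_bigr do under eq_bigr do rewrite !D.
have e1 (f : 'I_l -> R) : \sum_j (j == i)%:R * f j = f i.
  rewrite (bigD1 i)//= eqxx mul1r big1 ?addr0// => j /negPf ->.
  by rewrite mul0r.
transitivity (\sum_a (\sum_b t 0 a * t 0 b * S a b - c * (t 0 a * S a i) -
    (a == i)%:R * (c * (\sum_b t 0 b * S a b) - c ^+ 2 * S a i))).
  apply: eq_bigr => a _.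
  rewrite -(e1 (fun b => t 0 a * S a b)) -(e1 (fun b => S a b)) !mulr_sumr -!sumrB.
  rewrite mulr_sumr -sumrB; apply: eq_bigr => b _; ring.
rewrite sumrB e1 sumrB -mulr_sumr.
have -> : \sum_j S i j * t 0 j = \sum_b t 0 b * S i b by apply: eq_bigr => b _; rewrite mulrC.
have -> : \sum_a t 0 a * S a i = \sum_b t 0 b * S i b by apply: eq_bigr => a _; rewrite sym.
ring.
Qed.

(** The function [c |-> qform S (t - c e_i)] is quadratic and non-negative. Its minimum, at
    [c = b / S i i], gives the inequality; when [S i i = 0] it is affine in [c], so its slope must
    vanish. *)
Lemma psd_pivot (S : 'M[R]_l) t i : psd S ->
  if S i i == 0 then \sum_j S i j * t 0 j = 0
  else 0 < S i i /\ (\sum_j S i j * t 0 j) ^+ 2 / S i i <= qform S t.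
Proof.
move=> [sym pos]; set b := \sum_j _.
have H c : 0 <= qform S t - 2 * c * b + c ^+ 2 * S i i.
  by rewrite -qform_add_delta.
have a0 : 0 <= S i i.
  have := pos (delta_mx 0 i); rewrite /qform (bigD1 i)//= (bigD1 i)//= !mxE !eqxx mul1r mul1r.
  rewrite big1 ?addr0; last by move=> j /negPf ji; rewrite !mxE ji andbF mulr0 mul0r.
  rewrite big1 ?addr0// => j /negPf ji; rewrite big1// => k _.
  by rewrite !mxE ji andbF !mul0r.
case: eqVneq => [S0|Sn0].
  apply: contrapT => /eqP b0; have := H ((qform S t + 1) / (2 * b)).
  rewrite S0 mulr0 addr0 (_ : 2 * _ * b = qform S t + 1); last by field.
  by rewrite opprD addrA subrr add0r oppr_ge0 ler10.
have a1 : 0 < S i i by rewrite lt_neqAle eq_sym Sn0.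
split=> //; have := H (b / S i i).
rewrite (_ : _ - _ + _ = qform S t - b ^+ 2 / S i i); last by field.
by rewrite subr_ge0.
Qed.

(** Cholesky's algorithm: subtracting the product of the normalized pivot row with itself clears a
    row and, by [psd_pivot], leaves a positive semidefinite matrix. A zero pivot forces a zero
    row. *)
Lemma psd_decomposition (S : 'M[R]_l) : psd S ->
  exists s, forall i j, S i j = \sum_(v <- s) v 0 i * v 0 j.
Proof.
(* [n] counts the last rows that may still be non-zero; the pivot is the first of them. *)
suff H n : forall S : 'M[R]_l, psd S -> (forall i j : 'I_l, (i + n < l)%N -> S i j = 0) ->
    exists s, forall i j, S i j = \sum_(v <- s) v 0 i * v 0 j.
  by move=> pS; apply: (H l) => // i j; rewrite ltnNge leq_addl.
elim: n => [|n IH] {}S pS Z.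
  exists [::] => i j; rewrite big_nil; apply: Z; rewrite addn0; exact: ltn_ord.
have [sym pos] := pS.
have [ln|nl] := leqP l n.
  by apply: IH => // i j; rewrite ltnNge (leq_trans ln)// leq_addl.
have i0P : (l - n.+1 < l)%N by rewrite ltn_subrL (leq_ltn_trans _ nl).
pose i0 : 'I_l := Ordinal i0P.
have lt_i0 (i : 'I_l) : (i + n < l)%N -> (i < i0)%N \/ i = i0.
  move=> h; have : (i <= i0)%N by exact: leq_sub_succ.
  by rewrite leq_eqVlt => /orP[/eqP/val_inj|]; [right|left].
have zero_row (i j : 'I_l) : (i < i0)%N -> S i j = 0.
  by move=> h; apply: Z; exact: ltn_sub_succ.
have dd i j : \sum_k S i k * delta_mx (0 : 'I_1) j 0 k = S i j.
  rewrite (bigD1 j)//= mxE !eqxx mulr1 big1 ?addr0// => k /negPf kj.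
  by rewrite mxE kj andbF mulr0.
have [S0|Sn0] := eqVneq (S i0 i0) 0.
  apply: IH => // i j /lt_i0[|->]; first exact: zero_row.
  by have := psd_pivot (delta_mx 0 j) i0 pS; rewrite S0 eqxx dd.
have a0 : 0 < S i0 i0 by have := psd_pivot 0 i0 pS; rewrite (negPf Sn0) => -[].
pose r := Num.sqrt (S i0 i0).
have r0 : r != 0 by rewrite gt_eqF// sqrtr_gt0.
have r2 : r ^+ 2 = S i0 i0 by rewrite sqr_sqrtr// ltW.
pose v : 'rV[R]_l := \row_j (S i0 j / r).
pose S' : 'M[R]_l := \matrix_(i, j) (S i j - v 0 i * v 0 j).
have qv t : \sum_i \sum_j t 0 i * t 0 j * (v 0 i * v 0 j) = (\sum_j S i0 j * t 0 j) ^+ 2 / S i0 i0.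
  rewrite expr2 mulr_suml mulr_suml; apply: eq_bigr => i _.
  rewrite mulr_sumr mulr_suml; apply: eq_bigr => j _.
  by rewrite !mxE -r2; field.
have [] := IH S'.
- split=> [i j|t]; first by rewrite !mxE sym mulrC.
  have := psd_pivot t i0 pS; rewrite (negPf Sn0) => -[_].
  rewrite -qv -subr_ge0; congr (0 <= _).
  rewrite /qform -sumrB; apply: eq_bigr => i _; rewrite -sumrB; apply: eq_bigr => j _.
  by rewrite !mxE; ring.
- move=> i j /lt_i0[ii0|->].
    by rewrite !mxE zero_row// sym zero_row// !mul0r subr0.
  by rewrite !mxE -r2; field.
- move=> s Hs; exists (v :: s) => i j; rewrite big_cons -Hs !mxE; ring.
Qed.

Lemma qform_quad (S : 'M[R]_l) s t : (forall i j, S i j = \sum_(v <- s) v 0 i * v 0 j) ->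
  quad s t = qform S t.
Proof.
move=> HS; rewrite /quad /qform.
under [RHS]eq_bigr do under eq_bigr do rewrite HS mulr_sumr.
under [RHS]eq_bigr do rewrite exchange_big/=.
rewrite exchange_big/=; apply: eq_bigr => v _.
rewrite expr2 /dotp mulr_suml; apply: eq_bigr => i _; rewrite mulr_sumr.
by apply: eq_bigr => j _; ring.
Qed.

Lemma normal_law_char (v : R) : 0 <= v -> exists Q : probability (measurableTypeR R) R,
  [/\ forall A, measurable A -> Q A = normal_law 0 v A,
      L2 Q (fun x : R => x), Ex Q (fun x : R => x) = 0, Ex Q (fun x : R => x ^+ 2) = v
    & forall a th, Ex Q (fun x : R => cos (a * x + th)) = expR (- (a ^+ 2 * v / 2)) * cos th].
Proof.
move=> v0; have [->|vn0] := eqVneq v 0.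
  have m0 : measurable_fun setT (fun _ : measurableTypeR R => (0 : R) : measurableTypeR R) by exact: measurable_cst.
  have [Q [QA HQ]] := image_probability N m0.
  have Qcst (f : measurableTypeR R -> R) : measurable_fun setT f -> L1 Q f /\ Ex Q f = f 0.
    move=> mf; have [|L E] := HQ f mf; first exact: L1_cst.
    by split=> //; rewrite E; exact: Ex_cst.
  have mid : measurable_fun setT (fun x : measurableTypeR R => x : R) by exact: measurable_id.
  exists Q; split.
  - move=> A mA; rewrite QA// /normal_law eqxx diracE.
    have [A0|A0] := pselect (A 0).
      by rewrite (_ : _ @^-1` _ = setT) ?mem_set//; [exact: probability_setT|apply/seteqP; split].
    by rewrite (_ : _ @^-1` _ = set0) ?memNset ?measure0//; apply/seteqP; split.
  - by split=> //; apply: (Qcst _ _).1; exact: measurable_funX.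
  - by rewrite (Qcst _ _).2.
  - by rewrite (Qcst _ _).2 ?expr0n//; exact: measurable_funX.
  - move=> a th; rewrite (Qcst _ _).2 ?mulr0 ?add0r ?mul0r ?oppr0 ?expR0 ?mul1r//.
    apply: (@measurableT_comp _ _ _ _ _ _ (@cos R)); first exact: measurable_cos.
    by apply: measurable_funD => //; exact: measurable_funM.
have vp : 0 < v by rewrite lt_neqAle eq_sym vn0.
have s0 : 0 < Num.sqrt v by rewrite sqrtr_gt0.
exists (normal_prob 0 (Num.sqrt v)); split.
- by move=> A mA; rewrite /normal_law (negPf vn0).
- exact: normal_id_L2.
- exact: normal_mean.
- by rewrite normal_var// sqr_sqrtr.
- by move=> a th; rewrite normal_char// sqr_sqrtr.
Qed.

(** Every linear form has the characteristic function of a centred normal law of variance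
    [qform S t], so uniqueness on the line identifies its law. Covariances follow by polarization
    from the second moments of two coordinates and of their sum. *)
Theorem gaussian_exists (S : 'M[R]_l) : psd S -> exists nu : probability Rl R,
  [/\ gaussian_vector nu 0 S, row_L2 nu (fun y => y)
    & forall t th, Ex nu (fun y => cos (dotp t y + th)) = expR (- (qform S t / 2)) * cos th].
Proof.
move=> pS; have [s Hs] := psd_decomposition pS.
have [nu [Lnu Hnu]] := gaussian_sum s.
have cnu t th : Ex nu (fun y => cos (dotp t y + th)) = expR (- (qform S t / 2)) * cos th.
  by rewrite Hnu (qform_quad t Hs).
exists nu; split=> //.
have mdot t : measurable_fun setT (fun y : Rl => dotp t (y : 'rV[R]_l) : measurableTypeR R).
  exact: dotp_measurable.
have Ldot t : L2 nu (fun y : Rl => dotp t (y : 'rV[R]_l)).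
  by apply: L2_sum => i _; apply: L2_scale; exact: Lnu.
have law t : exists Q : probability (measurableTypeR R) R,
    [/\ forall A, measurable A -> Q A = normal_law 0 (qform S t) A,
        forall A, measurable A -> Q A = nu [set y : 'rV[R]_l | A (dotp t y)],
        Ex nu (fun y : Rl => dotp t (y : 'rV[R]_l)) = 0
      & Ex nu (fun y : Rl => dotp t (y : 'rV[R]_l) ^+ 2) = qform S t].
  have [Q [Qlaw LQ Q1 Q2 Qcos]] := normal_law_char (pS.2 t).
  have [Q' [Q'A HQ']] := image_probability nu (mdot t).
  have mid : measurable_fun setT (fun x : measurableTypeR R => x : R) by exact: measurable_id.
  have I1 := HQ' _ mid (L2_L1 (Ldot t)).
  have I2 := HQ' (fun x => x ^+ 2) (measurable_funX _ mid) (L2_sqr (Ldot t)).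
  have LQ' : L2 Q' (fun x : R => x) by split=> //; exact: I2.1.
  have QQ' A : measurable A -> Q A = Q' A.
    apply: char_eq_measure => // a th; rewrite Qcos.
    have mc : measurable_fun setT (fun x : measurableTypeR R => cos (a * x + th)).
      apply: (@measurableT_comp _ _ _ _ _ _ (@cos R)); first exact: measurable_cos.
      by apply: measurable_funD => //; exact: measurable_funM.
    have [|_ ->] := HQ' _ mc.
      apply: (@L1_bounded _ _ _ _ _ 1); last by move=> y; exact: cos_abs_le1.
      by apply: measurableT_comp => //; exact: mdot.
    have E : qform S (a *: t) = a ^+ 2 * qform S t.
      rewrite /qform mulr_sumr; apply: eq_bigr => i _; rewrite mulr_sumr; apply: eq_bigr => j _.
      by rewrite !mxE; ring.
    rewrite -E -cnu; congr Ex; apply/funext => y /=; congr (cos (_ + th)).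
    by rewrite /dotp mulr_sumr; apply: eq_bigr => i _; rewrite mxE mulrA.
  have EQQ' (f : measurableTypeR R -> R) : Ex Q f = Ex Q' f.
    by rewrite /Ex; congr fine; apply: eq_measure_integral => A mA _; exact: QQ'.
  exists Q; split=> //.
  - by move=> A mA; rewrite QQ'// Q'A.
  - by rewrite -[LHS]I1.2 -EQQ' Q1.
  - by rewrite -[LHS]I2.2 -EQQ' Q2.
have e i y : dotp (delta_mx 0 i) y = (y : 'rV[R]_l) 0 i.
  rewrite /dotp (bigD1 i)//= mxE !eqxx mul1r big1 ?addr0// => j /negPf ji.
  by rewrite mxE ji andbF mul0r.
split.
- move=> t; exists 0, (qform S t); split; first exact: pS.2.
  by move=> B mB; have [Q [Q1 Q2 _ _]] := law t; rewrite -Q1// Q2.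
- move=> i; rewrite mxE (_ : (fun y => _) = fun y : Rl => (dotp (delta_mx 0 i) y)%:E); last first.
    by apply/funext => y; rewrite e.
  by have [Q [_ _ E _]] := law (delta_mx 0 i); rewrite ExE ?E//; exact: L2_L1.
- move=> i j.
  have Lij : L1 nu (fun y : Rl => (y : 'rV[R]_l) 0 i * (y : 'rV[R]_l) 0 j) by exact: L2_mul.
  under eq_integral do rewrite !mxE !subr0.
  rewrite ExE//; congr EFin.
  have qe k : qform S (delta_mx 0 k) = S k k.
    have := qform_add_delta 0 k (-1) pS.1; rewrite sub0r scaleN1r opprK => ->.
    rewrite /qform big1; last by move=> a _; rewrite big1// => b _; rewrite mxE !mul0r.
    by rewrite big1; [ring|move=> a _; rewrite mxE mulr0].
  have qe2 : qform S (delta_mx 0 i + delta_mx 0 j) = S i i + 2 * S i j + S j j.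
    have := qform_add_delta (delta_mx 0 i) j (-1) pS.1; rewrite scaleN1r opprK => ->.
    rewrite qe (bigD1 i)//= mxE !eqxx mulr1 big1 ?addr0; last first.
      by move=> k /negPf ki; rewrite mxE ki andbF mulr0.
    by rewrite (pS.1 j i); ring.
  have [_ [_ _ _ Ei]] := law (delta_mx 0 i); have [_ [_ _ _ Ej]] := law (delta_mx 0 j).
  have [_ [_ _ _ Eij]] := law (delta_mx 0 i + delta_mx 0 j).
  rewrite qe in Ei; rewrite qe in Ej; rewrite qe2 in Eij.
  have Li := L2_sqr (Ldot (delta_mx 0 i)); have Lj := L2_sqr (Ldot (delta_mx 0 j)).
  have Lm := L2_mul (Ldot (delta_mx 0 i)) (Ldot (delta_mx 0 j)).
  have := Eij.
  rewrite (_ : (fun y => _) = fun y : Rl => dotp (delta_mx 0 i) y ^+ 2 +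
    2 * (dotp (delta_mx 0 i) y * dotp (delta_mx 0 j) y) + dotp (delta_mx 0 j) y ^+ 2); last first.
    by apply/funext => y; rewrite dotpD; ring.
  rewrite Ex_add//; last by apply: L1_add => //; exact: L1_scale.
  rewrite Ex_add//; last exact: L1_scale.
  rewrite Ex_scale// Ei Ej => /addIr /addrI /mulfI -/(_ _)/=.
  rewrite (_ : (fun y => _) = fun y : Rl => (y : 'rV[R]_l) 0 i * (y : 'rV[R]_l) 0 j); last first.
    by apply/funext => y; rewrite !e.
  by apply; rewrite pnatr_eq0.
Qed.

End GaussianExistence.

(** * Stationary marked point processes *)

Section Process.
Context {disp : measure_display} {Omega : measurableType disp} {R : realType}
  (P : probability Omega R) {d : nat} {M : ptopologicalType}.
Local Notation Rd := (borel 'rV[R]_d).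
Local Notation S := (Rd * borel M)%type.
Variable X : R.-ker Omega ~> S.

(** The generator of [evaluation_salgebra], named so as to turn the space of set functions into a
    measurable type [ES]. *)
Definition evaluations : set_system (set S -> \bar R) :=
  \bigcup_(A in (measurable : set (set S)))
    preimage_set_system setT (fun N : set S -> \bar R => N A) measurable.

Local Notation ES := (g_sigma_algebraType evaluations).

Lemma measurable_evaluation (A : set S) : measurable A ->
  measurable_fun setT (fun N : ES => (N : set S -> \bar R) A).
Proof.
move=> mA _ B mB; apply: sub_sigma_algebra; exists A => //.
by exists B.
Qed.

Lemma measurable_to_evaluations {disp'} {T : measurableType disp'} (Phi : T -> set S -> \bar R) :
  (forall A, measurable A -> measurable_fun setT (fun w => Phi w A)) ->
  measurable_fun setT (Phi : T -> ES).
Proof.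
move=> mPhi; apply: (@measurability _ _ T ES setT Phi evaluations) => //.
move=> _ [_ [A mA] [B mB <-] <-]; rewrite !setTI.
by rewrite -[X in measurable X]setTI; exact: mPhi.
Qed.

Lemma translate_measurable (z : 'rV[R]_d) : measurable_fun setT (@translate R d M z).
Proof.
apply: measurable_fun_pair; last exact: measurable_snd.
apply: (@row_measurable R d _ S (fun p : S => (p.1 : 'rV[R]_d) - z)) => i.
under eq_fun do rewrite mxE.
apply: measurable_funD; last exact: measurable_cst.
apply: (@measurableT_comp _ _ _ _ _ _ (fun y : Rd => (y : 'rV[R]_d) 0 i)).
  exact: coord_measurable.
exact: measurable_fst.
Qed.

Definition shifted (z : 'rV[R]_d) (w : Omega) : set S -> \bar R :=
  pushforward (X w) (translate z).

Lemma shifted_measurable z (A : set S) : measurable A ->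
  measurable_fun setT (fun w => shifted z w A).
Proof.
move=> mA; apply: measurable_kernel; rewrite -[X in measurable X]setTI.
exact: translate_measurable.
Qed.

Lemma shifted_evaluations z : measurable_fun setT (shifted z : Omega -> ES).
Proof. by apply: measurable_to_evaluations => A; exact: shifted_measurable. Qed.

Hypothesis hstat : stationary P X.

(** Stationarity says that the process and its translate have the same image law on [ES]; both
    expectations are integrals of [f] against that law. *)
Lemma stationary_Ex (z : 'rV[R]_d) (f : ES -> R) : measurable_fun setT f ->
  L1 P (fun w => f (X w : set S -> \bar R)) ->
  L1 P (fun w => f (shifted z w)) /\
  Ex P (fun w => f (shifted z w)) = Ex P (fun w => f (X w : set S -> \bar R)).
Proof.
have mX : measurable_fun setT ((fun w => X w : set S -> \bar R) : Omega -> ES).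
  by apply: measurable_to_evaluations => A mA; exact: measurable_kernel.
move=> mf Lf.
have [Q [QA HQ]] := image_probability P mX.
have [Q' [QA' HQ']] := image_probability P (shifted_evaluations z).
have QQ' A : measurable A -> Q A = Q' A.
  by move=> mA; rewrite QA// QA'//; symmetry; exact: hstat.
have [LQ EQ] := HQ f mf Lf.
have mEf : measurable_fun setT (EFin \o f) by exact/measurable_EFinP.
have L : L1 P (fun w => f (shifted z w)).
  have LQ' : L1 Q' f.
    apply/integrableP; split=> //; have /integrableP[_] := LQ.
    by rewrite (eq_measure_integral Q')// => A mA _; exact: QQ'.
  pose Xm : {mfun Omega >-> ES} := HB.pack (shifted z : Omega -> ES)
    (isMeasurableFun.Build _ _ _ _ (shifted z : Omega -> ES) (shifted_evaluations z)).
  apply/integrableP; split.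
    by apply: (measurableT_comp mEf); exact: shifted_evaluations.
  have := @ge0_integral_distribution _ _ _ _ _ P Xm (fun N => `|(f N)%:E|%E).
  move=> /(_ _ _)/=; rewrite /comp/= => <-//.
  have /integrableP[_] := LQ'.
  rewrite (eq_measure_integral (distribution P Xm))// => A mA _; move: (QA' A mA).  by [].
  by apply/measurable_EFinP; exact: measurableT_comp.
split=> //; have [_ EQ'] := HQ' f mf L.
rewrite -[LHS]EQ' -[RHS]EQ /Ex; congr fine; apply: eq_measure_integral => A mA _.
by move: (QQ' A mA).
Qed.

(* The translation by [z] is put on the process and not on the region: stationarity then
   reduces mixing around [z] to mixing around the origin. *)
Definition region_salgebra (z : 'rV[R]_d) (B : set Rd) : set_system Omega :=
  preimage_set_system setT (fun w => (fun A => shifted z w (A `&` (B `*` setT))))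
    (@evaluation_salgebra _ S R).

Lemma region_salgebra_sigma z B : sigma_algebra setT (region_salgebra z B).
Proof. exact: sigma_algebra_preimage (smallest_sigma_algebra _ _). Qed.

Lemma region_salgebra_gen z B : <<s region_salgebra z B>> = region_salgebra z B.
Proof. exact: sigma_algebra_id (region_salgebra_sigma _ _). Qed.

Lemma region_sub_salgebra z (B : set Rd) : measurable B -> sub_salgebra (region_salgebra z B).
Proof.
move=> mB _ [E mE <-].
have : measurable_fun setT ((fun w A => shifted z w (A `&` (B `*` setT))) : Omega -> ES).
  apply: measurable_to_evaluations => A mA; apply: shifted_measurable.
  by apply: measurableI => //; exact: measurableX.
by apply.
Qed.

Lemma region_meas_for z (B : set Rd) (f : ES -> R) (g : Omega -> R) : measurable B ->
  measurable_fun setT f ->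
  (forall w, g w = f (fun A => shifted z w (A `&` (B `*` setT)))) ->
  meas_for (region_salgebra z B) g.
Proof.
move=> mB mf gf; rewrite /meas_for => _ C mC; rewrite setTI.
apply: sub_sigma_algebra; exists (f @^-1` C).
  by rewrite -[X in evaluation_salgebra X]setTI; exact: mf.
by rewrite setTI; apply/seteqP; split => w /=; rewrite gf.
Qed.

(** Each event and its complement form an admissible partition. The terms of [A] with [B] and of [A]
    with the complement of [B] are equal in absolute value, and the factor one half compensates
    their sum. Blocks of a partition are non-empty, whence the four trivial cases treated apart. *)
Lemma beta_coeff_alpha (F G : set_system Omega) A B (b : R) :
  sigma_algebra setT F -> sigma_algebra setT G -> sub_salgebra F -> sub_salgebra G ->
  (beta_coeff P F G <= b%:E)%E -> 0 <= b -> F A -> G B ->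
  `|fine (P (A `&` B)) - fine (P A) * fine (P B)| <= b.
Proof.
move=> [F0 FC _] [G0 GC _] sF sG Fb b0 FA GB.
have [mA mB] := (sF _ FA, sG _ GB).
have fP C : measurable C -> P C = (fine (P C))%:E by move=> mC; rewrite fineK ?fin_num_measure.
have [PA PB PAB] := And3 (fP _ mA) (fP _ mB) (fP _ (measurableI _ _ mA mB)).
have [A0|/set0P A0] := eqVneq A set0.
  by rewrite A0 set0I measure0 mul0r subrr normr0.
have [B0|/set0P B0] := eqVneq B set0.
  by rewrite B0 setI0 measure0 mulr0 subrr normr0.
have [A1|/set0P A1] := eqVneq (~` A) set0.
  rewrite -[A]setCK A1 setC0 setTI (@probability_setT _ _ _ P) mul1r subrr normr0//.
have [B1|/set0P B1] := eqVneq (~` B) set0.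
  rewrite -[B]setCK B1 setC0 setIT (@probability_setT _ _ _ P) mulr1 subrr normr0//.
pose bl (C : set Omega) (i : 'I_2) : set Omega := if i == 0 then C else ~` C.
have part C : C !=set0 -> ~` C !=set0 -> partition setT (bl C) setT.
  move=> C0 C1; split.
  - apply/seteqP; split=> // w _; have [Cw|Cw] := pselect (C w).
      by exists 0 => //; rewrite /bl eqxx.
    by exists 1.
  - apply/trivIsetP => i j _ _; case: (i =P 0) => [->|/eqP i0]; case: (j =P 0) => [->|/eqP j0] //.
    + by rewrite /bl eqxx (negPf j0) setICr.
    + by rewrite /bl eqxx (negPf i0) setICl.
    + move=> /eqP[]; apply/val_inj => /=; move: i0 j0; rewrite -!val_eqE/=.
      by case: i => -[|[|]]//; case: j => -[|[|]].
  - by move=> i _; rewrite /bl; case: eqP.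
set c := `|_|; have c0 : 0 <= c by exact: normr_ge0.
have H : ((c + c)%:E <= ereal_sup [set s | exists m n : nat,
     exists (A : 'I_m -> set Omega) (B : 'I_n -> set Omega),
     [/\ partition setT A setT /\ (forall i, F (A i)),
         partition setT B setT /\ (forall j, G (B j))
       & s = \sum_(i < m) \sum_(j < n)
               `| P (A i `&` B j) - P (A i) * P (B j) | ] ])%E.
  apply: le_trans; last first.
    apply: ereal_sup_ubound; exists 2, 2, (bl A), (bl B); split=> //.
      split; first exact: part.
      by move=> i; rewrite /bl; case: eqP => // _; rewrite -setTD; exact: FC.
    split; first exact: part.
    by move=> i; rewrite /bl; case: eqP => // _; rewrite -setTD; exact: GC.
  rewrite !big_ord_recl !big_ord0 /= !adde0.
  apply: (@le_trans _ _ (`|P (A `&` B) - P A * P B| + `|P (A `&` ~` B) - P A * P (~` B)|)%E).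
    have -> : P (A `&` ~` B) = (fine (P A) - fine (P (A `&` B)))%:E.
      rewrite -setDE measureD//; last by rewrite ltey_eq fin_num_measure.
      by rewrite EFinB -PA -PAB.
    have -> : P (~` B) = (1 - fine (P B))%:E by rewrite probability_setC// PB.
    rewrite PA PB PAB /=.
    rewrite -EFinD lee_fin /c.
    rewrite lerD2l -normrN le_eqVlt; apply/orP; left; apply/eqP; congr `|_|; ring.
  rewrite -[leLHS]adde0; apply: leeD => //.
  by apply: adde_ge0; exact: abse_ge0.
have : (2^-1%:E * (c + c)%:E <= b%:E)%E.
  by apply: le_trans Fb; apply: lee_pmul => //; rewrite lee_fin addr_ge0.
by rewrite -EFinM lee_fin -mulr2n -(mulr_natl c) mulrA mulVf ?mul1r.
Qed.

Lemma box_measurable (I : 'I_d -> set R) : (forall i, measurable (I i)) ->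
  measurable ([set x : 'rV[R]_d | forall i, I i (x 0 i)] : set Rd).
Proof.
move=> mI; rewrite (_ : mkset _ = \bigcap_(i in [set: 'I_d])
    ((fun y : Rd => (y : 'rV[R]_d) 0 i) @^-1` I i)); last first.
  by apply/seteqP; split=> x /= H i; [move=> _|]; exact: H.
apply: fin_bigcap_measurable => // i _; rewrite -[X in measurable X]setTI.
exact: coord_measurable.
Qed.

Lemma cube_measurable a : measurable (cube a : set Rd).
Proof.
rewrite (_ : cube a = [set x | forall i, `[- a, a]%classic (x 0 i)]).
  by apply: (@box_measurable (fun=> `[- a, a]%classic)) => i; exact: measurable_itv.
by apply/seteqP; split=> x H i; have := H i; rewrite /= in_itv.
Qed.

(** An event observed around [z] has the same description, for the translated process, as an event
    observed around the origin; stationarity carries the three probabilities to the origin, where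
    [a <= b] gives the rate [bs b]. *)
Lemma region_mixing z (a b : R) bs bss : mixing_rates P X bs bss -> 2^-1 <= a -> a <= b ->
  dependence_le P (region_salgebra z (cube a)) (region_salgebra z (~` cube (a + b))) (bs b).
Proof.
move=> [bs0 _ Hbs _] a2 ab A B.
have eX (K : set Rd) (E : set (set S -> \bar R)) : measurable K -> evaluation_salgebra E ->
    evaluation_salgebra [set N : set S -> \bar R | E (fun A => N (A `&` (K `*` setT)))].
  move=> mK mE.
  have : measurable_fun setT ((fun (N : ES) (A : set S) => (N : set S -> \bar R) (A `&` (K `*` setT))) : ES -> ES).
    apply: measurable_to_evaluations => C mC; apply: measurable_evaluation.
    by apply: measurableI => //; exact: measurableX.
  by move=> /(_ measurableT E mE); rewrite setTI.
have mK := cube_measurable a; have mK' : measurable (~` cube (a + b) : set Rd).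
  by apply: measurableC; exact: cube_measurable.
rewrite !region_salgebra_gen => -[E1 mE1 <-] [E2 mE2 <-]; rewrite !setTI.
have m1 := eX _ _ mK mE1; have m2 := eX _ _ mK' mE2.
have h1 := hstat z m1; have h2 := hstat z m2.
have := hstat z (@measurableI _ ES _ _ m1 m2).
rewrite /preimage/= -/(shifted z) => h12.
rewrite [X in fine X - _]h12 [X in fine X * _]h1 [X in _ * fine X]h2.
have sR (K : set Rd) : measurable K -> sub_salgebra (restricted_salgebra X K).
  move=> mC _ [E mE <-].
  have : measurable_fun setT ((fun w A => X w (A `&` (K `*` setT))) : Omega -> ES).
    apply: measurable_to_evaluations => C mC'; apply: measurable_kernel.
    by apply: measurableI => //; exact: measurableX.
  by apply.
have b0 : 0 <= bs b by apply: bs0.1; exact: le_trans ab.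
apply: (@beta_coeff_alpha (restricted_salgebra X (cube a)) (restricted_salgebra X (~` cube (a + b)))) => //.
- exact: sigma_algebra_preimage (smallest_sigma_algebra _ _).
- exact: sigma_algebra_preimage (smallest_sigma_algebra _ _).
- exact: sR.
- exact: sR.
- exact: Hbs.
- by exists E1 => //; rewrite setTI.
- by exists E2 => //; rewrite setTI.
Qed.

End Process.

(** * The grid of half-open cells *)

Section Grid.
Context {R : realType} {d : nat}.
Implicit Types (o q : 'rV[R]_d) (h : R).

Definition cell q h : set 'rV[R]_d := [set x | forall j, q 0 j <= x 0 j < q 0 j + h].

Definition corner L o h (i : {ffun 'I_d -> 'I_L}) : 'rV[R]_d :=
  \row_j (o 0 j + h * (i j)%:R).

Lemma cell_halfopen : cell 0 1 = halfopen_unit_cube.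
Proof.
by apply/seteqP; split=> x H j; have := H j; rewrite mxE add0r.
Qed.

Lemma cell_measurable q h : measurable (cell q h : set (borel 'rV[R]_d)).
Proof.
rewrite (_ : cell q h = [set x | forall j, `[q 0 j, q 0 j + h[%classic (x 0 j)]).
  by apply: (@box_measurable _ _ (fun j => `[q 0 j, q 0 j + h[%classic)) => i; exact: measurable_itv.
by apply/seteqP; split=> x H i; have := H i; rewrite /= in_itv.
Qed.

Lemma bounded_coord (B : set 'rV[R]_d) r : (forall x, B x -> forall j, `|x 0 j| <= r) -> bounded_set B.
Proof.
move=> H; exists (Num.max r 0); split; first exact: num_real.
move=> s; rewrite gt_max => /andP[rs s0] x Bx.
rewrite /= [X in X <= _]/Num.Def.normr/= mx_normrE; apply: bigmax_le => [|[a j] _]; first exact: ltW.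
by rewrite ord1 (le_trans (H _ Bx _))// ltW.
Qed.

Lemma coord_le_norm (x : 'rV[R]_d) j : `|x 0 j| <= `|x|.
Proof. by rewrite [leRHS]/Num.Def.normr /= mx_normrE; apply/bigmax_geP; right => /=; exists (0, j). Qed.

Lemma cell_bounded q h : bounded_set (cell q h).
Proof.
apply: (@bounded_coord _ (`|q| + `|h|)) => x H j; have /andP[h1 h2] := H j.
have q0 := coord_le_norm q j; have hh := ler_norm h.
have [q1 q2] : - `|q| <= q 0 j /\ q 0 j <= `|q| by move: q0; rewrite ler_norml => /andP.
rewrite ler_norml; apply/andP; split.
  by rewrite (le_trans _ h1)// (le_trans _ q1)// lerN2 lerDl.
by rewrite (le_trans (ltW h2))// lerD.
Qed.

Lemma cell_shift q h v : (fun x => x - v) @^-1` cell q h = cell (q + v) h.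
Proof.
apply/seteqP; split=> x H j; have := H j; rewrite !mxE.
  by rewrite lerBrDr ltrBlDr addrAC.
by rewrite lerBrDr ltrBlDr [q 0 j + _ + _]addrAC.
Qed.

Lemma cell_corner L o h (i : {ffun 'I_d -> 'I_L}) j (x : 'rV[R]_d) : 0 < h ->
  cell (corner o h i) h x -> (i j)%:R <= (x 0 j - o 0 j) / h < (i j).+1%:R.
Proof.
move=> h0 /(_ j); rewrite mxE => /andP[h1 h2]; rewrite ler_pdivlMr// ltr_pdivrMr//.
by rewrite lerBrDl mulrC h1 -natr1 mulrDl mul1r ltrBlDl addrA [_ * h]mulrC.
Qed.

Lemma cell_trivIset L o h : 0 < h ->
  trivIset setT (fun i : {ffun 'I_d -> 'I_L} => cell (corner o h i) h).
Proof.
move=> h0 i i' _ _ [x [Hi Hi']]; apply/ffunP => j; apply/val_inj/eqP => /=.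
have /andP[a1 a2] := cell_corner j h0 Hi; have /andP[b1 b2] := cell_corner j h0 Hi'.
have := le_lt_trans a1 b2; have := le_lt_trans b1 a2.
by rewrite !ltr_nat !ltnS eqn_leq => -> ->.
Qed.

Lemma cell_cover L o h (x : 'rV[R]_d) : 0 < h -> (forall j, 0 <= x 0 j - o 0 j < h * L%:R) ->
  exists i : {ffun 'I_d -> 'I_L}, cell (corner o h i) h x.
Proof.
move=> h0 H; have n0 j : 0 <= (x 0 j - o 0 j) / h.
  by have /andP[a _] := H j; rewrite divr_ge0// ltW.
have nL j : (Num.truncn ((x 0%R j - o 0%R j) / h)%R < L)%N.
  have /andP[_ b] := H j; rewrite -(ltr_nat R); apply: le_lt_trans (_ : (x 0 j - o 0 j) / h < _).
    by have /andP[] := truncn_itv (n0 j).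
  by rewrite ltr_pdivrMr// mulrC.
exists [ffun j => Ordinal (nL j)] => j; rewrite mxE ffunE /=.
have /andP[a b] := truncn_itv (n0 j); rewrite ler_pdivlMr// in a; rewrite ltr_pdivrMr// in b.
rewrite -lerBrDl mulrC a -addrA -ltrBlDl.
by move: b; rewrite -natr1 mulrDl mul1r mulrC.
Qed.

Lemma cell_tiling L o h : 0 < h ->
  cell o (h * L%:R) = \bigcup_(i in [set: {ffun 'I_d -> 'I_L}]) cell (corner o h i) h.
Proof.
move=> h0; apply/seteqP; split=> x.
  move=> H; have [j|i Hi] := @cell_cover L o h x h0; last by exists i.
  by have := H j; rewrite subr_ge0 ltrBlDl.
move=> [i _ Hi] j; have := Hi j; rewrite mxE => /andP[a b]; apply/andP; split.
  by rewrite (le_trans _ a)// lerDl mulr_ge0// ltW.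
rewrite (lt_le_trans b)// -addrA lerD2l -{2}[h]mulr1 -mulrDr ler_pM2l//.
by rewrite natr1 ler_nat.
Qed.

End Grid.

(** * Scores of regions *)

Section Score.
Context {disp : measure_display} {Omega : measurableType disp} {R : realType}
  (P : probability Omega R) {d : nat} {M : ptopologicalType}.
Local Notation Rd := (borel 'rV[R]_d).
Local Notation S := (Rd * borel M)%type.
Variable X : R.-ker Omega ~> S.
Hypothesis Xfin : forall w (B : set Rd), measurable B -> bounded_set (B : set 'rV[R]_d) ->
  (X w (B `*` setT) < +oo)%E.
Variables (l : nat) (C : 'I_l -> set (borel M)).
Hypothesis mC : forall i, measurable (C i).
Variable pm : 'I_l -> R.

Local Notation ES := (g_sigma_algebraType (@evaluations R d M)).

(** Defined for an arbitrary set function [N], so as to be a functional on [ES] that applies alike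
    to the process, its translates and its restrictions. [t] is the direction of a linear form of
    the fluctuation vector. *)
Definition score (t : 'rV[R]_l) (N : set S -> \bar R) (A : set Rd) : R :=
  \sum_i t 0 i * (fine (N (A `*` C i)) - pm i * fine (N (A `*` setT))).

Lemma fine_evaluation (A : set S) : measurable A ->
  measurable_fun setT (fun N : ES => fine ((N : set S -> \bar R) A)).
Proof.
move=> mA; apply: (@measurableT_comp _ _ _ _ _ _ fine); first exact: fine_measurable.
exact: measurable_evaluation.
Qed.

Lemma score_measurable t (A : set Rd) : measurable A ->
  measurable_fun setT (fun N : ES => score t N A).
Proof.
move=> mA; apply: measurable_sum_cond => i _; apply: measurable_funM => //.
apply: measurable_funB; first by apply: fine_evaluation; exact: measurableX.
by apply: measurable_funM => //; apply: fine_evaluation; exact: measurableX.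
Qed.

Lemma score_shift t z w (A : set Rd) :
  score t (shifted X z w) A = score t (X w : set S -> \bar R) ((fun x => x - z) @^-1` A).
Proof. by []. Qed.

(** Serves to place the score of [A] in the sigma-algebra of any region that contains [A]. *)
Lemma score_restrict t (N : set S -> \bar R) (A B : set Rd) : A `<=` B ->
  score t (fun D => N (D `&` (B `*` setT))) A = score t N A.
Proof.
move=> AB; have E (D : set (borel M)) : (A `*` D) `&` (B `*` setT) = A `*` D.
  by apply/seteqP; split=> [[x m] [[]]|[x m] [/= Ax Dm]] //=; split=> //; split=> //; exact: AB.
by apply: eq_bigr => i _; rewrite !E.
Qed.

Definition score_bound (t : 'rV[R]_l) : R := \sum_i `|t 0 i| * (1 + `|pm i|).

Lemma score_bound_ge0 t : 0 <= score_bound t.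
Proof. by apply: sumr_ge0 => i _; rewrite mulr_ge0// addr_ge0. Qed.

Definition count w (A : set Rd) : R := fine (X w (A `*` setT)).

Lemma count_ge0 w A : 0 <= count w A.
Proof. exact: fine_ge0. Qed.

Lemma bounded_set_sub (A B : set 'rV[R]_d) : A `<=` B -> bounded_set B -> bounded_set A.
Proof.
move=> AB [r [rr H]]; exists r; split=> // s rs x Ax; apply: H => //; exact: AB.
Qed.

Lemma mark_fin w (A : set Rd) (D : set (borel M)) : measurable A -> measurable D ->
  bounded_set (A : set 'rV[R]_d) -> X w (A `*` D) \is a fin_num.
Proof.
move=> mA mD bA; rewrite ge0_fin_numE//; apply: le_lt_trans (Xfin w mA bA).
by apply: le_measure; rewrite ?inE; [exact: measurableX..|move=> [x m] []].
Qed.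

Lemma count_le w (A B : set Rd) : measurable A -> measurable B -> bounded_set (B : set 'rV[R]_d) ->
  A `<=` B -> count w A <= count w B.
Proof.
move=> mA mB bB AB; apply: fine_le.
- by apply: mark_fin => //; exact: bounded_set_sub bB.
- exact: mark_fin.
- by apply: le_measure; rewrite ?inE; [exact: measurableX..|move=> [x m] [/AB]].
Qed.

Lemma score_le t w (A : set Rd) : measurable A -> bounded_set (A : set 'rV[R]_d) ->
  `|score t (X w : set S -> \bar R) A| <= score_bound t * count w A.
Proof.
move=> mA bA; rewrite mulr_suml; apply: le_trans (ler_norm_sum _ _ _) _.
apply: ler_sum => i _; rewrite normrM -mulrA ler_wpM2l//.
apply: le_trans (ler_normB _ _) _; rewrite normrM mulrDl mul1r.
rewrite (ger0_norm (count_ge0 w A)) lerD2r ger0_norm ?fine_ge0//.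
apply: fine_le; [exact: mark_fin..|].
by apply: le_measure; rewrite ?inE; [exact: measurableX..|move=> [x m] []].
Qed.

Lemma mark_bigcup (I : finType) (Q : {pred I}) (A : I -> set Rd) (D : set (borel M)) w :
  trivIset setT A -> (forall i, measurable (A i)) -> measurable D ->
  (forall i, bounded_set (A i : set 'rV[R]_d)) ->
  fine (X w ((\bigcup_(i in [set` Q]) A i) `*` D)) = \sum_(i in Q) fine (X w (A i `*` D)).
Proof.
move=> tA mA mD bA.
rewrite (_ : _ `*` _ = \bigcup_(i in [set` Q]) (A i `*` D)); last first.
  apply/seteqP; split=> [[x m] [/= [i Qi Ai] Dm]|[x m] [i Qi [Ai Dm]]]; first by exists i.
  by split=> //; exists i.
rewrite measure_fin_bigcup//; first last.
- by move=> i _; exact: measurableX.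
- by move=> i j _ _ [[x m] [[Ai _] [Aj _]]]; apply: tA => //; exists x.
rewrite -(@bigfs _ _ _ _ (index_enum I))//; first by rewrite sum_fine// => i _; exact: mark_fin.
- exact: index_enum_uniq.
- by move=> i _; rewrite mem_index_enum.
Qed.

Lemma score_bigcup t (I : finType) (Q : {pred I}) (A : I -> set Rd) w :
  trivIset setT A -> (forall i, measurable (A i)) ->
  (forall i, bounded_set (A i : set 'rV[R]_d)) ->
  score t (X w : set S -> \bar R) (\bigcup_(i in [set` Q]) A i) =
  \sum_(i in Q) score t (X w : set S -> \bar R) (A i).
Proof.
move=> tA mA bA; rewrite exchange_big/=; apply: eq_bigr => i _.
by rewrite !mark_bigcup// mulr_sumr -sumrB mulr_sumr.
Qed.

End Score.

(** On natural numbers [a - b + (b - a)] is the absolute difference, one of the truncated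
    differences being 0. *)
Lemma absd_tri a b c : (a - c + (c - a) <= (a - b + (b - a)) + (b - c + (c - b)))%N.
Proof. lia. Qed.

Lemma absd_window_lt a b r : (b - a + (a - b) <= r)%N -> (a + r - b < r.*2.+1)%N.
Proof. lia. Qed.

Lemma absd_window_inj a a' b r : (b - a + (a - b) <= r)%N -> (b - a' + (a' - b) <= r)%N ->
  (a + r - b = a' + r - b)%N -> a = a'.
Proof. lia. Qed.

Lemma absd_le a b m : (a - b + (b - a) <= m)%N -> (a <= b + m)%N /\ (b <= a + m)%N.
Proof. lia. Qed.

Lemma absd_ge a b m : (m <= a - b + (b - a))%N -> (0 < m)%N -> (b + m <= a)%N \/ (a + m <= b)%N.
Proof. lia. Qed.

Section GridDistance.
Variables d L : nat.
Implicit Types i j k : {ffun 'I_d -> 'I_L}.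

Definition grid_dist i j := (\max_a (i a - j a + (j a - i a)))%N.

Lemma grid_dist_leP i j m :
  reflect (forall a, (i a - j a + (j a - i a) <= m)%N) (grid_dist i j <= m)%N.
Proof. by apply: (iffP (bigmax_leqP _ _ _)) => H a //; exact: H. Qed.

Lemma grid_dist0 i : grid_dist i i = 0%N.
Proof. by apply/eqP; rewrite -leqn0; apply/grid_dist_leP => a; rewrite subnn. Qed.

Lemma grid_dist_sym i j : grid_dist i j = grid_dist j i.
Proof. by apply: eq_bigr => a _; rewrite addnC. Qed.

Lemma grid_dist_tri i j k : (grid_dist i k <= grid_dist i j + grid_dist j k)%N.
Proof.
apply/grid_dist_leP => a; apply: leq_trans (absd_tri _ (j a) _) _.
by apply: leq_add; apply: (leq_bigmax a).
Qed.

(** A ball for the sup distance is a product of intervals of at most [2 r + 1] integers. *)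
Lemma grid_ball i r : (#|[pred j | grid_dist i j <= r]| <= (r.*2.+1) ^ d)%N.
Proof.
pose G (a : 'I_d) := [pred b : 'I_L | i a - b + (b - i a) <= r]%N.
have -> : #|[pred j | (grid_dist i j <= r)%N]| = #|family G|.
  apply: eq_card => j; rewrite !inE; apply/grid_dist_leP/familyP => H a; exact: H.
rewrite card_family foldrE big_map big_enum/=.
rewrite -[in leqRHS](card_ord d) -prod_nat_const; apply: leq_prod => a _.
pose f (b : 'I_L) : 'I_(r.*2.+1) := inord (b + r - i a).
have fi : {in G a &, injective f}.
  move=> b b'; rewrite !inE => hb hb' /(congr1 val); rewrite /= !inordK ?absd_window_lt//.
  by move=> /(absd_window_inj hb hb') /val_inj.
by rewrite -(card_in_image fi) (leq_trans (max_card _))// card_ord.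
Qed.

Lemma grid_dist_ge i j m : (m <= grid_dist i j)%N -> (0 < m)%N ->
  exists a, (j a + m <= i a)%N \/ (i a + m <= j a)%N.
Proof.
move=> mD m0; apply: contrapT => H.
suff : (grid_dist i j <= m.-1)%N by rewrite -ltnS prednK// ltnNge mD.
apply/grid_dist_leP => a; rewrite -ltnS prednK// ltnNge; apply/negP => h; apply: H.
by exists a; exact: absd_ge.
Qed.

End GridDistance.

(** * Moments and means of scores *)

Section Scores.
Context {disp : measure_display} {Omega : measurableType disp} {R : realType}
  (P : probability Omega R) {d : nat} {M : ptopologicalType}.
Local Notation Rd := (borel 'rV[R]_d).
Local Notation S := (Rd * borel M)%type.
Variable X : R.-ker Omega ~> S.
Hypothesis Xfin : forall w (B : set Rd), measurable B -> bounded_set (B : set 'rV[R]_d) ->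
  (X w (B `*` setT) < +oo)%E.
Hypothesis hstat : stationary P X.
Hypothesis hint : (0 < intensity P X < +oo)%E.
Variables (l : nat) (C : 'I_l -> set (borel M)).
Hypothesis mC : forall i, measurable (C i).
Variable p : R.
Hypothesis p2 : 2 < p.
Hypothesis moment_cube :
  (\int[P]_w (X w ((closed_unit_cube : set Rd) `*` setT) `^ p) < +oo)%E.

Local Notation ES := (g_sigma_algebraType (@evaluations R d M)).
Local Notation pm := (fun i => palm_mark P X (C i)).
Local Notation sc := (score C pm).

Definition cube_moment : R := Ex P (fun w => `|count X w (closed_unit_cube : set Rd)| `^ p).

Lemma closed_cube_measurable : measurable (closed_unit_cube : set Rd).
Proof.
rewrite (_ : closed_unit_cube = [set x | forall j, `[(0 : R), 1]%classic (x 0 j)]).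
  by apply: (@box_measurable _ _ (fun=> `[(0 : R), 1]%classic)) => i; exact: measurable_itv.
by apply/seteqP; split=> x H i; have := H i; rewrite /= in_itv.
Qed.

Lemma closed_cube_bounded : bounded_set (closed_unit_cube : set 'rV[R]_d).
Proof. by apply: (@bounded_coord _ _ _ 1) => x H j; have /andP[a b] := H j; rewrite ger0_norm. Qed.

Lemma shift_measurable v (A : set Rd) : measurable A ->
  measurable ((fun x : 'rV[R]_d => x - v) @^-1` A : set Rd).
Proof.
move=> mA; rewrite -[X in measurable X]setTI.
have : measurable_fun setT ((fun x => (x : 'rV[R]_d) - v) : Rd -> Rd).
  apply: row_measurable => i; under eq_fun do rewrite !mxE.
  by apply: measurable_funB => //; exact: coord_measurable.
exact.
Qed.

Lemma shift_bounded v (A : set 'rV[R]_d) : bounded_set A -> bounded_set ((fun x => x - v) @^-1` A).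
Proof.
move=> bA; have [r _ /= H] := pinfty_ex_gt0 bA.
apply: (@bounded_coord _ _ _ (r + `|v|)) => x Ax j.
rewrite (le_trans (coord_le_norm _ _))// -[x](subrK v) (le_trans (ler_normD _ _))// lerD2r.
exact: H.
Qed.

Lemma count_measurable (A : set Rd) : measurable A -> measurable_fun setT (fun w => count X w A).
Proof.
move=> mA; apply: (@measurableT_comp _ _ _ _ _ _ fine); first exact: fine_measurable.
by apply: measurable_kernel; exact: measurableX.
Qed.

Lemma count_cube_moment : moment_le P p cube_moment (fun w => count X w (closed_unit_cube : set Rd)).
Proof.
have p0 : 0 < p by exact: lt_trans p2.
have mc := count_measurable closed_cube_measurable.
have Lp : L1 P (fun w => `|count X w (closed_unit_cube : set Rd)| `^ p).
  apply/integrableP; split.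
    apply/measurable_EFinP; apply: (@measurableT_comp _ _ _ _ _ _ (fun x : R => x `^ p)).
      exact: measurable_powR.
    exact: measurableT_comp.
  move: moment_cube; apply: le_lt_trans; rewrite le_eqVlt; apply/orP; left; apply/eqP.
  apply: eq_integral => w _; rewrite abse_EFin ger0_norm ?powR_ge0// ger0_norm ?count_ge0//.
  rewrite -poweR_EFin /count fineK//; apply: mark_fin => //.
  - exact: closed_cube_measurable.
  - exact: closed_cube_bounded.
split=> //; split=> //; apply: (L1_dom _ (L1_add (L1_cst P 1) Lp)); first exact: measurable_funX.
move=> w; rewrite ger0_norm ?sqr_ge0//.
exact: sqr_le1_powR.
Qed.

Lemma shifted_count_moment v :
  moment_le P p cube_moment (fun w => count X w ((fun x : 'rV[R]_d => x - v) @^-1` closed_unit_cube : set Rd)).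
Proof.
have [[mf L2f] Lpf _] := count_cube_moment.
have mfe : measurable_fun setT (fun N : ES => fine ((N : set S -> \bar R) ((closed_unit_cube : set Rd) `*` setT))).
  by apply: fine_evaluation; apply: measurableX => //; exact: closed_cube_measurable.
have [L2s _] := @stationary_Ex _ _ _ P _ _ X hstat v (fun N : ES => fine ((N : set S -> \bar R) ((closed_unit_cube : set Rd) `*` setT)) ^+ 2) (measurable_funX _ mfe) L2f.
have mp : measurable_fun setT (fun N : ES => `|fine ((N : set S -> \bar R) ((closed_unit_cube : set Rd) `*` setT))| `^ p).
  apply: (@measurableT_comp _ _ _ _ _ _ (fun x : R => x `^ p)); first exact: measurable_powR.
  exact: measurableT_comp.
have [Lps Eps] := @stationary_Ex _ _ _ P _ _ X hstat v _ mp Lpf.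
split.
- split; last exact: L2s.
  by apply: count_measurable; apply: shift_measurable; exact: closed_cube_measurable.
- exact: Lps.
- by rewrite [leLHS]Eps.
Qed.

(** The maximum with 1 secures the condition [1 <= K] of the field estimates; the 2 leaves room for
    a multiplier of absolute value at most 2. *)
Definition score_moment t : R := Num.max 1 ((2 * score_bound pm t) `^ p * cube_moment).

Lemma scoreX_measurable t (A : set Rd) : measurable A ->
  measurable_fun setT (fun w => sc t (X w : set S -> \bar R) A).
Proof.
move=> mA; apply: (@measurableT_comp _ _ _ Omega ES R (fun N : ES => sc t N A) setT (fun w => X w : set S -> \bar R)).
  exact: score_measurable.
by apply: measurable_to_evaluations => B mB; exact: measurable_kernel.
Qed.

(** [A] lies in a translate of the closed unit cube, whose count dominates the score and has the
    moments of the cube at the origin. The multiplier [c] will be the square root of the number of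
    cells over the volume of the window. *)
Lemma score_moment_le t c q (A : set Rd) : `|c| <= 2 -> measurable A -> A `<=` cell q 1 ->
  moment_le P p (score_moment t) (fun w => c * sc t (X w : set S -> \bar R) A).
Proof.
move=> c2 mA AH; have p0 : 0 <= p by rewrite ltW// (lt_trans _ p2).
set T := 2 * score_bound pm t; have T0 : 0 <= T by rewrite mulr_ge0// score_bound_ge0.
set B : set Rd := (fun x : 'rV[R]_d => x - q) @^-1` closed_unit_cube.
have [L2B LpB EB] := shifted_count_moment q.
have AB : A `<=` B.
  move=> x /AH H j; have /andP[a b] := H j; rewrite !mxE subr_ge0 a/= lerBlDl; exact: ltW.
have mB : measurable B by apply: shift_measurable; exact: closed_cube_measurable.
have bB : bounded_set (B : set 'rV[R]_d) by apply: shift_bounded; exact: closed_cube_bounded.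
have E w : `|T * count X w B| `^ p = T `^ p * `|count X w B| `^ p.
  by rewrite normrM powRM// ger0_norm.
have mom : moment_le P p (score_moment t) (fun w => T * count X w B).
  split; first exact: L2_scale.
    by under eq_fun do rewrite E; exact: L1_scale.
  under eq_fun do rewrite E; rewrite Ex_scale// le_max; apply/orP; right.
  by rewrite ler_wpM2l// powR_ge0.
apply: (moment_le_dom p2 _ mom); first by apply: measurable_funM => //; exact: scoreX_measurable.
move=> w; rewrite normrM [leRHS]ger0_norm; last by rewrite mulr_ge0// count_ge0.
rewrite /T -mulrA; apply: ler_pM => //.
have bA : bounded_set (A : set 'rV[R]_d) by exact: bounded_set_sub bB.
have h := score_le Xfin mC pm t w mA bA.
by apply: (le_trans h); rewrite ler_wpM2l ?score_bound_ge0//; apply: count_le.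
Qed.

Lemma score_L2 t q (A : set Rd) : measurable A -> A `<=` cell q 1 ->
  L2 P (fun w => sc t (X w : set S -> \bar R) A).
Proof.
move=> mA Aq; have [|+ _ _] := @score_moment_le t 1 q A _ mA Aq; first by rewrite normr1 ler1n.
by under eq_fun do rewrite mul1r.
Qed.

Lemma Ex_score_shift t q v h : h <= 1 ->
  Ex P (fun w => sc t (X w : set S -> \bar R) (cell (q + v) h)) =
  Ex P (fun w => sc t (X w : set S -> \bar R) (cell q h)).
Proof.
move=> h1; have cq : cell q h `<=` cell q 1.
  by move=> x H j; have /andP[-> /= b] := H j; rewrite (lt_le_trans b)// lerD2l.
have L := L2_L1 (score_L2 t (cell_measurable q h) cq).
have [_ <-] := @stationary_Ex _ _ _ P _ _ X hstat v (fun N : ES => sc t N (cell q h))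
  (score_measurable mC _ t (cell_measurable q h)) L.
by congr Ex; apply/funext => w; rewrite -cell_shift.
Qed.

(** The normalization of [palm_mark]: the mean number of points of the unit cube with mark in [C i]
    is [palm_mark] times the intensity, which is positive and finite. *)
Lemma Ex_score_cube t : Ex P (fun w => sc t (X w : set S -> \bar R) (cell 0 1)) = 0.
Proof.
have mH := cell_measurable (0 : 'rV[R]_d) 1.
have bH := cell_bounded (0 : 'rV[R]_d) 1.
have [cD AD] : measurable (closed_unit_cube : set Rd) /\ (cell 0 1 : set Rd) `<=` closed_unit_cube.
  split; first exact: closed_cube_measurable.
  by rewrite cell_halfopen => x H j; have /andP[-> /= /ltW] := H j.
have LD : L1 P (fun w => count X w (closed_unit_cube : set Rd)).
  by have [L _ _] := count_cube_moment; exact: L2_L1.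
have LC (D : set (borel M)) : measurable D ->
    L1 P (fun w => fine (X w ((cell 0 1 : set Rd) `*` D))).
  move=> mD; apply: (L1_dom _ LD).
    apply: (@measurableT_comp _ _ _ _ _ _ fine); first exact: fine_measurable.
    by apply: measurable_kernel; exact: measurableX.
  move=> w; rewrite ger0_norm ?fine_ge0//.
  apply: fine_le; [exact: mark_fin|apply: mark_fin => //; exact: closed_cube_bounded|].
  by apply: le_measure; rewrite ?inE; [exact: measurableX..|move=> [x m] [/AD]].
have EC (D : set (borel M)) : measurable D ->
    fine (\int[P]_w X w ((halfopen_unit_cube : set Rd) `*` D)) =
    Ex P (fun w => fine (X w ((cell 0 1 : set Rd) `*` D))).
  move=> mD; rewrite -cell_halfopen /Ex; congr fine; apply: eq_integral => w _.
  by rewrite fineK//; exact: mark_fin.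
have LT := LC setT measurableT.
rewrite Ex_sum; last first.
  by move=> i _; apply: L1_scale; apply: L1_sub; [exact: LC|apply: L1_scale; exact: LT].
rewrite big1// => i _; rewrite Ex_scale; last by apply: L1_sub; [exact: LC|apply: L1_scale; exact: LT].
rewrite Ex_sub; [|exact: LC|by apply: L1_scale; exact: LT].
rewrite Ex_scale; last exact: LT.
rewrite /palm_mark -EC//.
have -> : Ex P (fun w => fine (X w ((cell 0 1 : set Rd) `*` setT))) = fine (intensity P X) by rewrite -EC.
rewrite mulrAC mulVf ?mul1r ?subrr ?mulr0//.
by rewrite gt_eqF// fine_gt0.
Qed.

Lemma Ex_score_mesh t q n : (0 < n)%N ->
  Ex P (fun w => sc t (X w : set S -> \bar R) (cell q n%:R^-1)) = 0.
Proof.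
move=> n0; have h0 : 0 < n%:R^-1 :> R by rewrite invr_gt0 ltr0n.
have h1 : n%:R^-1 <= 1 :> R by rewrite invf_le1 ?ltr0n// ler1n.
have E q' : Ex P (fun w => sc t (X w : set S -> \bar R) (cell q' n%:R^-1)) =
    Ex P (fun w => sc t (X w : set S -> \bar R) (cell 0 n%:R^-1)).
  by have := Ex_score_shift t 0 q' h1; rewrite add0r.
have := Ex_score_cube t; rewrite -[X in cell 0 X](mulVf (_ : n%:R != 0)) ?pnatr_eq0 -?lt0n//.
rewrite cell_tiling// (_ : [set: {ffun 'I_d -> 'I_n}] = [set` predT]); last by apply/seteqP; split.
under eq_fun do rewrite (score_bigcup Xfin mC pm t predT _ (cell_trivIset h0)
  (fun i => cell_measurable _ _) (fun i => cell_bounded _ _)).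
rewrite Ex_sum; last first.
  move=> i _; apply: L2_L1; apply: (@score_L2 t (corner 0 n%:R^-1 i)).
    exact: cell_measurable.
  by move=> x H j; have /andP[-> /= b] := H j; rewrite (lt_le_trans b)// lerD2l.
under eq_bigr do rewrite E.
rewrite sumr_const E => /eqP; rewrite mulrn_eq0 => /orP[|/eqP//].
by rewrite (cardE _) -cardE card_ffun !card_ord expn_eq0 (gtn_eqF n0).
Qed.

(* Campbell's formula for a closed set: [W] is the limit of the unions
   of the cubes of mesh [1 / n] that it meets, and each such cube has score of mean 0
   because equal cubes have equal means by stationarity. *)
Lemma Ex_score_inter t q (W : set 'rV[R]_d) : closed W ->
  Ex P (fun w => sc t (X w : set S -> \bar R) (cell q 1 `&` W)) = 0.
Proof.
move=> cW.
pose Qn n (i : {ffun 'I_d -> 'I_n.+1}) := `[< cell (corner q n.+1%:R^-1 i) n.+1%:R^-1 `&` W !=set0 >].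
pose An n : set Rd := \bigcup_(i in [set` @Qn n]) cell (corner q n.+1%:R^-1 i) n.+1%:R^-1.
have h0 n : 0 < n.+1%:R^-1 :> R by [].
have h1 n : n.+1%:R * n.+1%:R^-1 = 1 :> R by rewrite divff.
have tile n : cell q 1 = \bigcup_(i in [set: {ffun 'I_d -> 'I_n.+1}]) cell (corner q n.+1%:R^-1 i) n.+1%:R^-1.
  by rewrite -cell_tiling// mulrC h1.
have Acell n : An n `<=` cell q 1.
  by rewrite (tile n) => x [i _ Hi]; exists i.
have mA n : measurable (An n).
  by apply: fin_bigcup_measurable => // i _; exact: cell_measurable.
have EA n : Ex P (fun w => sc t (X w : set S -> \bar R) (An n)) = 0.
  rewrite /An; under eq_fun do rewrite (score_bigcup Xfin mC pm t (@Qn n) _ (cell_trivIset (h0 n))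
    (fun i => cell_measurable _ _) (fun i => cell_bounded _ _)).
  rewrite Ex_sum; last first.
    move=> i Qi; apply: L2_L1; apply: (@score_L2 t q); first exact: cell_measurable.
    by rewrite (tile n) => x Hx; exists i.
  by rewrite big1// => i _; exact: Ex_score_mesh.
have AnW x n : W x -> cell q 1 x -> An n x.
  move=> Wx; rewrite (tile n) => -[i _ Hi]; exists i => //.
  by apply/asboolP; exists x.
(* Closedness of [W] enters here: a point off [W] has a ball off [W], and a cube of small mesh
   containing the point stays in that ball. *)
have AnNW x : ~ W x -> \forall n \near \oo, ~ An n x.
  move=> NW; have : nbhs x (~` W) by apply: open_nbhs_nbhs; split=> //; exact: closed_openC.
  move=> /nbhs_ballP[e /= e0 He]; near=> n => -[i /asboolP[y [Hy Wy]] Hx].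
  apply: (He y) Wy; split=> // a j; rewrite ord1 /ball/=.
  have /andP[a1 a2] := Hx j; have /andP[b1 b2] := Hy j.
  have ne : n.+1%:R^-1 < e by near: n; exact: near_infty_natSinv_lt (PosNum e0).
  apply: lt_trans ne; rewrite ltr_norml; apply/andP; split.
    by rewrite ltrBrDl ltrBlDr (lt_le_trans b2)// lerD2r.
  by rewrite ltrBlDl (lt_le_trans a2)// lerD2r.
have mW : measurable (W : set Rd) by rewrite -[W]setCK; apply: measurableC; apply: sub_sigma_algebra; exact: closed_openC.
have mc := cell_measurable q 1; have bc := cell_bounded q 1.
have cvgm w (D : set (borel M)) : measurable D ->
    fine (X w (An n `*` D)) @[n --> \oo] --> fine (X w ((cell q 1 `&` W) `*` D)).
  move=> mD; have mB : measurable ((cell q 1 : set Rd) `&` W) by exact: measurableI.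
  apply: fine_cvg; rewrite fineK; last by apply: mark_fin => //; apply: bounded_set_sub bc => x [].
  have I (A : set Rd) : measurable A -> X w (A `*` D) = (\int[X w]_y (\1_(A `*` D) y)%:E)%E.
    by move=> mA'; rewrite integral_indic ?setIT//; exact: measurableX.
  rewrite I//; under eq_fun do rewrite I//.
  apply: (@dominated_cvg _ S R (X w) setT measurableT
    (fun n y => (\1_(An n `*` D) y)%:E) (fun y => (\1_((cell q 1 `&` W) `*` D) y)%:E)
    (fun y => (\1_((cell q 1 : set Rd) `*` setT) y)%:E)).
  - by move=> n; apply/measurable_EFinP; apply: measurable_indic; exact: measurableX.
  - move=> [x m] _; apply: cvg_near_cst; have [Wx|NW] := pselect (W x).
      near=> n; congr EFin; rewrite !indicE; congr (_ : bool)%:R.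
      by apply/idP/idP; rewrite !inE/= => -[Ax Dm]; split=> //; [split=> //; exact: (Acell n)|case: Ax => cx _; exact: AnW].
    have := AnNW x NW; apply: filterS => n NA; congr EFin; rewrite !indicE; congr (_ : bool)%:R.
    by apply/idP/idP; rewrite !inE/= => -[Ax Dm] //; case: Ax.
  - by [].
  - apply/integrableP; split; first by apply/measurable_EFinP; apply: measurable_indic; exact: measurableX.
    under eq_integral do rewrite abse_EFin ger0_norm//.
    rewrite integral_indic ?setIT//; [exact: Xfin|exact: measurableX].
  - move=> n [x m] _; rewrite abse_EFin lee_fin ger0_norm// !indicE ler_nat.
    case: (boolP (_ \in _)) => //; rewrite inE => -[/= Ax _].
    by rewrite mem_set//; split=> //; exact: (Acell n).
have cvgs w : sc t (X w : set S -> \bar R) (An n) @[n --> \oo] -->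
    sc t (X w : set S -> \bar R) (cell q 1 `&` W).
  apply: cvg_big => [|i _]; first exact: add_continuous.
  apply: cvgM; first exact: cvg_cst.
  by apply: cvgB; [exact: cvgm|apply: cvgM; [exact: cvg_cst|exact: cvgm]].
have LD : L1 P (fun w => score_bound pm t * count X w (cell q 1)).
  apply: L1_scale; have [Ls _ _] := shifted_count_moment q; apply: (L1_dom _ (L2_L1 Ls)).
    exact: count_measurable.
  move=> w; rewrite ger0_norm ?count_ge0//; apply: count_le => //.
  - by apply: shift_measurable; exact: closed_cube_measurable.
  - by apply: shift_bounded; exact: closed_cube_bounded.
  - by move=> x H j; have /andP[a b] := H j; rewrite !mxE subr_ge0 a/= lerBlDl; exact: ltW.
have : Ex P (fun w => sc t (X w : set S -> \bar R) (An n)) @[n --> \oo] -->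
    Ex P (fun w => sc t (X w : set S -> \bar R) (cell q 1 `&` W)).
  have LE : L1 P (fun w => sc t (X w : set S -> \bar R) (cell q 1 `&` W)).
    by apply: L2_L1; apply: (@score_L2 t q); [exact: measurableI|move=> x []].
  apply: fine_cvg; rewrite -/(Ex P _) -ExE//.
  apply: (@dominated_cvg _ Omega R P setT measurableT
    (fun n w => (sc t (X w : set S -> \bar R) (An n))%:E)
    (fun w => (sc t (X w : set S -> \bar R) (cell q 1 `&` W))%:E)
    (fun w => (score_bound pm t * count X w (cell q 1))%:E)).
  - by move=> n; apply/measurable_EFinP; exact: scoreX_measurable.
  - by move=> w _; apply: cvg_EFin; [near=> n|exact: cvgs].
  - by [].
  - exact: LD.
  - move=> n w _; rewrite abse_EFin lee_fin.
    have bA : bounded_set (An n : set 'rV[R]_d) by exact: bounded_set_sub bc.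
    have h := score_le Xfin mC pm t w (mA n) bA; apply: (le_trans h).
    by rewrite ler_wpM2l ?score_bound_ge0//; apply: count_le.
under eq_cvg do rewrite EA.
by move=> /(cvg_unique (@norm_hausdorff _ _)) /(_ (cvg_cst _)) ->.
Unshelve. all: by end_near. Qed.

End Scores.

Lemma prob_diff_le1 {R : realFieldType} (a b c : R) : 0 <= a <= 1 -> 0 <= b <= 1 -> 0 <= c <= 1 ->
  `|c - a * b| <= 1.
Proof.
move=> /andP[a0 a1] /andP[b0 b1] /andP[c0 c1].
have ab0 : 0 <= a * b by exact: mulr_ge0.
have ab1 : a * b <= 1 by exact: mulr_ile1.
by rewrite ler_norml; apply/andP; split; lra.
Qed.

Lemma near_cell_coord {R : realFieldType} (o x i j m : R) :
  o + j <= x < o + j + 1 -> i <= j + m -> j <= i + m ->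
  - (m + 2^-1) <= x - (o + i + 2^-1) <= m + 2^-1.
Proof. by move=> /andP[? ?] ? ?; apply/andP; split; lra. Qed.

Lemma far_cell_coord {R : realFieldType} (o x i j m : R) :
  o + j <= x < o + j + 1 -> j + m <= i \/ i + m <= j ->
  - (m - 3 / 2) <= x - (o + i + 2^-1) <= m - 3 / 2 -> False.
Proof. by move=> /andP[? ?] [?|?] /andP[? ?]; lra. Qed.

Lemma cube_neg_coord {R : realFieldType} (x : R) : - (0 - 3 / 2) <= x <= 0 - 3 / 2 -> False.
Proof. by move=> /andP[? ?]; lra. Qed.

(** * Mixing of the field of cells *)

Section MixingIndex.
Context {disp : measure_display} {Omega : measurableType disp} {R : realType}
  (P : probability Omega R) {d : nat} {M : ptopologicalType}.
Local Notation Rd := (borel 'rV[R]_d).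
Local Notation S := (Rd * borel M)%type.
Variable X : R.-ker Omega ~> S.
Hypothesis hstat : stationary P X.
Variables bs bss : R -> R.
Hypothesis hrates : mixing_rates P X bs bss.
Variables (L : nat) (o : 'rV[R]_d).
Local Notation idx := {ffun 'I_d -> 'I_L}.

Local Notation ES := (g_sigma_algebraType (@evaluations R d M)).

(** At 0, outside the domain of [bs], the value is set to 1; the cap 1 holds for any two events. *)
Definition alpha_rate (r : nat) : R := if r == 0%N then 1 else Num.min 1 (bs r%:R).

Lemma two_inv_le_nat (r : nat) : (0 < r)%N -> 2^-1 <= r%:R :> R.
Proof. by move=> r0; apply: (@le_trans _ _ 1); rewrite ?ler1n// invf_le1// ler1n. Qed.

Lemma alpha_rate_ge0 r : 0 <= alpha_rate r.
Proof.
rewrite /alpha_rate; case: eqP => // /eqP r0; rewrite le_min ler01/=.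
by have [H _ _ _] := hrates; apply: H.1; apply: two_inv_le_nat; rewrite lt0n.
Qed.

Lemma alpha_rate_le1 r : alpha_rate r <= 1.
Proof. by rewrite /alpha_rate; case: eqP => // _; rewrite ge_min lexx. Qed.

Lemma alpha_rate_noninc r s : (r <= s)%N -> alpha_rate s <= alpha_rate r.
Proof.
move=> rs; have [->|r0] := eqVneq r 0%N; first exact: alpha_rate_le1.
have s0 : s != 0%N by rewrite -lt0n (leq_trans _ rs)// lt0n.
rewrite /alpha_rate (negPf r0) (negPf s0) le_min ge_min lexx/= ge_min.
have [H _ _ _] := hrates; rewrite H.2 ?orbT// ?ler_nat//; apply: two_inv_le_nat; by rewrite lt0n.
Qed.

Definition center (i : idx) : 'rV[R]_d := corner o 1 i + \row_j 2^-1.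

Definition near_salgebra (i : idx) (m : nat) := region_salgebra X (center i) (cube (m%:R + 2^-1)).
(** A half-open cell at distance [s] may touch the boundary of the cube of half-width [s - 1/2]
    about the center, hence a smaller cube; [3/2] makes the gap an integer:
    [m + r + 2 - 3/2 = (m + 1/2) + r]. *)
Definition far_salgebra (i : idx) (s : nat) := region_salgebra X (center i) (~` cube (s%:R - 3 / 2)).

Lemma grid_mixing_index :
  mixing_index P d alpha_rate (@grid_dist d L) near_salgebra far_salgebra.
Proof.
split.
- exact: grid_dist0.
- exact: grid_dist_sym.
- exact: grid_dist_tri.
- exact: grid_ball.
- by move=> i m; apply: region_sub_salgebra; exact: cube_measurable.
- by move=> i m; apply: region_sub_salgebra; apply: measurableC; exact: cube_measurable.
- move=> i m r mr A B HA HB.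
  have r0 : (0 < r)%N by exact: leq_ltn_trans mr.
  rewrite /alpha_rate gtn_eqF// le_min; apply/andP; split.
    have fP (C : set Omega) : measurable C -> 0 <= fine (P C) <= 1.
      move=> mC.
      rewrite fine_ge0//= -[leRHS]/(fine 1%E); apply: fine_le => //; first exact: fin_num_measure.
      exact: probability_le1.
    have mA : measurable A by apply: sub_salgebra_gen HA; apply: region_sub_salgebra; exact: cube_measurable.
    have mB : measurable B.
      by apply: sub_salgebra_gen HB; apply: region_sub_salgebra; apply: measurableC; exact: cube_measurable.
    by apply: prob_diff_le1; apply: fP => //; exact: measurableI.
  have E : (m + r + 2)%N%:R - 3 / 2 = (m%:R + 2^-1) + r%:R :> R.
    by rewrite !natrD; field.
  move: HA HB; rewrite /far_salgebra E /near_salgebra.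
  apply: (region_mixing hstat hrates); first by rewrite lerDr.
  apply: (@le_trans _ _ (m%:R + 1)); first by rewrite lerD2l invf_le1// ler1n.
  by rewrite natr1 ler_nat.
Qed.

Hypothesis d0 : (0 < d)%N.

Lemma score_adapted {l} (C : 'I_l -> set (borel M)) (pm : 'I_l -> R) (t : 'rV[R]_l) (c : R)
    (A : idx -> set Rd) :
  (forall i, measurable (C i)) -> (forall i, measurable (A i)) ->
  (forall i, A i `<=` cell (corner o 1 i) 1) ->
  adapted (@grid_dist d L) near_salgebra far_salgebra
    (fun i w => c * score C pm t (X w : set S -> \bar R) (A i)).
Proof.
move=> mC mA Acell.
have key i j (K : set Rd) : measurable K -> (forall x, A j x -> K (x - center i)) ->
    meas_for (region_salgebra X (center i) K)
      (fun w => c * score C pm t (X w : set S -> \bar R) (A j)).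
  move=> mK AK; pose A' : set Rd := (fun x : 'rV[R]_d => x - - center i) @^-1` A j.
  have mA' : measurable A' by exact: shift_measurable.
  apply: (@region_meas_for _ _ _ _ _ X _ K (fun N : ES => c * score C pm t N A')) => //.
    by apply: measurable_funM => //; exact: score_measurable.
  move=> w; rewrite score_restrict; last first.
    by move=> x /AK; rewrite opprK addrK.
  rewrite score_shift; congr (_ * score _ _ _ _ _).
  by apply/seteqP; split=> x; rewrite /A'/preimage/= opprK subrK.
split=> i m j ij.
- apply: key; first exact: cube_measurable.
  move=> x /Acell H b; have /andP[x1 x2] := H b; move: x1 x2; rewrite !mxE !mul1r => x1 x2.
  have [h1 h2] := absd_le (elimT (grid_dist_leP _ _ _) ij b).
  by apply: (@near_cell_coord _ _ _ _ (j b)%:R); rewrite ?x1 ?x2// -natrD ler_nat.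
- apply: key; first by apply: measurableC; exact: cube_measurable.
  (* For [m = 0] the excluded cube has half-width [-3/2]; it is empty because there is at least one
     coordinate. *)
  move=> x /Acell H K; have [m0|m0] := posnP m.
    by have := K (Ordinal d0); rewrite m0; exact: cube_neg_coord.
  have [b hb] := grid_dist_ge ij m0.
  have /andP[x1 x2] := H b; move: x1 x2; rewrite !mxE !mul1r => x1 x2.
  have := K b; rewrite !mxE !mul1r; apply: (@far_cell_coord _ _ _ _ (j b)%:R).
    by rewrite x1 x2.
  by rewrite -!natrD !ler_nat; exact: hb.
Qed.

End MixingIndex.

(** * From the integral condition to dyadic sums *)

Lemma bounded_series_tail {R : realType} (u : nat -> R) (B : R) : (forall q, 0 <= u q) ->
  (forall n, \sum_(0 <= q < n) u q <= B) ->
  forall e, 0 < e -> exists Q, forall n, \sum_(Q <= q < n) u q <= e.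
Proof.
move=> u0 uB e e0.
have nd : nondecreasing_seq (fun n => \sum_(0 <= q < n) u q).
  by apply/nondecreasing_seqP => n; rewrite big_nat_recr//= lerDl.
have cv : cvgn (fun n => \sum_(0 <= q < n) u q).
  by apply: nondecreasing_is_cvgn => //; exists B => _ [n _ <-].
have le_l n : \sum_(0 <= q < n) u q <= limn (fun n => \sum_(0 <= q < n) u q).
  exact: nondecreasing_cvgn_le.
move/cvgrPdist_le : cv => /(_ e e0)[Q _ HQ]; exists Q => n.
have [nQ|Qn] := leqP n Q; first by rewrite big_geq// ltW.
have := HQ Q (leqnn _); rewrite /= ger0_norm ?subr_ge0//; apply: le_trans.
by rewrite lerBrDl -big_cat_nat//= ltnW.
Qed.

Section DyadicMass.
Context {R : realType}.
Variables (d : nat) (f : R -> R) (ka : R).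
Hypothesis d0 : (0 < d)%N.
Hypothesis f0 : forall r, 1 <= r -> 0 <= f r.
Hypothesis f_noninc : forall r s, 1 <= r -> r <= s -> f s <= f r.
Hypothesis ka0 : 0 <= ka.
Hypothesis f_int : (\int[lebesgue_measure]_(r in `[1%R, +oo[)
  (r ^+ d.-1 * f r `^ ka)%R%:E < +oo)%E.

Let g (r : R) := r ^+ d.-1 * f r `^ ka.

Let g0 r : 1 <= r -> 0 <= g r.
Proof. by move=> r1; rewrite mulr_ge0 ?powR_ge0// exprn_ge0// (le_trans _ r1). Qed.

Let g_meas : measurable_fun (`[1%R, +oo[%classic : set R) (fun r : R => (g r)%:E).
Proof.
apply/measurable_EFinP; apply: measurable_funM; first exact: measurable_funX.
(* [f] is monotone on [[1, +oo[] only, so it is extended to the left by its value at 1. *)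
apply: (@eq_measurable_fun _ _ _ _ _ (fun r : R => f (Num.max r 1) `^ ka)).
  by move=> r; rewrite inE/= in_itv/= andbT => r1; rewrite max_l.
apply: nonincreasing_measurable => // r s rs.
have m1 (x : R) : 1 <= Num.max x 1 by rewrite le_max lexx orbT.
apply: ge0_ler_powR; rewrite ?nnegrE ?f0//; apply: f_noninc => //.
by rewrite ge_max !le_max rs lexx orbT.
Qed.

Let two_pow_ge1 q : 1 <= 2 ^+ q :> R.
Proof. by rewrite exprn_ege1// ler1n. Qed.

Let sub q n : `[2 ^+ q, 2 ^+ n[%classic `<=` `[(1 : R), +oo[%classic.
Proof.
by move=> r /=; rewrite !in_itv/= andbT => /andP[h _]; exact: le_trans h.
Qed.

(** On the shell the integrand is at least its power at the left end times its rate at the right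
    end, and the length [2^q] raises the exponent [q (d - 1)] to [q d]. *)
Lemma dyadic_shell q :
  ((2 ^+ (q * d) * f (2 ^+ q.+1) `^ ka)%:E <=
    \int[lebesgue_measure]_(r in `[(2 ^+ q)%R, (2 ^+ q.+1)%R[) (g r)%:E)%E.
Proof.
have E : 2 ^+ (q * d) * f (2 ^+ q.+1) `^ ka = (2 ^+ q) ^+ d.-1 * f (2 ^+ q.+1) `^ ka * 2 ^+ q.
  by rewrite mulrAC -exprSr prednK// exprM.
have q12 : 2 ^+ q < 2 ^+ q.+1 :> R by rewrite ltr_eXn2l// ltr1n.
rewrite E EFinM.
have -> : (2 ^+ q : R)%:E = lebesgue_measure (`[2 ^+ q, 2 ^+ q.+1[%classic : set R).
  rewrite lebesgue_measure_itv/= lte_fin q12 -EFinB; congr EFin.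
  by rewrite exprS mulr_natl mulr2n addrK.
rewrite -integral_cst//; apply: ge0_le_integral => //.
- by move=> r _; rewrite lee_fin mulr_ge0 ?powR_ge0// exprn_ge0.
- by apply: measurable_funS g_meas; [exact: measurable_itv|exact: sub].
move=> r /=; rewrite in_itv/= => /andP[qr rq].
have r1 : 1 <= r by exact: le_trans qr.
rewrite lee_fin; apply: ler_pM; rewrite ?powR_ge0 ?exprn_ge0//.
  by apply: lerXn2r => //; rewrite nnegrE ?exprn_ge0// (le_trans _ r1).
apply: ge0_ler_powR => //; rewrite ?nnegrE ?f0//; first by rewrite f_noninc// ltW.
Qed.

Lemma dyadic_sum n :
  ((\sum_(0 <= q < n) 2 ^+ (q * d) * f (2 ^+ q.+1) `^ ka)%:E <=
    \int[lebesgue_measure]_(r in `[1%R, (2 ^+ n)%R[) (g r)%:E)%E.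
Proof.
elim: n => [|n IH].
  by rewrite big_geq// expr0 set_itvxx// integral_set0.
rewrite big_nat_recr//= EFinD.
have -> : `[1%R, 2 ^+ n.+1[%classic = `[1%R, 2 ^+ n[%classic `|` `[2 ^+ n, 2 ^+ n.+1[%classic :> set R.
  by apply: itv_bndbnd_setU; rewrite bnd_simp ?two_pow_ge1// ler_weXn2l// ler1n.
rewrite ge0_integral_setU//=.
- by apply: leeD => //; exact: dyadic_shell.
- apply: measurable_funS g_meas => //.
  by rewrite subUset; split; [rewrite -[1]/(2 ^+ 0); exact: sub|exact: sub].
- by move=> r [|] /=; rewrite in_itv/= lee_fin => /andP[h _]; apply: g0 => //; exact: le_trans h.
- apply/disj_setPS => r [] /=; rewrite !in_itv/= => /andP[_ h1] /andP[h2 _].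
  by have := lt_le_trans h1 h2; rewrite ltxx.
Qed.

Variable al : nat -> R.
Hypothesis al0 : forall r, 0 <= al r.
Hypothesis al_le : forall r, (0 < r)%N -> al r <= f r%:R.

(** Cauchy condensation: the term [q + 1] is at most [2^d] times the integral over the shell [q], so
    the partial sums are bounded. The term 0 has no shell before it and is counted apart. *)
Lemma dyadic_mass_tail (e : R) : 0 < e ->
  exists Q, forall n, \sum_(Q <= q < n) dyadic_mass d al ka q <= e.
Proof.
pose I := fine (\int[lebesgue_measure]_(r in `[1%R, +oo[) (g r)%:E).
have Ifin : (\int[lebesgue_measure]_(r in `[1%R, +oo[) (g r)%:E)%E = I%:E.
  rewrite fineK// ge0_fin_numE//; apply: integral_ge0 => r /=.
  by rewrite in_itv/= andbT => r1; rewrite lee_fin g0.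
have u0 q : 0 <= dyadic_mass d al ka q by rewrite mulr_ge0 ?powR_ge0.
apply: (@bounded_series_tail _ _ (dyadic_mass d al ka 0 + (2 ^ d)%:R * I)) => //.
move=> [|n]; first by rewrite big_geq// addr_ge0// mulr_ge0// -lee_fin -Ifin; apply: integral_ge0 => r /=;
  rewrite in_itv/= andbT => r1; rewrite lee_fin g0.
rewrite big_nat_recl//= lerD2l.
apply: (@le_trans _ _ ((2 ^ d)%:R * \sum_(0 <= q < n) 2 ^+ (q * d) * f (2 ^+ q.+1) `^ ka)).
  rewrite mulr_sumr; apply: ler_sum => q _.
  rewrite /dyadic_mass mulrA -natrX -natrM -expnD -mulSn ler_wpM2l//.
  rewrite -natrX; apply: ge0_ler_powR => //; rewrite ?nnegrE ?f0 ?ler1n ?expn_gt0//.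
  by apply: al_le; rewrite expn_gt0.
rewrite ler_wpM2l// -lee_fin -Ifin; apply: le_trans (dyadic_sum n) _.
apply: ge0_subset_integral => //.
- by move=> r /=; rewrite in_itv/= andbT => r1; rewrite lee_fin g0.
- by rewrite -[1]/(2 ^+ 0); exact: sub.
Qed.

End DyadicMass.

(** [F] contains the cells that meet [W] and possibly others, whose pieces are empty. *)
Record window {R : realType} {d : nat} (L : nat) (o : 'rV[R]_d) (W : set 'rV[R]_d)
    (F : {set {ffun 'I_d -> 'I_L}}) : Prop := Window {
  win_closed : closed W;
  win_box : forall x, W x -> forall j, 0 <= x 0 j - o 0 j < L%:R;
  win_cells : forall i x, cell (corner o 1 i) 1 x -> W x -> i \in F }.

(** The deep cells: [r.*2.+1] is the side of the cube filled by the unit cells at grid distance at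
    most [r]. *)
Definition core {R : realType} {d : nat} (L : nat) (o : 'rV[R]_d) (W : set 'rV[R]_d) (r : nat) :
    {set {ffun 'I_d -> 'I_L}} :=
  [set i | `[< cell (corner o 1 i - \row_j r%:R) (r.*2.+1)%:R `<=` W >]].

Lemma sum_defect_le {R : realFieldType} (I : finType) (F D : {set I}) (s : I -> R) (a b : R) :
  (forall i, i \in D -> `|s i| <= a) -> (forall i, `|s i| <= b) -> 0 <= a -> D \subset F ->
  `|\sum_(i in F) s i| <= a * #|F|%:R + b * (#|F|%:R - #|D|%:R).
Proof.
move=> sa sb a0 DF; apply: le_trans (ler_norm_sum _ _ _) _.
rewrite (bigID (mem D))/=; apply: lerD.
  apply: (@le_trans _ _ (\sum_(i in F) a)); last by rewrite sumr_const mulr_natr.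
  rewrite big_mkcondr; apply: ler_sum => i _; case: ifP => // iD; exact: sa.
rewrite (_ : #|F|%:R - #|D|%:R = #|F :\: D|%:R :> R); last first.
  by rewrite -(cardsID D F) (finset.setIidPr DF) natrD addrC addKr.
rewrite mulr_natr -sumr_const [leRHS](eq_bigl (fun i => (i \in F) && (i \notin D))); last first.
  by move=> i; rewrite !inE andbC.
by apply: ler_sum => i _; exact: sb.
Qed.

Lemma absd_le_of_lt a b r : (a < b + r.+1)%N -> (b < a + r.+1)%N -> (a - b + (b - a) <= r)%N.
Proof. lia. Qed.

Lemma cell_ball_coord {R : realFieldType} (o x : R) (i j r : nat) :
  (i <= j + r)%N -> (j <= i + r)%N -> o + j%:R <= x -> x < o + j%:R + 1 ->
  o + i%:R - r%:R <= x < o + i%:R - r%:R + (r.*2.+1)%:R.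
Proof.
rewrite -!(ler_nat R) !natrD -addnn -natr1 natrD => h1 h2 h3 h4.
by apply/andP; split; lra.
Qed.

Lemma ball_cell_coord {R : realFieldType} (o x : R) (i j r : nat) :
  o + i%:R - r%:R <= x -> x < o + i%:R - r%:R + (r.*2.+1)%:R ->
  o + j%:R <= x -> x < o + j%:R + 1 -> (i - j + (j - i) <= r)%N.
Proof.
rewrite -addnn -natr1 natrD => h1 h2 h3 h4.
by apply: absd_le_of_lt; rewrite -(ltr_nat R) natrD -natr1; lra.
Qed.

(** * Variance and central limit theorem for one window *)

Section WindowVariance.
Context {disp : measure_display} {Omega : measurableType disp} {R : realType}
  (P : probability Omega R) {d : nat} {M : ptopologicalType}.
Local Notation Rd := (borel 'rV[R]_d).
Local Notation S := (Rd * borel M)%type.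
Variable X : R.-ker Omega ~> S.
Hypothesis d0 : (0 < d)%N.
Hypothesis Xfin : forall w (B : set Rd), measurable B -> bounded_set (B : set 'rV[R]_d) ->
  (X w (B `*` setT) < +oo)%E.
Hypothesis hstat : stationary P X.
Hypothesis hint : (0 < intensity P X < +oo)%E.
Variables (l : nat) (C : 'I_l -> set (borel M)).
Hypothesis mC : forall i, measurable (C i).
Variable p : R.
Hypothesis p2 : 2 < p.
Hypothesis moment_cube :
  (\int[P]_w (X w ((closed_unit_cube : set Rd) `*` setT) `^ p) < +oo)%E.
Variables bs bss : R -> R.
Hypothesis hrates : mixing_rates P X bs bss.
Local Notation al := (alpha_rate bs).
Local Notation ka := (1 - 2 / p).
Hypothesis mass_tail : forall e : R, 0 < e ->
  exists Q, forall n, \sum_(Q <= q < n) dyadic_mass d al ka q <= e.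

Local Notation ES := (g_sigma_algebraType (@evaluations R d M)).
Local Notation pm := (fun i => palm_mark P X (C i)).
Local Notation sc t w := (score C pm t (X w : set S -> \bar R)).

Section FixedWindow.
Variables (L : nat) (o : 'rV[R]_d) (W : set 'rV[R]_d) (F : {set {ffun 'I_d -> 'I_L}}).
Hypothesis win : window o W F.
Local Notation idx := {ffun 'I_d -> 'I_L}.

Definition piece (i : idx) : set Rd := cell (corner o 1 i) 1 `&` W.

Lemma window_measurable : measurable (W : set Rd).
Proof.
rewrite -[W]setCK; apply: measurableC; apply: sub_sigma_algebra; apply: closed_openC.
exact: win_closed win.
Qed.

Lemma window_bounded : bounded_set W.
Proof.
apply: bounded_set_sub (cell_bounded o L%:R) => x /(win_box win) H j.
by have := H j; rewrite subr_ge0 ltrBlDl.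
Qed.

Lemma piece_measurable i : measurable (piece i).
Proof. by apply: measurableI; [exact: cell_measurable|exact: window_measurable]. Qed.

Lemma piece_bounded i : bounded_set (piece i : set 'rV[R]_d).
Proof. by apply: bounded_set_sub window_bounded => x []. Qed.

Lemma piece_trivIset : trivIset setT piece.
Proof.
move=> i j _ _ [x [[Hi _] [Hj _]]]; apply: (cell_trivIset (o := o) ltr01) => //.
by exists x.
Qed.

Lemma score_pieces t w (Q : {pred idx}) :
  sc t w (\bigcup_(i in [set` Q]) piece i) = \sum_(i in Q) sc t w (piece i).
Proof.
apply: score_bigcup => //; [exact: piece_trivIset|exact: piece_measurable|exact: piece_bounded].
Qed.

Lemma window_pieces (Q : {pred idx}) (V : set 'rV[R]_d) : V `<=` W ->
  (forall i x, cell (corner o 1 i) 1 x -> W x -> reflect (V x) (i \in Q)) ->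
  V = \bigcup_(i in [set` Q]) piece i.
Proof.
move=> VW H; apply/seteqP; split=> [x Vx|x [i Qi [ci Wx]]]; last exact: (elimT (H i x ci Wx)).
have Wx := VW _ Vx; have [|i Hi] := @cell_cover R d L o 1 x ltr01.
  by move=> j; rewrite mul1r; exact: win_box win _ Wx j.
by exists i; [exact: (introT (H i x Hi Wx))|split].
Qed.

Lemma score_window t w : sc t w W = \sum_(i in F) sc t w (piece i).
Proof.
rewrite -score_pieces; congr (score _ _ _ _ _); apply: window_pieces => // i x ci Wx.
by apply: (iffP idP) => // _; exact: win_cells win _ _ ci Wx.
Qed.

Lemma core_sub_window (r : nat) : core L o W r \subset F.
Proof.
apply/fintype.subsetP => i; rewrite inE => /asboolP H.
have c : cell (corner o 1 i) 1 (corner o 1 i) by move=> j; rewrite lexx ltrDl/=.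
apply: (win_cells win) (c) _; apply: H => j; rewrite !mxE mul1r.
rewrite lerBlDr lerDl ler0n/= -addrA ltrDl addrC subr_gt0 ltr_nat.
by rewrite ltnS -addnn leq_addr.
Qed.

Lemma cell_window_dist (i j : idx) (r : nat) x : cell (corner o 1 j) 1 x ->
  reflect (cell (corner o 1 i - \row_j r%:R) (r.*2.+1)%:R x) (grid_dist i j <= r)%N.
Proof.
move=> H; apply: (iffP (grid_dist_leP _ _ _)) => K a.
  have := H a; have := absd_le (K a); rewrite !mxE !mul1r => -[h1 h2] /andP[x1 x2].
  exact: cell_ball_coord x1 x2.
have := H a; have := K a; rewrite !mxE !mul1r => /andP[k1 k2] /andP[x1 x2].
exact: ball_cell_coord x1 x2.
Qed.

Lemma score_core t w i r : i \in core L o W r ->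
  \sum_(j in F | (grid_dist i j <= r)%N) sc t w (piece j) =
  sc t w (cell (corner o 1 i - \row_j r%:R) (r.*2.+1)%:R).
Proof.
rewrite inE => /asboolP H.
pose Q := [pred j | (j \in F) && (grid_dist i j <= r)%N].
rewrite -(score_pieces t w Q); congr (score _ _ _ _ _); apply/esym/window_pieces => // j x cj Wx.
rewrite inE (win_cells win cj Wx)/=; exact: cell_window_dist.
Qed.

Lemma piece_core t w i r : i \in core L o W r -> sc t w (piece i) = sc t w (cell (corner o 1 i) 1).
Proof.
rewrite inE => /asboolP H; congr (score _ _ _ _ _); apply/seteqP; split=> [x []//|x c].
split=> //; apply: H; apply: elimT (cell_window_dist i r c) _.
by rewrite grid_dist0.
Qed.

Lemma piece_moment t c i : `|c| <= 2 ->
  moment_le P p (score_moment P X C p t) (fun w => c * sc t w (piece i)).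
Proof.
move=> c2; apply: (@score_moment_le _ _ _ P _ _ X Xfin hstat _ C mC p p2 moment_cube t c (corner o 1 i)) => //.
  exact: piece_measurable.
by move=> x [].
Qed.

Lemma piece_adapted t c : adapted (@grid_dist d L) (near_salgebra X o) (far_salgebra X o)
  (fun i w => c * sc t w (piece i)).
Proof. by apply: score_adapted => //; [exact: piece_measurable|move=> i x []]. Qed.

Lemma piece_mean t i : Ex P (fun w => sc t w (piece i)) = 0.
Proof.
apply: (@Ex_score_inter _ _ _ P _ _ X Xfin hstat hint _ C mC p p2 moment_cube).
exact: win_closed win.
Qed.

End FixedWindow.

Lemma score_cell_L2 t q n : L2 P (fun w => sc t w (cell q n%:R)).
Proof.
have T w : sc t w (cell q n%:R) = \sum_(i : {ffun 'I_d -> 'I_n}) sc t w (cell (corner q 1 i) 1).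
  rewrite -(score_bigcup Xfin mC pm t predT w (cell_trivIset ltr01)
    (fun i => cell_measurable _ _) (fun i => cell_bounded _ _)).
  rewrite -[n%:R]mul1r cell_tiling//; congr (score _ _ _ _ _).
  by apply/seteqP; split=> x [i _ Hi]; exists i.
under eq_fun do rewrite T; apply: L2_sum => i _.
by apply: (@score_L2 _ _ _ P _ _ X Xfin hstat _ C mC p p2 moment_cube t (corner q 1 i)) => //; exact: cell_measurable.
Qed.

Lemma score_moment_ge1 t : 1 <= score_moment P X C p t.
Proof. by rewrite le_max lexx. Qed.

(* For [i] in the core, the pieces within distance [r] of [i] fill a cube of side [2 r + 1],
   so the row sum of covariances is a constant [sigma] up to the mixing tail; the rows
   outside the core are few. *)
Lemma window_variance t e : 0 < e -> exists (r : nat) (B sigma : R), 0 <= B /\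
  forall (L : nat) (o : 'rV[R]_d) (W : set 'rV[R]_d) (F : {set {ffun 'I_d -> 'I_L}}),
  window o W F ->
  `|Ex P (fun w => sc t w W ^+ 2) - #|F|%:R * sigma| <=
    e * #|F|%:R + B * (#|F|%:R - #|core L o W r|%:R).
Proof.
move=> e0; set K := score_moment P X C p t; have K1 : 1 <= K by exact: score_moment_ge1.
have al0 : forall r, 0 <= al r by exact: alpha_rate_ge0 hrates.
have al1 : forall r, al r <= 1 by exact: alpha_rate_le1.
have aln : forall r s, (r <= s)%N -> al s <= al r by exact: alpha_rate_noninc hrates.
set CK := 4 + 6 * K ^+ 2.
have CK0 : 0 < CK by rewrite /CK ltr_pwDl// mulr_ge0// sqr_ge0.
have eCK : 0 < e / CK by rewrite divr_gt0.
have [Q Q2 HQ] := field_tails P al0 aln p2 mass_tail eCK.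
have [Ga Ga0 HGa] := field_total P al0 al1 aln p2 mass_tail.
(* A distance larger than [r] is then exactly one in the tail [2^Q <= dist]. *)
pose r := (2 ^ Q).-1.
pose U : Omega -> R := fun w => sc t w (cell 0 1).
pose V : Omega -> R := fun w => sc t w (cell (- \row_j r%:R) (r.*2.+1)%:R).
pose sigma := Ex P (fun w => U w * V w).
exists r, (CK * Ga + `|sigma|), sigma; split.
  by rewrite addr_ge0// mulr_ge0// ltW.
move=> L o W F win.
pose xi (i : {ffun 'I_d -> 'I_L}) (w : Omega) : R := 1 * sc t w (piece o W i).
have xiE i (w : Omega) : xi i w = sc t w (piece o W i) by rewrite /xi mul1r.
have mom i : moment_le P p K (xi i).
  by apply: (piece_moment win); rewrite normr1 ler1n.
have L2i i : L2 P (xi i) by have [] := mom i.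
have ad : adapted (@grid_dist d L) (near_salgebra X o) (far_salgebra X o) xi.
  exact: (piece_adapted win t 1).
have MI := grid_mixing_index hstat hrates L o.
have mean i : Ex P (xi i) = 0.
  by rewrite -[RHS](piece_mean win t i); congr Ex; apply/funext => w; rewrite xiE.
pose c i j := Ex P (fun w => xi i w * xi j w).
have cle i j : `|c i j| <= CK * rate al ka (grid_dist i j).
  have -> : c i j = cov P (xi i) (xi j) by rewrite /cov !mean mul0r subr0.
  by first [apply: (field_davydov al0 p2 K1 MI)|apply: (field_davydov al0 al1 p2 K1 MI)|apply: (field_davydov al0 al1 aln p2 K1 MI)].
have -> : Ex P (fun w => sc t w W ^+ 2) = \sum_(i in F) \sum_(j in F) c i j.
  rewrite -Ex_sqr_sum//; congr Ex; apply/funext => w; congr (_ ^+ 2).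
  by rewrite (score_window win); apply: eq_bigr => i _; rewrite xiE.
have row_le i : `|\sum_(j in F) c i j| <= CK * Ga.
  apply: le_trans (ler_norm_sum _ _ _) _.
  apply: (@le_trans _ _ (\sum_j CK * rate al ka (grid_dist i j))).
    rewrite big_mkcond/=; apply: ler_sum => j _; case: ifP => _; first exact: cle.
    exact: le_trans (cle i j).
  by rewrite -mulr_sumr ler_wpM2l ?(ltW CK0)//; exact: HGa MI _.
rewrite (_ : _ - _ = \sum_(i in F) (\sum_(j in F) c i j - sigma)); last first.
  by rewrite sumrB sumr_const mulr_natl.
apply: sum_defect_le.
- move=> i iD.
  rewrite (bigID (fun j => grid_dist i j <= r)%N)/=.
  have -> : \sum_(j in F | (grid_dist i j <= r)%N) c i j = sigma.
    rewrite /c -Ex_sum; last by move=> j _; exact: L2_mul.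
    pose q := corner o 1 i.
    have sq w (A : set Rd) : sc t w ((fun x : 'rV[R]_d => x - q) @^-1` A) = score C pm t (shifted X q w) A.
      by rewrite score_shift.
    have LUV : L1 P (fun w => U w * V w).
      by apply: L2_mul; [exact: (score_cell_L2 t 0 1)|exact: score_cell_L2].
    have mUV : measurable_fun setT (fun N : ES => score C pm t N (cell 0 1) *
        score C pm t N (cell (- \row_j r%:R) (r.*2.+1)%:R)).
      by apply: measurable_funM; apply: score_measurable => //; exact: cell_measurable.
    (* The two cubes about cell [i] are translates of the two at the origin, so [sigma] depends on
       [r] but neither on [i] nor on the window. *)
    have [_ EE] := @stationary_Ex _ _ _ P _ _ X hstat q _ mUV LUV.
    rewrite /sigma /U /V -[RHS]EE.
    congr Ex; apply/funext => w.
    rewrite -mulr_sumr xiE (piece_core t w iD) -/q.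
    under eq_bigr do rewrite xiE.
    rewrite (score_core win t w iD) -!sq !cell_shift add0r.
    by rewrite [- _ + q]addrC.
  rewrite addrAC subrr add0r; apply: le_trans (ler_norm_sum _ _ _) _.
  apply: (@le_trans _ _ (\sum_(j | (2 ^ Q <= grid_dist i j)%N) CK * rate al ka (grid_dist i j))).
    rewrite big_mkcond [leRHS]big_mkcond/=; apply: ler_sum => j _.
    rewrite -ltnNge /r prednK ?expn_gt0//.
    case: (j \in F) => /=; last first.
      by case: ifP => // _; exact: le_trans (normr_ge0 _) (cle i j).
    by case: ifP => // _; exact: cle.
  rewrite -mulr_sumr; have := HQ Q (leqnn _) _ _ _ _ MI i.
  by rewrite ler_pdivlMr// mulrC.
- by move=> i; apply: le_trans (ler_normB _ _) _; rewrite lerD2r.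
- exact: ltW.
- exact: (core_sub_window win).
Qed.

(** [a] times the score of [W] is the normalized sum of the pieces multiplied by [c], the root of
    the number of cells times [a]. The bound 2 on [c] keeps their moments under one constant for all
    windows. *)
Lemma window_clt t e : 0 < e -> exists n0,
  forall (L : nat) (o : 'rV[R]_d) (W : set 'rV[R]_d) (F : {set {ffun 'I_d -> 'I_L}}) (a : R),
  window o W F -> (n0 <= #|F|)%N -> `|Num.sqrt #|F|%:R * a| <= 2 -> (0 < #|F|)%N -> forall th,
  `|Ex P (fun w => cos (a * sc t w W + th)) -
    expR (- (Ex P (fun w => (a * sc t w W) ^+ 2) / 2)) * cos th| <= e.
Proof.
move=> e0; set K := score_moment P X C p t; have K1 : 1 <= K by exact: score_moment_ge1.
have al0 : forall r, 0 <= al r by exact: alpha_rate_ge0 hrates.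
have al1 : forall r, al r <= 1 by exact: alpha_rate_le1.
have aln : forall r s, (r <= s)%N -> al s <= al r by exact: alpha_rate_noninc hrates.
have [n0 H] := field_clt P d0 al0 al1 aln p2 K1 mass_tail e0.
exists n0 => L o W F a win nF a2 F0 th.
set c := Num.sqrt #|F|%:R * a.
pose xi (i : {ffun 'I_d -> 'I_L}) (w : Omega) : R := c * sc t w (piece o W i).
have E : (fun w => a * sc t w W) = normalized_sum xi F.
  apply/funext => w; rewrite /normalized_sum -mulr_sumr -(score_window win) mulrA; congr (_ * _).
  by rewrite mulrA mulVf ?mul1r// gt_eqF// sqrtr_gt0 ltr0n.
have Ew w : a * sc t w W = normalized_sum xi F w by rewrite -E.
under eq_fun do rewrite Ew; under [X in expR (- (Ex P X / 2))]eq_fun do rewrite Ew.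
apply: (H _ _ _ _ (grid_mixing_index hstat hrates L o)) => //.
- exact: (piece_adapted win t c).
- by move=> i; apply: (piece_moment win).
- move=> i; rewrite /xi Ex_scale; first by rewrite (piece_mean win) mulr0.
  have [|Lm _ _] := @piece_moment L o W F win t 1 i _; first by rewrite normr1 ler1n.
  by apply: L2_L1; move: Lm; under eq_fun do rewrite mul1r.
Qed.

End WindowVariance.

(** * Lebesgue measure of convex windows *)

Section BoxVolumes.
Context {R : realType} {d : nat}.
Implicit Types (a b x : 'rV[R]_d) (c : bool).

(** [c = true] gives [[a, b[], the shape of [cell]; [c = false] gives []a, b]], the shape used in
    [lebesgue_d]. *)
Definition itv_box c a b : set 'rV[R]_d :=
  [set x | forall j, x 0 j \in Interval (BSide c (a 0 j)) (BSide c (b 0 j))].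

Definition box_volume a b : R := \prod_j (b 0 j - a 0 j).

Definition replace_coord x (j : 'I_d) (s : R) : 'rV[R]_d :=
  \row_k (if k == j then s else x 0 k).

(* The indicator of a box after its first [m] coordinates have been integrated out. *)
Definition partial_volume c (m : nat) a b x : R :=
  \prod_(j < d) (if (j < m)%N then b 0 j - a 0 j
           else (x 0 j \in Interval (BSide c (a 0 j)) (BSide c (b 0 j)))%:R).

Definition ordered_box a b := forall j, a 0 j <= b 0 j.

Lemma partial_volume_ge0 c m a b x : ordered_box a b -> 0 <= partial_volume c m a b x.
Proof. by move=> ab; apply: prodr_ge0 => j _; case: ifP => // _; rewrite subr_ge0. Qed.

Lemma partial_volume0 c a b x : partial_volume c 0 a b x = (x \in itv_box c a b)%:R.
Proof.
rewrite /partial_volume; case: (boolP (x \in _)) => [|/negP].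
  by rewrite inE => H; rewrite big1// => j _ /=; rewrite H.
move=> H; have [j Hj] : exists j, x 0 j \notin Interval (BSide c (a 0 j)) (BSide c (b 0 j)).
  apply: contrapT => K; apply: H; rewrite inE => j; apply: contrapT => /negP h.
  by apply: K; exists j.
by rewrite (bigD1 j)//= (negPf Hj) mul0r.
Qed.

Lemma partial_volume_full c a b x : partial_volume c d a b x = box_volume a b.
Proof. by apply: eq_bigr => j _; rewrite ltn_ord. Qed.

Lemma partial_volume_replace c (j : 'I_d) a b x s :
  partial_volume c j a b (replace_coord x j s) =
  \prod_(k < d | k != j) (if (k < j)%N then b 0 k - a 0 k
           else (x 0 k \in Interval (BSide c (a 0 k)) (BSide c (b 0 k)))%:R) *
  \1_[set` Interval (BSide c (a 0 j)) (BSide c (b 0 j))] s.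
Proof.
rewrite /partial_volume (bigD1 j)//= ltnn !mxE eqxx mulrC; congr (_ * _).
  by apply: eq_bigr => k kj; rewrite !mxE (negPf kj).
by rewrite indicE mem_setE.
Qed.

Lemma partial_volumeS c (j : 'I_d) a b x : partial_volume c j.+1 a b x =
  \prod_(k < d | k != j) (if (k < j)%N then b 0 k - a 0 k
           else (x 0 k \in Interval (BSide c (a 0 k)) (BSide c (b 0 k)))%:R) * (b 0 j - a 0 j).
Proof.
rewrite /partial_volume (bigD1 j)//= ltnS leqnn mulrC; congr (_ * _).
by apply: eq_bigr => k kj; rewrite ltnS leq_eqVlt val_eqE (negPf kj).
Qed.

Lemma measurable_partial_volume c (j : 'I_d) a b x :
  measurable_fun setT (fun s => (partial_volume c j a b (replace_coord x j s))%:E).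
Proof.
apply/measurable_EFinP; under eq_fun do rewrite partial_volume_replace.
by apply: measurable_funM => //; apply: measurable_indic; exact: measurable_itv.
Qed.

Lemma integral_partial_volume c (j : 'I_d) a b x : ordered_box a b ->
  (\int[lebesgue_measure]_s (partial_volume c j a b (replace_coord x j s))%:E =
   (partial_volume c j.+1 a b x)%:E)%E.
Proof.
move=> ab; under eq_integral do rewrite partial_volume_replace EFinM.
rewrite ge0_integralZl//; last 2 first.
- by apply/measurable_EFinP; apply: measurable_indic; exact: measurable_itv.
- by rewrite lee_fin; apply: prodr_ge0 => k _; case: ifP => // _; rewrite subr_ge0.
rewrite partial_volumeS EFinM; congr (_ * _)%E.
rewrite integral_indic ?setIT//.
apply: etrans (lebesgue_measure_itv (Interval (BSide c (a 0 j)) (BSide c (b 0 j)))) _ => /=.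
rewrite lte_fin -EFinB; case: ltP => // ba.
by rewrite (@le_anti _ _ (b 0 j) (a 0 j)) ?subrr// ba ab.
Qed.

(** The pointwise inequality between sums of indicators survives the integration of one coordinate
    at a time; at [m = d] the indicators have become volumes. *)
Lemma partial_volume_series (I : Type) (s : seq I) c (a b : I -> 'rV[R]_d)
    (a' b' : nat -> 'rV[R]_d) c' m : (m <= d)%N ->
  (forall i, ordered_box (a i) (b i)) -> (forall k, ordered_box (a' k) (b' k)) ->
  (forall x, (\sum_(i <- s) ((x \in itv_box c (a i) (b i))%:R : R)%:E <=
     \sum_(0 <= k <oo) ((x \in itv_box c' (a' k) (b' k))%:R : R)%:E)%E) ->
  forall x, (\sum_(i <- s) (partial_volume c m (a i) (b i) x)%:E <=
     \sum_(0 <= k <oo) (partial_volume c' m (a' k) (b' k) x)%:E)%E.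
Proof.
move=> md ab ab' H; elim: m md => [_ x|m IH md x].
  under eq_bigr do rewrite partial_volume0.
  by under eq_eseriesr do rewrite partial_volume0.
pose j : 'I_d := Ordinal md.
have -> : (\sum_(i <- s) (partial_volume c m.+1 (a i) (b i) x)%:E =
  \int[lebesgue_measure]_z \sum_(i <- s) (partial_volume c m (a i) (b i) (replace_coord x j z))%:E)%E.
  rewrite ge0_integral_sum//.
  - by apply: eq_bigr => i _; rewrite (integral_partial_volume c j).
  - by move=> i; exact: (measurable_partial_volume c j).
  - by move=> i z _; rewrite lee_fin partial_volume_ge0.
have -> : (\sum_(0 <= k <oo) (partial_volume c' m.+1 (a' k) (b' k) x)%:E =
  \int[lebesgue_measure]_z \sum_(0 <= k <oo) (partial_volume c' m (a' k) (b' k) (replace_coord x j z))%:E)%E.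
  rewrite integral_nneseries//.
  - by apply: eq_eseriesr => k _; rewrite (integral_partial_volume c' j).
  - by move=> k; exact: (measurable_partial_volume c' j).
  - by move=> k z _; rewrite lee_fin partial_volume_ge0.
apply: ge0_le_integral => //.
- by move=> z _; apply: sume_ge0 => i _; rewrite lee_fin partial_volume_ge0.
- by apply: emeasurable_sum => i _; exact: (measurable_partial_volume c j).
- apply: ge0_emeasurable_sum => //.
  + by move=> k z _ _; rewrite lee_fin partial_volume_ge0.
  + by move=> k _; exact: (measurable_partial_volume c' j).
- by move=> z _; apply: IH; exact: ltnW.
Qed.

Lemma box_volume_ge0 a b : ordered_box a b -> 0 <= box_volume a b.
Proof. by move=> ab; apply: prodr_ge0 => j _; rewrite subr_ge0. Qed.

(** The indicators of the disjoint boxes sum to at most 1, and to 0 off [A], while those of a cover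
    of [A] sum to at least 1 on [A]; this is integrated by [partial_volume_series]. *)
Lemma boxes_le_lebesgue (I : finType) (Q : {pred I}) c (a b : I -> 'rV[R]_d) (A : set 'rV[R]_d) :
  (forall i, ordered_box (a i) (b i)) -> trivIset setT (fun i => itv_box c (a i) (b i)) ->
  (forall i, i \in Q -> itv_box c (a i) (b i) `<=` A) ->
  ((\sum_(i in Q) box_volume (a i) (b i))%:E <= lebesgue_d A)%E.
Proof.
move=> ab tr sub; apply: le_ereal_inf_tmp => v [a' [b' [ab' cov ->]]].
have := @partial_volume_series I (enum Q) c a b a' b' false d (leqnn d) ab ab' _ 0.
under eq_eseriesr do rewrite partial_volume_full.
rewrite big_enum/=; under eq_bigr do rewrite partial_volume_full.
rewrite sumEFin; apply=> x; rewrite big_enum/=.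
have [[i Qi xi]|nx] := pselect (exists2 i, i \in Q & itv_box c (a i) (b i) x); last first.
  rewrite big1; first by apply: nneseries_ge0 => k _ _; rewrite lee_fin.
  move=> i Qi; rewrite memNset// => xi; apply: nx; by exists i.
rewrite (bigD1 i)//= big1 ?adde0; last first.
  move=> j /andP[Qj ji]; rewrite memNset// => xj.
  by have := tr i j Logic.I Logic.I (ex_intro _ x (conj xi xj)); move=> ij; rewrite ij eqxx in ji.
rewrite mem_set//; have [k _ xk] := cov _ (sub _ Qi _ xi).
have ge0 n : (0 <= ((x \in itv_box false (a' n) (b' n))%:R : R)%:E)%E by rewrite lee_fin.
apply: le_trans (@nneseries_lim_ge R _ xpredT 0%N k.+1 _) => //.
rewrite big_nat_recr//= (_ : (x \in itv_box false (a' k) (b' k)) = true); last first.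
  by apply: mem_set => n; have := xk n; rewrite in_itv/=.
by rewrite leeDr// sume_ge0// => n _; rewrite lee_fin.
Qed.

(** The list is completed into a sequence by degenerate boxes, of volume 0 as [d] is positive. *)
Lemma lebesgue_le_boxes (s : seq ('rV[R]_d * 'rV[R]_d)) (A : set 'rV[R]_d) : (0 < d)%N ->
  (forall p, p \in s -> ordered_box p.1 p.2) ->
  (forall x, A x -> exists2 p, p \in s & itv_box false p.1 p.2 x) ->
  (lebesgue_d A <= (\sum_(p <- s) box_volume p.1 p.2)%:E)%E.
Proof.
move=> d0 os cov; pose e k := nth (0, 0) s k.
have e_out k : (size s <= k)%N -> e k = (0, 0) by exact: nth_default.
have vol0 : box_volume 0 0 = 0 :> R.
  by rewrite /box_volume (bigD1 (Ordinal d0))//= !mxE subrr mul0r.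
have oe k : ordered_box (e k).1 (e k).2.
  have [ks|ks] := ltnP k (size s); first by apply: os; exact: mem_nth.
  by rewrite e_out.
apply: le_trans (_ : (\sum_(0 <= k <oo) (box_volume (e k).1 (e k).2)%:E <= _)%E).
  apply: ereal_inf_lbound; exists (fun k => (e k).1), (fun k => (e k).2); split=> //.
  move=> x /cov[p ps Hx]; exists (index p s) => // j.
  by have := Hx j; rewrite /e nth_index// in_itv/=.
apply: lime_le; first by apply: is_cvg_nneseries => k _ _; rewrite lee_fin box_volume_ge0.
apply: nearW => N; apply: (@le_trans _ _ (\sum_(0 <= k < size s + N) (box_volume (e k).1 (e k).2)%:E)%E).
  rewrite [leRHS](@big_cat_nat _ _ _ N)//= ?leq_addl//.
  by rewrite leeDl// sume_ge0// => k _; rewrite lee_fin box_volume_ge0.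
rewrite (@big_cat_nat _ _ _ (size s))//= ?leq_addr//.
have -> : (\sum_(size s <= k < size s + N) (box_volume (e k).1 (e k).2)%:E = 0)%E.
  by rewrite big_nat_cond big1// => k /andP[/andP[h _] _]; rewrite e_out// vol0.
rewrite adde0.
by rewrite sumEFin (big_nth (0, 0)) lexx.
Qed.

Definition homothety (c : 'rV[R]_d) (r : R) (A : set 'rV[R]_d) : set 'rV[R]_d :=
  [set x | A (c + r^-1 *: (x - c))].

(** Covers are transported by the homothety; the inverse ratio gives the converse inequality. *)
Lemma lebesgue_homothety_le (c : 'rV[R]_d) (r : R) A : 0 < r ->
  (lebesgue_d (homothety c r A) <= (r ^+ d)%:E * lebesgue_d A)%E.
Proof.
move=> r0; have rd0 : 0 < r ^+ d by exact: exprn_gt0.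
rewrite -lee_pdivrMl//; apply: le_ereal_inf_tmp => v [a [b [ab cov ->]]].
rewrite lee_pdivrMl//; apply: ereal_inf_lbound.
pose T (x : 'rV[R]_d) := c + r *: (x - c).
exists (fun k => T (a k)), (fun k => T (b k)); split.
- by move=> k i; rewrite !mxE lerD2l ler_pM2l// lerD2r.
- move=> x /cov[k _ H]; exists k => // i; have := H i; rewrite !mxE.
  move=> /andP[h1 h2]; apply/andP; split.
    by rewrite -ltrBrDl mulrC -ltr_pdivlMr// mulrC ltrBlDl.
  by rewrite -lerBlDl mulrC -ler_pdivrMr// mulrC lerBrDl.
rewrite -nneseriesZl; last by move=> k _; rewrite lee_fin box_volume_ge0//; exact: ab.
apply: eq_eseriesr => k _; rewrite -EFinM; congr EFin.
have -> : r ^+ d = \prod_(i < d) r by rewrite prodr_const card_ord.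
rewrite -big_split/=; apply: eq_bigr => i _.
by rewrite !mxE; ring.
Qed.

End BoxVolumes.

Lemma ceil_index {R : realType} (L : nat) (y : R) : 0 < y < L%:R ->
  exists n : 'I_L, n%:R < y <= n.+1%:R.
Proof.
move=> /andP[y0 yL]; have ex : exists m, y <= m%:R by exists L; exact: ltW.
case: (ex_minnP ex) => m ym min.
have m0 : (0 < m)%N by rewrite lt0n; apply/eqP => mz; move: ym; rewrite mz leNgt y0.
have mL : (m.-1 < L)%N by rewrite prednK// min// ltW.
exists (Ordinal mL); rewrite /= prednK// ym andbT ltNge; apply/negP => /min.
by rewrite -ltnS prednK// ltnn.
Qed.

Lemma cell_gap1 {R : realFieldType} (q x y : R) : q <= y <= q + 1 -> q <= x < q + 1 -> `|x - y| <= 1.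
Proof. by move=> /andP[? ?] /andP[? ?]; rewrite ler_distl; apply/andP; split; lra. Qed.

Lemma cell_gap {R : realFieldType} (q x y : R) (r : nat) : q < y <= q + 1 ->
  q - r%:R <= x < q - r%:R + (r.*2.+1)%:R -> `|x - y| <= r.+1%:R.
Proof.
rewrite -addnn -!natr1 natrD => /andP[? ?] /andP[? ?].
by rewrite ler_distl; apply/andP; split; lra.
Qed.

Lemma le_pow_double {R : realFieldType} (e : R) n : 1 <= e -> (0 < n)%N -> e <= (2 * e) ^+ n.
Proof.
move=> e1 n0; have e2 : e <= 2 * e by lra.
by apply: (le_trans e2); rewrite -[leLHS]expr1 ler_weXn2l// (le_trans e1).
Qed.

(** * Convex sets and their homothetic images *)

Section ConvexGeometry.
Context {R : realType} {d : nat}.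
Implicit Types (c u x : 'rV[R]_d) (W : set 'rV[R]_d) (s rho : R).

Lemma eucl_normZ r u : 0 <= r -> eucl_norm (r *: u) = r * eucl_norm u.
Proof.
move=> r0; rewrite /eucl_norm -[X in X * _](ger0_norm r0) -sqrtr_sqr -sqrtrM ?sqr_ge0//.
by congr Num.sqrt; rewrite mulr_sumr; apply: eq_bigr => j _; rewrite mxE exprMn.
Qed.

Lemma eucl_norm_le u m : (forall j, `|u 0 j| <= m) -> 0 <= m -> eucl_norm u <= d%:R * m.
Proof.
move=> um m0; rewrite -[leRHS]ger0_norm ?mulr_ge0// -sqrtr_sqr ler_wsqrtr//.
rewrite exprMn; apply: (@le_trans _ _ (\sum_(j < d) m ^+ 2)).
  by apply: ler_sum => j _; rewrite -real_normK ?num_real// lerXn2r ?nnegrE.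
rewrite sumr_const card_ord -[leLHS]mulr_natl ler_wpM2r ?sqr_ge0//.
by rewrite -natrX ler_nat; case: (d) => // n; rewrite leq_pmulr.
Qed.

Lemma convex_set_comb W x y (t : R) : convex_set W -> W x -> W y -> 0 <= t -> t <= 1 ->
  W (t *: x + (1 - t) *: y).
Proof.
move=> cW Wx Wy t0 t1; have := cW x y (Itv01 t0 t1); rewrite !inE => /(_ Wx Wy).
by [].
Qed.

Variables (W : set 'rV[R]_d) (c : 'rV[R]_d) (rho : R).
Hypothesis cW : convex_set W.
Hypothesis ballW : eucl_cball c rho `<=` W.

(** [c + u / s] lies in the ball, hence in [W], and [c + (x + u - c) / (1 + s)] is the convex
    combination of [x] and [c + u / s] with weights [1 / (1 + s)] and [s / (1 + s)]. *)
Lemma convex_expand s x u : 0 < s -> W x -> eucl_norm u <= s * rho -> homothety c (1 + s) W (x + u).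
Proof.
move=> s0 Wx us; have s1 : 0 < 1 + s by rewrite addr_gt0.
have Wc : W (c + s^-1 *: u).
  apply: ballW; rewrite /eucl_cball/= addrAC subrr add0r eucl_normZ ?invr_ge0 ?(ltW s0)//.
  by rewrite ler_pdivrMl.
have t0 : 0 <= (1 + s)^-1 by rewrite invr_ge0 ltW.
have t1 : (1 + s)^-1 <= 1 by rewrite invf_le1// lerDl ltW.
have := convex_set_comb cW Wx Wc t0 t1; rewrite /homothety/=; congr W.
by apply/rowP => j; rewrite !mxE; field; rewrite !gt_eqF.
Qed.

(** If [y] is the image of the point [z] of [W], then [y + u] is the convex combination of [z] and
    [c + u / s] with weights [1 - s] and [s]. *)
Lemma convex_shrink s y u : 0 < s -> s < 1 -> homothety c (1 - s) W y -> eucl_norm u <= s * rho -> W (y + u).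
Proof.
move=> s0 s1 Wy us; have s2 : 0 < 1 - s by rewrite subr_gt0.
have Wc : W (c + s^-1 *: u).
  apply: ballW; rewrite /eucl_cball/= addrAC subrr add0r eucl_normZ ?invr_ge0 ?(ltW s0)//.
  by rewrite ler_pdivrMl.
have t1 : 1 - s <= 1 by rewrite gerBl ltW.
have := convex_set_comb cW Wy Wc (ltW s2) t1; congr W.
by apply/rowP => j; rewrite !mxE; field; rewrite !gt_eqF.
Qed.

Variables (L : nat) (o : 'rV[R]_d).
Hypothesis boxW : forall x, W x -> forall j, 0 < x 0 j - o 0 j < L%:R.
Hypothesis d0 : (0 < d)%N.
Hypothesis rho0 : 0 <= rho.
Local Notation idx := {ffun 'I_d -> 'I_L}.

(* The cells are taken closed here, so that a point of [W] puts into [hitting] both the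
   cell of [cell] and the left-open cell, as used by [lebesgue_d], containing it. *)
Definition hitting : {set idx} :=
  [set i | `[< exists2 x, W x & forall j, corner o 1 i 0 j <= x 0 j <= corner o 1 i 0 j + 1 >]].

Lemma hitting_window : closed W -> window o W hitting.
Proof.
move=> clW; split=> //.
  by move=> x Wx j; have /andP[/ltW -> ->] := boxW Wx j.
move=> i x ci Wx; rewrite inE; apply/asboolP; exists x => // j.
by have /andP[-> /ltW ->] := ci j.
Qed.

Local Notation top i := (corner o 1 i + const_mx 1).

Lemma left_cell_cover x : W x -> exists i : idx, itv_box false (corner o 1 i) (top i) x.
Proof.
move=> Wx; have H j := ceil_index (boxW Wx j).
pose i : idx := [ffun j => projT1 (cid (H j))].
exists i => j; rewrite in_itv/= !mxE ffunE; case: cid => n /= /andP[h1 h2].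
by rewrite mul1r -ltrBrDl h1/= -addrA -lerBlDl natr1.
Qed.

Lemma unit_box_volume (i : idx) : box_volume (corner o 1 i) (top i) = 1 :> R.
Proof. by rewrite /box_volume big1// => j _; rewrite !mxE addrAC subrr add0r. Qed.

Lemma lebesgue_le_cells (A : set 'rV[R]_d) (D : {set idx}) : A `<=` W ->
  (forall i x, A x -> itv_box false (corner o 1 i) (top i) x -> i \in D) ->
  (lebesgue_d A <= #|D|%:R%:E)%E.
Proof.
move=> AW H; apply: (le_trans (@lebesgue_le_boxes _ _ [seq (corner o 1 i, top i) | i <- enum D] A d0 _ _)).
- by move=> p /mapP[i _ ->] j; rewrite /= !mxE lerDl.
- move=> x Ax; have [i Hi] := left_cell_cover (AW _ Ax).
  by exists (corner o 1 i, top i) => //; apply: map_f; rewrite mem_enum; exact: H Hi.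
rewrite big_map big_enum/= (eq_bigr (fun=> 1)); last by move=> i _; exact: unit_box_volume.
by rewrite sumr_const lexx.
Qed.

Lemma lebesgue_le_hitting : (lebesgue_d W <= #|hitting|%:R%:E)%E.
Proof.
apply: lebesgue_le_cells => // i x Wx H; rewrite inE; apply/asboolP; exists x => // j.
by have := H j; rewrite in_itv/= !mxE => /andP[/ltW -> ->].
Qed.

(** A counted cell lies within sup distance 1 of a point of [W], hence within Euclidean distance
    [d <= s rho], and so in the homothetic image of ratio [1 + s]; half-open cells are disjoint. *)
Lemma hitting_le_lebesgue s : 0 < s -> d%:R <= s * rho ->
  ((#|hitting|%:R)%:E <= ((1 + s) ^+ d)%:E * lebesgue_d W)%E.
Proof.
move=> s0 ds; have s1 : 0 < 1 + s by rewrite addr_gt0.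
apply: le_trans (lebesgue_homothety_le c W s1).
have := @boxes_le_lebesgue _ _ _ (mem hitting) true (fun i : idx => corner o 1 i) (fun i => top i) (homothety c (1 + s) W).
rewrite (eq_bigr (fun=> 1)); last by move=> i _; exact: unit_box_volume.
rewrite sumr_const; apply.
- by move=> i j; rewrite !mxE lerDl.
- have E i : itv_box true (corner o 1 i) (top i) = cell (corner o 1 i) 1.
    by apply/seteqP; split=> x H j; have := H j; rewrite in_itv/= !mxE.
  move=> i j _ _ [x [Hi Hj]]; apply: (cell_trivIset (o := o) ltr01) => //; exists x.
  by rewrite -!E.
- move=> i; rewrite inE => /asboolP[y Wy Hy] x Hx.
  rewrite (_ : x = y + (x - y)); last by rewrite addrC subrK.
  apply: convex_expand => //.
  apply: le_trans ds; rewrite -[leRHS]mulr1; apply: eucl_norm_le => // j.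
  have := Hx j; have := Hy j; rewrite in_itv/= !mxE mul1r => a b.
  exact: (cell_gap1 a b).
Qed.

(** If a left-open cell meets the image of ratio [1 - s], its neighbourhood of radius [r] lies
    within sup distance [r + 1] of a point of that image, hence in [W]. The volume of the image is
    bounded below through the inverse homothety. *)
Lemma lebesgue_le_core s (r : nat) : 0 < s -> s < 1 -> d%:R * r.+1%:R <= s * rho ->
  (((1 - s) ^+ d)%:E * lebesgue_d W <= #|core L o W r|%:R%:E)%E.
Proof.
move=> s0 s1 ds; have s2 : 0 < 1 - s by rewrite subr_gt0.
set W' := homothety c (1 - s) W.
have sr0 : 0 <= s * rho by rewrite mulr_ge0// ltW.
have W'W : W' `<=` W.
  move=> y Wy; rewrite -[y]addr0; apply: (convex_shrink s0 s1) => //.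
  by rewrite (le_trans (@eucl_norm_le 0 0 _ _)) ?mulr0// => j; rewrite mxE normr0.
have E : W = homothety c (1 - s)^-1 W'.
  apply/seteqP; split=> x; rewrite /W' /homothety/= invrK addrAC subrr add0r scalerA mulVf ?gt_eqF// scale1r;
  by rewrite addrC subrK.
have := lebesgue_homothety_le c W' (_ : 0 < (1 - s)^-1); rewrite -E invr_gt0 => /(_ s2) h.
apply: le_trans (_ : (lebesgue_d W' <= _)%E).
  by rewrite -lee_pdivlMl ?exprn_gt0// -exprVn.
apply: lebesgue_le_cells => // i y Wy Hy; rewrite inE; apply/asboolP => x Hx.
rewrite -(subrK y x) addrC; apply: (convex_shrink s0 s1) => //.
apply: le_trans ds; apply: eucl_norm_le => // j.
have := Hx j; have := Hy j; rewrite in_itv/= !mxE mul1r => a b.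
exact: (cell_gap a b).
Qed.

(** The ball contains the box of half-width [rho / d >= 1], of volume [(2 rho / d)^d]. The bound is
    crude since only divergence with [rho] is at stake. *)
Lemma inball_volume : d%:R <= rho -> ((rho / d%:R)%:E <= lebesgue_d W)%E.
Proof.
move=> dr; have dR : 0 < d%:R :> R by rewrite ltr0n.
have r0 : 0 <= rho / d%:R by rewrite divr_ge0.
pose m := const_mx (rho / d%:R) : 'rV[R]_d.
have := @boxes_le_lebesgue R d unit predT false (fun=> c - m) (fun=> c + m) W.
rewrite (big_pred1 tt); last by case.
have r1 : 1 <= rho / d%:R by rewrite ler_pdivlMr// mul1r.
move=> H; apply: le_trans (H _ _ _).
- rewrite lee_fin /box_volume (eq_bigr (fun=> 2 * (rho / d%:R))); last by move=> j _; rewrite !mxE; ring.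
  by rewrite prodr_const card_ord; exact: le_pow_double.
- by move=> _ j; rewrite !mxE lerD2l (le_trans _ r0)// oppr_le0.
- by move=> [] [] _ _ _.
- move=> _ _ x Hx; apply: ballW; rewrite /eucl_cball/=.
  have -> : rho = d%:R * (rho / d%:R) by rewrite mulrC divfK// gt_eqF.
  apply: eucl_norm_le => // j; have := Hx j; rewrite in_itv/= !mxE => /andP[a1 a2].
  by rewrite ler_distl (ltW a1).
Qed.

End ConvexGeometry.

(** * Convex averaging sequences *)

Lemma bernoulli_sub {R : realFieldType} (s : R) n : 0 <= s -> s <= 1 -> 1 - n%:R * s <= (1 - s) ^+ n.
Proof.
move=> s0 s1; elim: n => [|n IH]; first by rewrite mul0r subr0 expr0.
rewrite exprSr; apply: (@le_trans _ _ ((1 - n%:R * s) * (1 - s))).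
  rewrite -subr_ge0 (_ : _ - _ = n%:R * s ^+ 2); first by rewrite mulr_ge0 ?sqr_ge0.
  by rewrite -natr1; ring.
by rewrite ler_wpM2r// subr_ge0.
Qed.

(** From [(1 + s)^n (1 - s)^n <= 1] and the lower bound on [(1 - s)^n], with
    [1 / (1 - t) <= 1 + 2 t] for [0 <= t <= 1/2]. *)
Lemma bernoulli_add {R : realFieldType} (s : R) n : 0 <= s -> n%:R * s <= 2^-1 -> s < 1 ->
  (1 + s) ^+ n <= 1 + 2 * (n%:R * s).
Proof.
move=> s0 ns s1; have b := bernoulli_sub n s0 (ltW s1).
have q0 : 0 < 1 - n%:R * s by rewrite subr_gt0; lra.
apply: (@le_trans _ _ (1 - n%:R * s)^-1).
  rewrite -[leRHS]mul1r ler_pdivlMr// (@le_trans _ _ ((1 + s) ^+ n * (1 - s) ^+ n))//.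
    by rewrite ler_wpM2l// exprn_ge0// addr_ge0.
  by rewrite -exprMn exprn_ile1//; nra.
rewrite -[leLHS]mul1r ler_pdivrMr//; move: (n%:R * s) (mulr_ge0 (ler0n R n) s0) ns => t t0 t1.
rewrite -subr_ge0 (_ : _ - _ = t * (1 - 2 * t)); last by ring.
by rewrite mulr_ge0// subr_ge0 -ler_pdivlMl// mulr1.
Qed.

Section AveragingAsymptotics.
Context {R : realType} {d : nat}.
Variable W : nat -> set 'rV[R]_d.
Hypothesis hW : convex_averaging_sequence W.
Hypothesis d0 : (0 < d)%N.

(** Strict inequalities on both sides let the left-open cells of the box cover [W k] as well as the
    right-open ones. *)
Lemma averaging_box k : exists Lo : nat * 'rV[R]_d,
  forall x, W k x -> forall j, 0 < x 0 j - Lo.2 0 j < Lo.1%:R.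
Proof.
have [_ _ cW _] := hW; have [r _ /= H] := pinfty_ex_gt0 (compact_bounded (cW k)).
pose N := (Num.truncn r).+1; have rN : r < N%:R.
  have [r0|r0] := leP 0 r; last by rewrite (lt_trans r0)// ltr0n.
  by have /andP[] := truncn_itv r0.
exists (N.*2, - const_mx N%:R) => x Wx j; rewrite !mxE opprK -addnn natrD.
have := le_lt_trans (le_trans (coord_le_norm x j) (H _ Wx)) rN.
by rewrite ltr_norml => /andP[a b]; rewrite ltrD2r b andbT -ltrBlDr sub0r.
Qed.

Definition box_data k := projT1 (cid (averaging_box k)).
Definition box_size k := (box_data k).1.
Definition box_corner k := (box_data k).2.
Definition cells k := hitting (W k) (box_size k) (box_corner k).
Definition volume k := fine (lebesgue_d (W k)).

Lemma box_dataP k x : W k x -> forall j, 0 < x 0 j - box_corner k 0 j < (box_size k)%:R.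
Proof. by rewrite /box_corner /box_size /box_data; case: cid => Lo /= H; exact: H. Qed.

Lemma averaging_closed k : closed (W k).
Proof.
have [_ _ cW _] := hW; apply: compact_closed (cW k); exact: norm_hausdorff.
Qed.

Lemma averaging_window k : window (box_corner k) (W k) (cells k).
Proof. by apply: hitting_window; [exact: box_dataP|exact: averaging_closed]. Qed.

Lemma lebesgue_volume k : lebesgue_d (W k) = (volume k)%:E.
Proof.
rewrite fineK// ge0_fin_numE.
  by apply: le_lt_trans (lebesgue_le_hitting (@box_dataP k) d0) _; rewrite ltry.
apply: le_ereal_inf_tmp => _ [a [b [ab _ ->]]]; apply: nneseries_ge0 => n _ _.
by rewrite lee_fin; apply: prodr_ge0 => j _; rewrite subr_ge0.
Qed.

Lemma volume_ge0 k : 0 <= volume k.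
Proof.
rewrite -lee_fin -lebesgue_volume.
apply: le_ereal_inf_tmp => _ [a [b [ab _ ->]]]; apply: nneseries_ge0 => n _ _.
by rewrite lee_fin; apply: prodr_ge0 => j _; rewrite subr_ge0.
Qed.

Lemma volume_le_cells k : volume k <= #|cells k|%:R.
Proof. by rewrite -lee_fin -lebesgue_volume; apply: lebesgue_le_hitting => //; exact: box_dataP. Qed.

Lemma inradius_ball (A : R) : \forall k \near \oo,
  exists c rho, A < rho /\ eucl_cball c rho `<=` W k.
Proof.
have [_ _ _ hr] := hW; move/cvgeyPgt : hr => /(_ A); apply: filterS => k.
move=> /ereal_sup_gt[_ [r [r0 [x Wx sub] <-]]]; rewrite lte_fin => Ar.
by exists x, r.
Qed.

Lemma volume_infty (A : R) : \forall k \near \oo, A <= volume k.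
Proof.
have dR : 0 < d%:R :> R by rewrite ltr0n.
have := inradius_ball (Num.max d%:R (A * d%:R)); apply: filterS => k [c [rho [+ sub]]].
rewrite gt_max => /andP[/ltW h1 /ltW h2].
have r0 : 0 <= rho by exact: le_trans h1.
rewrite -lee_fin -lebesgue_volume; have h3 := inball_volume sub d0 r0 h1.
by apply: le_trans h3; rewrite lee_fin ler_pdivlMr.
Qed.

Lemma averaging_counts (r : nat) (e : R) : 0 < e -> e <= 1 -> \forall k \near \oo,
  [/\ 0 < volume k, #|cells k|%:R <= (1 + e) * volume k
    & (1 - e) * volume k <= #|core (box_size k) (box_corner k) (W k) r|%:R].
Proof.
move=> e0 e1; have dR : 0 < d%:R :> R by rewrite ltr0n.
(* With [d s = e / 2] the Bernoulli inequalities give [(1 + s)^d <= 1 + e] and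
   [(1 - s)^d >= 1 - e]. *)
pose s := e / (2 * d%:R); have s0 : 0 < s by rewrite divr_gt0// mulr_gt0.
have ds : d%:R * s = e / 2 by rewrite /s; field; rewrite gt_eqF.
have s1 : s < 1.
  rewrite ltr_pdivrMr ?mulr_gt0// mul1r (le_lt_trans e1)// -natrM ltr1n.
  by rewrite (leq_trans (_ : 1 < 2 * 1)%N)// leq_mul.
have s12 : d%:R * s <= 2^-1 by rewrite ds ler_pdivrMr// mulVf.
near=> k.
have v0 : 0 < volume k by apply: (@lt_le_trans _ _ 1) => //; near: k; exact: volume_infty.
have [c [rho [rr sub]]] : exists c rho, d%:R * r.+1%:R / s < rho /\ eucl_cball c rho `<=` W k.
  by near: k; exact: inradius_ball.
have rs : d%:R * r.+1%:R <= s * rho by rewrite [leRHS]mulrC -ler_pdivrMr// ltW.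
have ds' : d%:R <= s * rho by apply: le_trans rs; rewrite ler_peMr// ler1n.
have rho0 : 0 <= rho by rewrite (le_trans _ (ltW rr))// divr_ge0 ?mulr_ge0// ltW.
have [_ cW _ _] := hW.
split=> //.
  have := hitting_le_lebesgue (cW k) sub (box_size k) (box_corner k) s0 ds'.
  rewrite lebesgue_volume -EFinM lee_fin => h; apply: (le_trans h).
  rewrite ler_wpM2r ?(ltW v0)//; apply: le_trans (bernoulli_add (ltW s0) s12 s1) _.
  by rewrite ds mulrCA divff ?mulr1.
have := lebesgue_le_core (cW k) sub (@box_dataP k) d0 rho0 s0 s1 rs.
rewrite lebesgue_volume -EFinM lee_fin; apply: le_trans.
rewrite ler_wpM2r ?(ltW v0)//; apply: le_trans (bernoulli_sub d (ltW s0) (ltW s1)).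
by rewrite ds lerD2l lerN2 ler_pdivrMr// ler_peMr ?ler1n// ltW.
Unshelve. all: by end_near. Qed.

End AveragingAsymptotics.

(** A Cauchy criterion: [s] may depend on [e], and the limit is not named. The constant [sigma] of
    [window_variance] is of this kind. *)
Lemma cvg_of_near_cst {R : realType} (u : nat -> R) :
  (forall e, 0 < e -> exists s, \forall k \near \oo, `|u k - s| <= e) -> cvgn u.
Proof.
move=> H; apply/cauchy_cvgP/cauchy_exP => e e0.
have e20 : 0 < e / 2 by rewrite divr_gt0.
have [s Hs] := H _ e20; exists s; near=> k => /=.
rewrite -ball_normE/= distrC; apply: le_lt_trans (_ : e / 2 < e); first by near: k.
by rewrite ltr_pdivrMr// ltr_pMr// ltr1n.
Unshelve. all: by end_near. Qed.

(** [E], [n], [c] and [v] stand for the second moment of the score, the numbers of cells and of core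
    cells, and the volume; here [n <= 2 v] and [n - c <= 2 e2 v]. *)
Lemma ratio_near {R : realFieldType} (E n v s e1 e2 B c : R) :
  0 < v -> 0 <= e1 -> 0 <= e2 -> e2 <= 1 -> 0 <= B -> v <= n -> n <= (1 + e2) * v ->
  (1 - e2) * v <= c -> `|E - n * s| <= e1 * n + B * (n - c) ->
  `|E / v - s| <= 2 * e1 + (2 * B + `|s|) * e2.
Proof.
move=> v0 e10 e20 e21 B0 vn nv cv H.
have -> : E / v - s = (E - n * s) / v + s * (n - v) / v by field; rewrite gt_eqF.
apply: le_trans (ler_normD _ _) _.
rewrite !normrM !normfV !(gtr0_norm v0) -mulrDl ler_pdivrMr//.
apply: le_trans (lerD H (lexx _)) _.
have nv' : `|n - v| <= e2 * v.
  by rewrite ger0_norm ?subr_ge0// lerBlDr (le_trans nv)// mulrDl mul1r addrC.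
have h1 : e1 * n <= 2 * e1 * v.
  rewrite -mulrA mulrCA ler_wpM2l// (le_trans nv)// ler_wpM2r ?(ltW v0)//.
  by rewrite -[leRHS]/(1 + 1)%:R lerD2l.
have h2 : B * (n - c) <= 2 * B * (e2 * v).
  by rewrite -mulrA mulrCA ler_wpM2l//; lra.
have h3 : `|s| * `|n - v| <= `|s| * (e2 * v) by rewrite ler_wpM2l.
apply: le_trans (lerD (lerD h1 h2) h3) _.
by rewrite le_eqVlt; apply/orP; left; apply/eqP; ring.
Qed.

Section Fluctuations.
Context {disp : measure_display} {Omega : measurableType disp} {R : realType}
  (P : probability Omega R) {d : nat} {M : ptopologicalType}.
Local Notation Rd := (borel 'rV[R]_d).
Local Notation S := (Rd * borel M)%type.
Variable X : R.-ker Omega ~> S.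
Hypothesis Xfin : forall w (B : set Rd), measurable B -> bounded_set (B : set 'rV[R]_d) ->
  (X w (B `*` setT) < +oo)%E.

Lemma mark_fluctE (W : set 'rV[R]_d) (D : set (borel M)) w : measurable (W : set Rd) ->
  bounded_set W -> measurable D ->
  mark_fluct P X W D w = (Num.sqrt (fine (lebesgue_d W)))^-1 *
    (fine (X w ((W : set Rd) `*` D)) - palm_mark P X D * fine (X w ((W : set Rd) `*` setT))).
Proof.
move=> mW bW mD; rewrite /mark_fluct; congr (_ * _).
have I (A : set S) : measurable A -> (X w A < +oo)%E ->
    (X w).-integrable setT (EFin \o (\1_A : S -> R)) /\ \int[X w]_p (\1_A p) = fine (X w A) :> R.
  move=> mA Afin; split; last by rewrite /Rintegral integral_indic ?setIT.
  apply/integrableP; split; first by apply/measurable_EFinP; exact: measurable_indic.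
  by under eq_integral => q _ do rewrite /= ger0_norm//; rewrite integral_indic ?setIT.
have mWD : measurable ((W : set Rd) `*` D) by exact: measurableX.
have mWT : measurable ((W : set Rd) `*` (setT : set (borel M))) by exact: measurableX.
have fD : (X w ((W : set Rd) `*` D) < +oo)%E by rewrite ltey_eq (mark_fin Xfin).
have [ID ED] := I _ mWD fD; have [IT ET] := I _ mWT (Xfin w mW bW).
have IcT : (X w).-integrable setT (EFin \o (fun p : S => palm_mark P X D * \1_((W : set Rd) `*` setT) p)).
  by apply: eq_integrable (integrableZl _ (palm_mark P X D) IT).
rewrite -ED -ET -RintegralZl// -RintegralB//; apply: eq_Rintegral => -[x m] _ /=.
rewrite !indicE !in_setX/= in_setT andbT.
case: (x \in W); case: (m \in D) => /=; rewrite ?mul1r ?mul0r ?mulr1 ?mulr0 ?subr0//.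
Qed.

End Fluctuations.

(** * Linear forms of the fluctuation vector *)

Section CentralLimit.
Context {disp : measure_display} {Omega : measurableType disp} {R : realType}
  (P : probability Omega R) {d : nat} {M : ptopologicalType}.
Local Notation Rd := (borel 'rV[R]_d).
Local Notation S := (Rd * borel M)%type.
Variable X : R.-ker Omega ~> S.
Hypothesis d0 : (0 < d)%N.
Hypothesis Xfin : forall w (B : set Rd), measurable B -> bounded_set (B : set 'rV[R]_d) ->
  (X w (B `*` setT) < +oo)%E.
Hypothesis hstat : stationary P X.
Hypothesis hint : (0 < intensity P X < +oo)%E.
Variables (l : nat) (C : 'I_l -> set (borel M)).
Hypothesis mC : forall i, measurable (C i).
Variable p : R.
Hypothesis p2 : 2 < p.
Hypothesis moment_cube :
  (\int[P]_w (X w ((closed_unit_cube : set Rd) `*` setT) `^ p) < +oo)%E.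
Variables bs bss : R -> R.
Hypothesis hrates : mixing_rates P X bs bss.
Hypothesis mass_tail : forall e : R, 0 < e ->
  exists Q, forall n, \sum_(Q <= q < n) dyadic_mass d (alpha_rate bs) (1 - 2 / p) q <= e.
Variable W : nat -> set 'rV[R]_d.
Hypothesis hW : convex_averaging_sequence W.

Local Notation pm := (fun i => palm_mark P X (C i)).
Local Notation sc t w := (score C pm t (X w : set S -> \bar R)).
Local Notation vol := (volume W).

Definition fluct_vector k w : 'rV[R]_l := \row_i mark_fluct P X (W k) (C i) w.

Lemma averaging_measurable k : measurable (W k : set Rd).
Proof. exact: window_measurable (averaging_window hW k). Qed.

Lemma averaging_bounded k : bounded_set (W k).
Proof. exact: window_bounded (averaging_window hW k). Qed.

Lemma dotp_fluct t k w : dotp t (fluct_vector k w) = (Num.sqrt (vol k))^-1 * sc t w (W k).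
Proof.
rewrite /dotp mulr_sumr; apply: eq_bigr => i _; rewrite mxE.
rewrite mark_fluctE//; [by rewrite mulrCA|exact: averaging_measurable|exact: averaging_bounded].
Qed.

Lemma score_averaging_L2 t k : L2 P (fun w => sc t w (W k)).
Proof.
have win := averaging_window hW k.
under eq_fun do rewrite (score_window P Xfin mC win).
apply: L2_sum => i _; apply: (@score_L2 _ _ _ P _ _ X Xfin hstat _ C mC p p2 moment_cube t (corner (box_corner hW k) 1 i)).
  exact: (piece_measurable win).
by move=> x [].
Qed.

Lemma dotp_fluct_L2 t k : L2 P (fun w => dotp t (fluct_vector k w)).
Proof. by under eq_fun do rewrite dotp_fluct; apply: L2_scale; exact: score_averaging_L2. Qed.

Lemma Ex_dotp_fluct_sqr t k :
  Ex P (fun w => dotp t (fluct_vector k w) ^+ 2) = Ex P (fun w => sc t w (W k) ^+ 2) / vol k.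
Proof.
under eq_fun do rewrite dotp_fluct exprMn.
rewrite Ex_scale; last by apply: L2_sqr; exact: score_averaging_L2.
by rewrite exprVn sqr_sqrtr ?volume_ge0// mulrC.
Qed.

(** Up to any precision the second moment of the score per cell is a constant, and the number of
    cells is asymptotic to the volume; so the normalized variances are Cauchy. *)
Lemma fluct_variance_cvg t : cvgn (fun k => Ex P (fun w => dotp t (fluct_vector k w) ^+ 2)).
Proof.
apply: cvg_of_near_cst => e e0.
have e40 : 0 < e / 4 by rewrite divr_gt0.
have [r [B [sigma [B0 H]]]] := window_variance d0 Xfin hstat hint mC p2 moment_cube hrates mass_tail t e40.
pose D := 2 * B + `|sigma| + 1.
have D0 : 0 < D by rewrite ltr_wpDl// addr_ge0// mulr_ge0.
pose e2 := Num.min 1 (e / 2 / D).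
have e20 : 0 < e2 by rewrite lt_min ltr01 !divr_gt0.
have e21 : e2 <= 1 by rewrite ge_min lexx.
exists sigma; have := averaging_counts hW d0 r e20 e21; apply: filterS => k [v0 h1 h2].
rewrite Ex_dotp_fluct_sqr.
have h3 : vol k <= #|cells hW k|%:R by exact: volume_le_cells.
have := H _ _ _ _ (averaging_window hW k) => h4.
have := ratio_near v0 (ltW e40) (ltW e20) e21 B0 h3 h1 h2 h4.
move=> h5; apply: (le_trans h5).
rewrite [leRHS](_ : e = 2 * (e / 4) + e / 2); last by field.
rewrite lerD2l; apply: (@le_trans _ _ (D * e2)); first by rewrite ler_wpM2r ?(ltW e20)// lerDl.
by rewrite mulrC -ler_pdivlMr// ge_min lexx orbT.
Qed.

(** With precision 1 in [averaging_counts] the cells number at most twice the volume, so the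
    multiplier of the pieces is at most 2. *)
Lemma fluct_cos_near t e : 0 < e -> \forall k \near \oo, forall th,
  `|Ex P (fun w => cos (dotp t (fluct_vector k w) + th)) -
    expR (- (Ex P (fun w => dotp t (fluct_vector k w) ^+ 2) / 2)) * cos th| <= e.
Proof.
move=> e0.
have [n0 H] := window_clt d0 Xfin hstat hint mC p2 moment_cube hrates mass_tail t e0.
have := averaging_counts hW d0 0 ltr01 (lexx 1).
have := volume_infty hW d0 n0.+1%:R.
apply: filterS2 => k vn [v0 h1 _] th.
under eq_fun do rewrite dotp_fluct; under [X in expR (- (Ex P X / 2))]eq_fun do rewrite dotp_fluct.
have vc : vol k <= #|cells hW k|%:R by exact: volume_le_cells.
have nc : (n0 < #|cells hW k|)%N by rewrite -(ler_nat R) (le_trans vn).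
apply: (H _ _ _ _ _ (averaging_window hW k)); [exact: ltnW| |exact: leq_ltn_trans nc].
rewrite ger0_norm; last by rewrite mulr_ge0 ?invr_ge0 ?sqrtr_ge0.
rewrite ler_pdivrMr ?sqrtr_gt0// -[2](@ger0_norm R 2)// -sqrtr_sqr -sqrtrM ?sqr_ge0//.
rewrite ler_wsqrtr// (le_trans h1)// ler_wpM2r ?(ltW v0)//.
by rewrite expr2 -natrM -[1 + 1]/(2%:R) ler_nat.
Qed.

End CentralLimit.

Lemma Ex_polarization {disp : measure_display} {T : measurableType disp} {R : realType}
    (P : probability T R) (f g : T -> R) : L2 P f -> L2 P g ->
  Ex P (fun w => f w * g w) = (Ex P (fun w => (f w + g w) ^+ 2) -
    Ex P (fun w => f w ^+ 2) - Ex P (fun w => g w ^+ 2)) / 2.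
Proof.
move=> Lf Lg; have Lfg := L2_mul Lf Lg.
rewrite (_ : (fun w => (f w + g w) ^+ 2) = fun w => f w ^+ 2 + 2 * (f w * g w) + g w ^+ 2); last first.
  by apply/funext => w; ring.
rewrite Ex_add; [|by apply: L1_add; [exact: L2_sqr|exact: L1_scale]|exact: L2_sqr].
rewrite Ex_add; [|exact: L2_sqr|exact: L1_scale].
by rewrite Ex_scale//; field.
Qed.

Lemma dotp_delta {R : realType} {l : nat} i (y : 'rV[R]_l) : dotp (delta_mx 0 i) y = y 0 i.
Proof.
rewrite /dotp (bigD1 i)//= mxE !eqxx mul1r big1 ?addr0// => j /negPf ji.
by rewrite mxE ji andbF mul0r.
Qed.

(** The Cramer-Wold device: the limits of the second moments of linear forms define [Sigma] by
    polarization. It is positive semidefinite because [qform Sigma t] is such a limit, and the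
    cosine estimates identify the limit of the characteristic functions. *)
Lemma gaussian_limit {disp : measure_display} {Omega : measurableType disp} {R : realType}
    (P : probability Omega R) (l : nat) (V : nat -> Omega -> 'rV[R]_l) :
  (forall t k, L2 P (fun w => dotp t (V k w))) ->
  (forall t, cvgn (fun k => Ex P (fun w => dotp t (V k w) ^+ 2))) ->
  (forall t e, 0 < e -> \forall k \near \oo, forall th,
    `|Ex P (fun w => cos (dotp t (V k w) + th)) -
      expR (- (Ex P (fun w => dotp t (V k w) ^+ 2) / 2)) * cos th| <= e) ->
  exists Sigma : 'M[R]_l,
    (forall i j, Ex P (fun w => V k w 0 i * V k w 0 j) @[k --> \oo] --> Sigma i j) /\
    exists nu : probability (borel 'rV[R]_l) R,
      gaussian_vector nu 0 Sigma /\
      forall f : 'rV[R]_l -> R, continuous f -> (exists K, forall y, `|f y| <= K) ->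
        Ex P (fun w => f (V k w)) @[k --> \oo] --> Ex nu f.
Proof.
move=> L2V cV cosV.
have L2c k i : L2 P (fun w => V k w 0 i).
  by have := L2V (delta_mx 0 i) k; under eq_fun do rewrite dotp_delta.
pose s t := limn (fun k => Ex P (fun w => dotp t (V k w) ^+ 2)).
pose Sigma : 'M[R]_l := \matrix_(i, j)
  ((s (delta_mx 0 i + delta_mx 0 j) - s (delta_mx 0 i) - s (delta_mx 0 j)) / 2).
have cS i j : Ex P (fun w => V k w 0 i * V k w 0 j) @[k --> \oo] --> Sigma i j.
  have -> : (fun k => Ex P (fun w => V k w 0 i * V k w 0 j)) = fun k =>
      (Ex P (fun w => dotp (delta_mx 0 i + delta_mx 0 j) (V k w) ^+ 2) -
       Ex P (fun w => dotp (delta_mx 0 i) (V k w) ^+ 2) -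
       Ex P (fun w => dotp (delta_mx 0 j) (V k w) ^+ 2)) / 2.
    apply/funext => k; rewrite Ex_polarization//.
    have E (a : R) (b c a' b' c' : R) : a = a' -> b = b' -> c = c' -> (a - b - c) / 2 = (a' - b' - c') / 2.
      by move=> -> -> ->.
    by apply: E; congr Ex; apply/funext => w; rewrite ?dotpD !dotp_delta.
  rewrite mxE; apply: cvgM; last exact: cvg_cst.
  by apply: cvgB; [apply: cvgB|]; exact: cV.
have sq t : s t = qform Sigma t.
  apply: cvg_lim; first exact: norm_hausdorff.
  have -> : (fun k => Ex P (fun w => dotp t (V k w) ^+ 2)) =
      fun k => \sum_i \sum_j t 0 i * t 0 j * Ex P (fun w => V k w 0 i * V k w 0 j).
    apply/funext => k; rewrite /dotp (Ex_sqr_sum (Q := predT)); last by move=> i _; exact: L2_scale.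
    apply: eq_bigr => i _; apply: eq_bigr => j _.
    rewrite -Ex_scale; last exact: L2_mul.
    by congr Ex; apply/funext => w; ring.
  apply: cvg_big => [|i _]; first exact: add_continuous.
  apply: cvg_big => [|j _]; first exact: add_continuous.
  by apply: cvgM; [exact: cvg_cst|exact: cS].
have pS : psd Sigma.
  split=> [i j|t]; first by rewrite !mxE (addrC (delta_mx 0 j)) addrAC.
  rewrite -sq; apply: limr_ge; first exact: cV.
  by apply: nearW => k; exact: Ex_sqr_ge0.
exists Sigma; split=> //; have [nu [gnu Lnu cnu]] := gaussian_exists pS.
exists nu; split=> // f cf [K fK].
(* Strictly above the diagonal of [Sigma], so that it bounds the second moments of the limit and,
   for large [k], those of [V k]. *)
pose B := \sum_i `|Sigma i i| + 1.
have SB i : Sigma i i < B.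
  rewrite (le_lt_trans (ler_norm _))// /B (bigD1 i)//= ltr_pwDr// lerDl.
  by apply: sumr_ge0 => j _.
apply: (levy_continuity (Z := fun y : borel 'rV[R]_l => (y : 'rV[R]_l)) (C := B)) fK => //.
- by near=> k => i.
- have H i : \forall k \near \oo, Ex P (fun w => V k w 0 i ^+ 2) <= B.
    have := cS i i; move/cvgr_lt/(_ _ (SB i)); apply: filterS => k /ltW; apply: le_trans.
    by rewrite le_eqVlt; apply/orP; left; apply/eqP; congr Ex; apply/funext => w; rewrite expr2.
  exact: filter_forall.
- move=> i; have [_ _ /(_ i i)] := gnu; rewrite !mxE; under eq_integral do rewrite !subr0 -expr2.
  rewrite ExE; last by exact: L2_sqr (Lnu i).
  by move=> [E]; apply: ltW; apply: le_lt_trans (SB i); rewrite mxE -E.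
move=> t th; rewrite cnu -sq; apply/cvgrPdist_le => e e0.
have e20 : 0 < e / 2 by rewrite divr_gt0.
have cE : expR (- (Ex P (fun w => dotp t (V k w) ^+ 2) / 2)) * cos th @[k --> \oo] -->
    expR (- (s t / 2)) * cos th.
  apply: cvgM; last exact: cvg_cst.
  apply: (continuous_cvg _ (@continuous_expR R _)); apply: cvgN.
  by apply: cvgM; [exact: cV|exact: cvg_cst].
move/cvgrPdist_le : cE => /(_ _ e20); apply: filterS2 (cosV t _ e20) => k h1 h2.
rewrite [leRHS](splitr e).
apply: le_trans (ler_distD (expR (- (Ex P (fun w => dotp t (V k w) ^+ 2) / 2)) * cos th) _ _) _.
by apply: lerD => //; rewrite distrC.
Unshelve. all: by end_near. Qed.

Theorem theorem3p1 (R : realType) (disp : measure_display)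
    (Omega : measurableType disp) (P : probability Omega R)
    (d : nat) (hd : (0 < d)%N)
    (M : ptopologicalType) (hM : @polish R M)
    (X : R.-ker Omega ~> (borel 'rV[R]_d * borel M)%type)
    (hX : marked_point_process X) (hsimple : simple_point_process P X)
    (hstat : stationary P X)
    (hlambda : (0 < intensity P X < +oo)%E)
    (bs bss : R -> R) (hrates : mixing_rates P X bs bss)
    (hbeta : condition_beta P X bs bss)
    (W : nat -> set 'rV[R]_d) (hW : convex_averaging_sequence W)
    (l : nat) (hl : (0 < l)%N)
    (C : 'I_l -> set (borel M)) (hC : forall i, measurable (C i)) :
  exists Sigma : 'M[R]_l,
    (forall i j : 'I_l,
       'E_P[fun w => (mark_fluct P X (W k) (C i) w *
                      mark_fluct P X (W k) (C j) w)%R]%E @[k --> \oo]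
         --> (Sigma i j)%:E) /\
    exists nu : probability (borel 'rV[R]_l) R,
      gaussian_vector nu 0 Sigma /\
      cvg_in_distribution P
        (fun k w => \row_(i < l) mark_fluct P X (W k) (C i) w) nu.

Proof.
have [delta [de0 mom rate_int _]] := hbeta.
have p2 : 2 < 2 + delta by rewrite ltrDl.
(* For [p = 2 + delta], Davydov's exponent is the one of the integral condition. *)
have ka : 1 - 2 / (2 + delta) = delta / (2 + delta).
  by field; rewrite gt_eqF// (lt_trans _ p2).
have [bs0 _ _ _] := hrates.
have half r : 1 <= r -> 2^-1 <= r :> R by apply: le_trans; rewrite invf_le1// ler1n.
have mass_tail : forall e : R, 0 < e ->
    exists Q, forall n, \sum_(Q <= q < n) dyadic_mass d (alpha_rate bs) (1 - 2 / (2 + delta)) q <= e.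
  rewrite ka; apply: (@dyadic_mass_tail _ d bs) => //.
  - by move=> r /half; exact: bs0.1.
  - by move=> r s /half; exact: bs0.2.
  - by rewrite divr_ge0// ?(ltW de0)// ltW// (lt_trans _ p2).
  - exact: alpha_rate_ge0 hrates.
  - by move=> r r0; rewrite /alpha_rate gtn_eqF// ge_min lexx orbT.
have Xfin := hX.2.
pose V := fluct_vector P X C W.
have L2V := dotp_fluct_L2 Xfin hstat hC p2 mom hW.
have cV := fluct_variance_cvg hd Xfin hstat hlambda hC p2 mom hrates mass_tail hW.
have cosV := fluct_cos_near hd Xfin hstat hlambda hC p2 mom hrates mass_tail hW.
have L2c k i : L2 P (fun w => V k w 0 i).
  by have := L2V (delta_mx 0 i) k; under eq_fun do rewrite dotp_delta.
have [Sigma [cS [nu [gnu cnu]]]] := gaussian_limit L2V cV cosV.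
exists Sigma; split.
  move=> i j; rewrite (_ : (fun k => _) = EFin \o (fun k => Ex P (fun w => V k w 0 i * V k w 0 j))).
    by apply: cvg_EFin; [exact: nearW|exact: cS].
  apply/funext => k /=; rewrite unlock -ExE; last exact: L2_mul.
  by apply: eq_integral => w _; rewrite !mxE.
exists nu; split=> // f cf [K fK].
have Lf k : L1 P (fun w => f (V k w)).
  apply: (@L1_bounded _ _ _ _ _ K) => //; apply: comp_row_measurable => // i.
  exact: L2_meas (L2c k i).
rewrite ExE; last first.
  by apply: (@L1_bounded _ _ _ _ _ K) => //; exact: continuous_borel_measurable.
rewrite (_ : (fun k => _) = EFin \o (fun k => Ex P (fun w => f (V k w)))); last first.
  by apply/funext => k /=; rewrite -ExE.
by apply: cvg_EFin; [exact: nearW|apply: cnu => //; exists K].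
Qed.
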